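(* Let $d\ge 2$. Let $f:\mathbb{R}^d\times[0,\infty)\to\mathbb{R}^d$ be measurable and such that, for some $\epsilon>0$ and a.e. $x\in\mathbb{R}^d$, $t\ge 0$, $$|f(x,t)|\le \epsilon\min\{(1+|x|)^{-d-2},(1+t)^{-(d+2)/2}\},\qquad \|f\|_{L^1(\mathbb{R}^d\times\mathbb{R}^+)}\le\epsilon ,$$ and such that, for some constant $C_f>0$ and all $t\ge0$, $$\big\|\,|x|f(\cdot,t)\big\|_{L^1(\mathbb{R}^d)}\le C_f(1+t)^{-1/2}.$$ Let $a\in L^1(\mathbb{R}^d)^d$ be a divergence-free vector field with $\|a\|_{1}<\epsilon$ and $|a(x)|\le\epsilon(1+|x|)^{-d}$ for a.e. $x$. Assume that $\epsilon$ is small enough (depending only on $d$) for the unique strong solution $u$ of the Navier--Stokes equations described in the context to exist. Define $\mathcal{R}(x,t)$ for $x\ne0$, $t>0$ by $$u(x,t)=e^{t\Delta}a(x)+\mathfrak{K}(x)\int_0^t\!\!\int_{\mathbb{R}^d} f(y,s)\,dy\,ds+\mathcal{R}(x,t).$$ Then there is a constant $C>0$, independent of $x$ and $t$, such that $$|\mathcal{R}(x,t)|\le C|x|^{-d-1}\sqrt t\qquad\text{for all } t>0 \text{ and all } |x|\ge e\sqrt t .$$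
   Context: $\mathfrak{K}(x)=(\mathfrak{K}_{j,k}(x))_{1\le j,k\le d}$ is the matrix of second derivatives of the fundamental solution $E_d$ of $-\Delta$ in $\mathbb{R}^d$: for $x\neq 0$, $$\mathfrak{K}_{j,k}(x)=\partial_{x_j}\partial_{x_k}E_d(x)=\frac{\Gamma(d/2)}{2\pi^{d/2}}\cdot\frac{-\delta_{j,k}|x|^2+d\,x_jx_k}{|x|^{d+2}} .$$ The product of $\mathfrak{K}(x)$ with the vector $\int_0^t\!\int f$ is the matrix-vector product. $\mathbb{P}$ is the Leray projector onto divergence-free fields and $e^{t\Delta}$ the heat semigroup on $\mathbb{R}^d$. For $t>0$ the operator $e^{t\Delta}\mathbb{P}$ is convolution with the smooth matrix kernel $\mathbb{K}(\cdot,t)$ whose Fourier transform is $e^{-t|\xi|^2}(\delta_{j,k}-\xi_j\xi_k/|\xi|^2)$; this defines $e^{t\Delta}\mathbb{P}f$ also for $f\in L^1$, and similarly $e^{t\Delta}\mathbb{P}\nabla\cdot(u\otimes u)$ has $j$-th component $\sum_{h,k}\partial_h\mathbb{K}_{j,k}(\cdot,t)*(u_hu_k)$. Here $f$ is not assumed divergence-free. Strong solution: the Navier--Stokes equations $\partial_tu+u\cdot\nabla u=\Delta u-\nabla p+f$, $\operatorname{div}u=0$, $u(\cdot,0)=a$ in $\mathbb{R}^d$ are understood in the integral form $$u(t)=e^{t\Delta}a-\int_0^te^{(t-s)\Delta}\mathbb{P}\nabla\cdot(u\otimes u)(s)\,ds+\int_0^te^{(t-s)\Delta}\mathbb{P}f(s)\,ds,\qquad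 \operatorname{div}a=0,$$ the values $u(x,t)$, $t>0$, being those of the right-hand side. For $\epsilon$ small enough (depending only on $d$) and $f,a$ satisfying the bounds involving $\epsilon$ in the claim, there is a unique such solution $u$ on $\mathbb{R}^d\times(0,\infty)$ satisfying, for some constant $C>0$, $$|u(x,t)|\le C\epsilon\min\{(1+|x|)^{-d},(1+t)^{-d/2}\},$$ and with $u(t)\to a$ a.e. and in the sense of distributions as $t\to0$. This is the solution $u$ of the claim. *)

(* Defs.v *)
From HB Require Import structures.
From mathcomp Require Import all_boot all_order all_algebra.
From mathcomp Require Import all_classical all_reals all_analysis.

Set Implicit Arguments.
Unset Strict Implicit.
Unset Printing Implicit Defensive.

Import Order.TTheory GRing.Theory Num.Theory.
Import numFieldNormedType.Exports.

Local Open Scope classical_set_scope.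
Local Open Scope ring_scope.

Definition measure_rV_display : measure_display.
Proof. exact: default_measure_display. Qed.

(* 'rV[R]_n carries the sigma-algebra generated by its coordinates, in the same
   way as the library's n.-tuple R; it is the Borel sigma-algebra of R^n. *)
Section measurable_rV.
Context {R : realType} (n : nat).

Let coors : 'I_n -> 'rV[R]_n -> measurableTypeR R := fun i x => x ord0 i.

Let rV_set0 : g_sigma_preimage coors set0.
Proof. exact: sigma_algebra0. Qed.

Let rV_setC A : g_sigma_preimage coors A -> g_sigma_preimage coors (~` A).
Proof. exact: sigma_algebraC. Qed.

Let rV_bigcup (F : _^nat) : (forall i, g_sigma_preimage coors (F i)) ->
  g_sigma_preimage coors (\bigcup_i (F i)).
Proof. exact: sigma_algebra_bigcup. Qed.

HB.instance Definition _ := @isMeasurable.Build measure_rV_display 'rV[R]_n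
  (g_sigma_preimage coors) rV_set0 rV_setC rV_bigcup.

End measurable_rV.

Lemma measurable_coord (R : realType) n (i : 'I_n) :
  measurable_fun [set: 'rV[R]_n]
    (fun x : 'rV[R]_n => x ord0 i : measurableTypeR R).
Proof.
move=> _ Y mY; rewrite setTI; apply: sub_sigma_algebra => /=.
rewrite -bigcup_seq/=; exists i => /=; first by rewrite mem_index_enum.
by exists Y => //; rewrite setTI.
Qed.

Lemma measurable_fun_rVP (R : realType) d (T : measurableType d) n
    (f : T -> 'rV[R]_n) :
  (forall i, measurable_fun [set: T] (fun x => f x ord0 i : measurableTypeR R)) ->
  measurable_fun [set: T] f.
Proof.
move=> mf _ A mA; rewrite setTI.
suff : [set B | measurable (f @^-1` B)] A by [].
move: A mA; apply: smallest_sub.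
  split => [|B /= mB|F /= mF].
  - by rewrite /= preimage_set0.
  - by rewrite setTD preimage_setC; exact: measurableC.
  - by rewrite preimage_bigcup; exact: bigcup_measurable.
rewrite -bigcup_seq/= => B [i _] [C mC <-] /=.
by rewrite setTI; have := mf i measurableT C mC; rewrite setTI.
Qed.

Section lebesgue_measure_rV.
Context {R : realType}.

Definition rV_cons n (p : 'rV[R]_n * measurableTypeR R) : 'rV[R]_n.+1 :=
  row_mx (p.2%:M : 'rV[R]_1) p.1.

Lemma measurable_rV_cons n : measurable_fun setT (@rV_cons n).
Proof.
apply: measurable_fun_rVP => i; rewrite /rV_cons.
case: (@split_ordP 1 n i) => k ->.
  rewrite (_ : (fun _ => _) = snd); first exact: measurable_snd.
  by apply/funext => x; rewrite (@row_mxEl _ 1 1 n) mxE (ord1 k) mulr1n.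
rewrite (_ : (fun _ => _) =
    (fun y : 'rV[R]_n => y ord0 k : measurableTypeR R) \o fst).
  by apply: measurableT_comp => //; exact: measurable_coord.
by apply/funext => x; rewrite (@row_mxEr _ 1 1 n).
Qed.

Section extend.
Context n (mu : {measure set 'rV[R]_n -> \bar R}).

Definition rV_cons_measure : set 'rV[R]_n.+1 -> \bar R :=
  pushforward (mu \x lebesgue_measure)%E (@rV_cons n).

Let rV_cons_measure0 : rV_cons_measure set0 = 0%E.
Proof. by rewrite /rV_cons_measure /pushforward preimage_set0 measure0. Qed.

Let rV_cons_measure_ge0 A : (0 <= rV_cons_measure A)%E.
Proof. by rewrite /rV_cons_measure /pushforward; exact: measure_ge0. Qed.

Let rV_cons_measure_sigma_additive : semi_sigma_additive rV_cons_measure.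
Proof.
move=> F mF tF mUF.
rewrite /rV_cons_measure /pushforward preimage_bigcup.
have mP A : measurable A -> measurable (@rV_cons n @^-1` A).
  by move=> mA; rewrite -[X in measurable X]setTI; exact: measurable_rV_cons.
apply: measure_semi_sigma_additive.
- by move=> k; exact: mP.
- apply/trivIsetP => /= i j _ _ ij; rewrite -preimage_setI.
  by move/trivIsetP : tF => /(_ _ _ _ _ ij) ->//; rewrite preimage_set0.
- by rewrite -preimage_bigcup; exact: mP.
Qed.

HB.instance Definition _ := isMeasure.Build _ _ _ rV_cons_measure
  rV_cons_measure0 rV_cons_measure_ge0 rV_cons_measure_sigma_additive.

End extend.

(* Lebesgue measure on R^n: the n-fold product of lebesgue_measure, carried to
   row vectors; the Dirac mass at the only point of R^0 starts the recursion. *)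
Fixpoint lebesgue_rV n : {measure set 'rV[R]_n -> \bar R} :=
  if n is m.+1 then rV_cons_measure (lebesgue_rV m) else \d_(0 : 'rV[R]_0).

End lebesgue_measure_rV.

Local Notation leb := lebesgue_measure.

Section euclidean.
Context {R : realType} {d : nat}.
Implicit Types x y : 'rV[R]_d.

Definition dotp x y : R := \sum_i x ord0 i * y ord0 i.

(* The library's `|x| on 'rV[R]_d is the sup norm. *)
Definition enorm x : R := Num.sqrt (dotp x x).

Definition partial (i : 'I_d) (g : 'rV[R]_d -> R) : 'rV[R]_d -> R :=
  'D_(delta_mx ord0 i) g.

(* foldr partial phi s is the iterated partial derivative of phi along s. *)
Definition test_function (phi : 'rV[R]_d -> R) :=
  (forall (s : seq 'I_d) x, differentiable (foldr partial phi s) x) /\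
  (exists r : R, forall x, r < enorm x -> phi x = 0).

Definition divergence_free (a : 'rV[R]_d -> 'rV[R]_d) :=
  forall phi, test_function phi ->
    \sum_j \int[lebesgue_rV d]_x (a x ord0 j * partial j phi x) = 0.

End euclidean.

Section kernels.
Context {R : realType} {d : nat}.
Implicit Types x y : 'rV[R]_d.

Definition Gamma (s : R) : R :=
  \int[leb]_(r in `]0%R, +oo[) (r `^ (s - 1) * expR (- r)).

(* Second derivatives of the fundamental solution of minus the Laplacian. *)
Definition kernelE x : 'M[R]_d :=
  \matrix_(j, k) (Gamma (d%:R / 2) / (2 * pi `^ (d%:R / 2)) *
    ((- (j == k)%:R * enorm x ^+ 2 + d%:R * x ord0 j * x ord0 k)
      / enorm x ^+ (d + 2))).

Definition heat_kernel x (t : R) : R :=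
  (4 * pi * t) `^ (- (d%:R / 2)) * expR (- (enorm x ^+ 2 / (4 * t))).

(* Symbol of the heat semigroup composed with the Leray projector; its value at
   the single point xi = 0 is irrelevant. *)
Definition leray_symbol (xi : 'rV[R]_d) (t : R) : 'M[R]_d :=
  \matrix_(j, k) (expR (- (t * enorm xi ^+ 2)) *
    ((j == k)%:R - xi ord0 j * xi ord0 k / enorm xi ^+ 2)).

(* Inverse Fourier transform of leray_symbol, for the convention
   (F g)(xi) = \int g(x) exp(- i x.xi) dx.  The symbol is real, even and, for
   t > 0, integrable, so exp(i x.xi) contributes only its real part. *)
Definition leray_kernel x (t : R) : 'M[R]_d :=
  \matrix_(j, k) ((2 * pi) ^- d *
    \int[lebesgue_rV d]_xi (cos (dotp x xi) * leray_symbol xi t j k)).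

End kernels.

Section navier_stokes.
Context {R : realType} {d : nat}.
Implicit Types (x y : 'rV[R]_d) (a : 'rV[R]_d -> 'rV[R]_d).
(* Space-time fields; only times t >= 0 matter. *)
Implicit Types f u v : 'rV[R]_d -> R -> 'rV[R]_d.

Definition heat_evol (t : R) a x : 'rV[R]_d :=
  \row_j \int[lebesgue_rV d]_y (heat_kernel (x - y) t * a y ord0 j).

Definition leray_evol (t : R) a x : 'rV[R]_d :=
  \row_j \sum_k
    \int[lebesgue_rV d]_y (leray_kernel (x - y) t j k * a y ord0 k).

(* The operator exp(t Laplacian) P div acting on the tensor field T. *)
Definition leray_div_evol (t : R) (T : 'rV[R]_d -> 'M[R]_d) x : 'rV[R]_d :=
  \row_j \sum_h \sum_k
    \int[lebesgue_rV d]_y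
      (partial h (fun z => leray_kernel z t j k) (x - y) * T y h k).

Definition tensor_square (v : 'rV[R]_d) : 'M[R]_d :=
  \matrix_(h, k) (v ord0 h * v ord0 k).

Definition time_integral (t : R) (w : R -> 'rV[R]_d) : 'rV[R]_d :=
  \row_j \int[leb]_(s in `]0, t[) w s ord0 j.

Definition space_integral a : 'rV[R]_d :=
  \row_j \int[lebesgue_rV d]_y a y ord0 j.

(* The integrals over s avoid the endpoints, where leray_kernel _ 0 and u _ 0
   are meaningless. *)
Definition mild_rhs a f u x (t : R) : 'rV[R]_d :=
  heat_evol t a x
  - time_integral t
      (fun s => leray_div_evol (t - s) (fun y => tensor_square (u y s)) x)
  + time_integral t (fun s => leray_evol (t - s) (f ^~ s) x).

Definition force_condition (eps : R) f :=
  [/\ measurable_fun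
        [set z : 'rV[R]_d * measurableTypeR R | 0 <= z.2]
        (fun z => f z.1 z.2),
      {ae (lebesgue_rV d \x leb)%E, forall z, 0 <= z.2 ->
        enorm (f z.1 z.2) <= eps *
          Num.min ((1 + enorm z.1) `^ (- (d%:R + 2)))
                  ((1 + z.2) `^ (- ((d%:R + 2) / 2)))},
      (\int[(lebesgue_rV d \x leb)%E]_(z in [set z | (0 <= z.2)%R])
        (enorm (f z.1 z.2))%:E <= eps%:E)%E &
      exists2 Cf : R, 0 < Cf & forall t : R, 0 <= t ->
        (\int[lebesgue_rV d]_y (enorm y * enorm (f y t))%:E
          <= (Cf * (1 + t) `^ (- 2^-1))%:E)%E].

Definition datum_condition (eps : R) a :=
  [/\ measurable_fun setT a,
      divergence_free a,
      (\int[lebesgue_rV d]_x (enorm (a x))%:E < eps%:E)%E &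
      {ae lebesgue_rV d, forall x,
        enorm (a x) <= eps * (1 + enorm x) `^ (- d%:R)}].

Definition strong_solution (eps : R) a f u :=
  [/\ measurable_fun
        [set z : 'rV[R]_d * measurableTypeR R | 0 < z.2]
        (fun z => u z.1 z.2),
      exists2 C : R, 0 < C & forall x (t : R), 0 < t ->
        enorm (u x t) <= C * eps *
          Num.min ((1 + enorm x) `^ (- d%:R)) ((1 + t) `^ (- (d%:R / 2))),
      forall x (t : R), 0 < t -> u x t = mild_rhs a f u x t,
      {ae lebesgue_rV d, forall x, u x t @[t --> 0^'+] --> a x} &
      forall phi j, test_function phi ->
        (\int[lebesgue_rV d]_x (u x t ord0 j * phi x)) @[t --> 0^'+]
          --> (\int[lebesgue_rV d]_x (a x ord0 j * phi x) : R)].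

(* u itself is unconstrained at t <= 0, hence uniqueness on t > 0 only. *)
Definition unique_strong_solution (eps : R) a f u :=
  strong_solution eps a f u /\
  forall v, strong_solution eps a f v ->
    forall x (t : R), 0 < t -> v x t = u x t.

End navier_stokes.

(* Main.v *)
Require Import Defs.
From HB Require Import structures.
From mathcomp Require Import all_boot all_order all_algebra.
From mathcomp Require Import all_classical all_reals all_analysis.
From mathcomp Require Import measurable_realfun zify ring lra.

Set Implicit Arguments.
Unset Strict Implicit.
Unset Printing Implicit Defensive.

Import Order.TTheory GRing.Theory Num.Theory.
Import numFieldNormedType.Exports.

Local Open Scope classical_set_scope.
Local Open Scope ring_scope.

Local Notation leb := lebesgue_measure.

(* The terms of u - heat_evol t a - kernelE * (integral of f) are the two Duhamel
   integrals, the second one being compared with its leading term.  Since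
   1 / |xi|^2 exp(- tau |xi|^2) is the integral of exp(- s |xi|^2) over s > tau,
   the kernel of exp(tau Laplacian) P is
     delta_jk G(z, tau) + \int_{s > tau} d_j d_k G(z, s) ds
   for the heat kernel G, while kernelE z is \int_{s > 0} d_j d_k G(z, s) ds.
   Gaussian decay of G then bounds the former by (tau + |z|^2)^(-d/2), its
   increments by |w| (tau + |z|^2)^(-(d+1)/2), and its distance to kernelE z by
   sqrt tau |z|^(-d-1).  In both Duhamel integrals, splitting according to
   whether y or x - y is of size at least |x| / 2 extracts the factor
   |x|^(-d-1); what is left integrates over space to the inverse square roots
   of 1 + s and t - s, hence over ]0, t[ to a multiple of sqrt t. *)

(** The symbol of the projector is discontinuous at frequency 0, so the decay of its kernel cannot
    be drawn from smoothness of the symbol. Removing the denominator by a time integral leaves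
    Gaussians only, whose transforms are explicit and can be computed with real phases. The
    borderline is the power [d]: [br tau z ^- d] is not integrable over the space, while
    [br tau z ^- (d + 1)] is, at the price of [tau ^ (-1/2)], which is integrable in time. Every
    splitting therefore aims at the power [d + 1]. In the drift term the derivative of the kernel
    supplies it. In the force term it comes either from the increment of the kernel between [x - y]
    and [x], paid for by the first moment of [f], or from the surplus decay of [f] when [y] is far
    out. The bound on [u] holds at every point, so the nested integrals of the drift are estimated
    one inside the other. The force is bounded only almost everywhere in space-time, and its leading
    term has to be subtracted under the integral sign: it is handled as one integral over the
    product space and brought back by Fubini. *)

Section sigma_finite_rV.
Context {R : realType}.

Lemma rV_cons0 n (p : 'rV[R]_n * measurableTypeR R) :
  rV_cons p ord0 ord0 = p.2.
Proof.
rewrite /rV_cons (_ : ord0 = @lshift 1 n ord0); last exact/val_inj.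
by rewrite (@row_mxEl _ 1 1 n) mxE mulr1n.
Qed.

Lemma rV_consS n (p : 'rV[R]_n * measurableTypeR R) (i : 'I_n) :
  rV_cons p ord0 (lift ord0 i) = p.1 ord0 i.
Proof.
rewrite /rV_cons (_ : lift ord0 i = @rshift 1 n i); last exact/val_inj.
by rewrite (@row_mxEr _ 1 1 n).
Qed.

Let box n (k : nat) : set 'rV[R]_n :=
  \bigcap_(i in [set: 'I_n]) [set y | y ord0 i \in `[- k%:R, k%:R]].

Let measurable_box n k : measurable (@box n k).
Proof.
apply: fin_bigcap_measurable => [|i _]; first exact: finite_finset.
have := @measurable_coord R n i measurableT `[- k%:R, k%:R]%classic.
by rewrite setTI; apply; exact: measurable_itv.
Qed.

Let lebesgue_rV_box n k : (lebesgue_rV n (@box n k) < +oo)%E.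
Proof.
elim: n => [|n IH] /=.
  by rewrite diracE; case: (_ \in _); rewrite ltry.
rewrite /rV_cons_measure /pushforward.
rewrite (_ : _ @^-1` _ = @box n k `*` `[- k%:R, k%:R]%classic); last first.
  apply/seteqP; split => /= p Hp.
    split => [i _|]; first by have := Hp (lift ord0 i) I; rewrite /= rV_consS.
    by have := Hp ord0 I; rewrite /= rV_cons0.
  case: Hp => Hp1 Hp2 i _ /=.
  by case: (unliftP ord0 i) => [j ->|->]; rewrite ?rV_consS ?rV_cons0//; exact: Hp1.
rewrite product_measure1E//; last exact: measurable_box.
rewrite lte_mul_pinfty//.
  by rewrite ge0_fin_numE.
have := @lebesgue_measure_itv R `[- k%:R, k%:R] => /= ->.
by case: ifP => _; rewrite ltry.
Qed.

(** The cubes [box n k] cover the space, and each has finite measure. Tonelli and Fubini ask for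
    this of every factor of a product. *)
Let sigma_finite_rV n : sigma_finite [set: 'rV[R]_n] (lebesgue_rV n).
Proof.
exists (@box n); last by move=> k; split; [exact: measurable_box|exact: lebesgue_rV_box].
apply/esym/seteqP; split => // y _.
exists (Num.bound `|y|) => // i _ /=.
rewrite in_itv/= -ler_norml.
have Hi : `|y ord0 i| <= `|y|.
  rewrite [leRHS]/Num.Def.normr/= mx_normrE.
  exact: (le_bigmax_cond _ (fun ij => `|y ij.1 ij.2|) (j := (ord0, i))).
exact: le_trans Hi (ltW (archi_boundP (normr_ge0 _))).
Qed.

(* lebesgue_rV is a Fixpoint with values in bundled measures: the sigma-finite
   instance needs a constant that is the underlying set function. *)
Definition lebn_fun n : set 'rV[R]_n -> \bar R := lebesgue_rV n.

HB.instance Definition _ n := Measure.on (@lebn_fun n).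
HB.instance Definition _ n :=
  @Measure_isSigmaFinite.Build _ _ _ (@lebn_fun n) (@sigma_finite_rV n).

Definition lebn n : {sigma_finite_measure set 'rV[R]_n -> \bar R} := @lebn_fun n.

End sigma_finite_rV.

(** * Integrals and Fubini *)

Section integral_tools.
Local Open Scope ereal_scope.
Context d (T : measurableType d) (R : realType).
Variable mu : {measure set T -> \bar R}.

(** The integral of a nonnegative function is a supremum over the simple functions below it, so it
    is monotone for arbitrary functions. *)
Lemma ge0_integral_mono (D : set T) (f g : T -> \bar R) :
  (forall x, D x -> 0 <= f x) -> (forall x, D x -> f x <= g x) ->
  \int[mu]_(x in D) f x <= \int[mu]_(x in D) g x.
Proof.
move=> f0 fg.
have g0 x : D x -> 0 <= g x by move=> Dx; exact: le_trans (f0 _ Dx) (fg _ Dx).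
rewrite !ge0_integralE//; apply: le_ereal_sup => _ [h /= hf <-].
exists h => //= x; apply: le_trans (hf x) _.
by rewrite /patch; case: ifPn => //; rewrite inE; exact: fg.
Qed.

Lemma ge0_integral_mono_le (D : set T) (f g : T -> \bar R) (M : \bar R) :
  (forall x, D x -> 0 <= f x) -> (forall x, D x -> f x <= g x) ->
  \int[mu]_(x in D) g x <= M -> \int[mu]_(x in D) f x <= M.
Proof. by move=> f0 fg; apply: le_trans; exact: ge0_integral_mono. Qed.

(* No measurability of f is assumed: if f is not measurable then Rintegral is
   still a difference of suprema lying in [0, M]. *)
Lemma normr_Rintegral_le (D : set T) (f g : T -> R) (M : R) :
  (forall x, D x -> `|f x| <= g x)%R ->
  \int[mu]_(x in D) (g x)%:E <= M%:E ->
  (`|Rintegral mu D f| <= M)%R.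
Proof.
move=> fg gM; rewrite /Rintegral integralE.
set A := \int[mu]_(x in D) _^\+ x; set B := \int[mu]_(x in D) _^\- x.
have A0 : 0 <= A by apply: integral_ge0 => x _; exact: funepos_ge0.
have B0 : 0 <= B by apply: integral_ge0 => x _; exact: funeneg_ge0.
have AM : A <= M%:E.
  apply: ge0_integral_mono_le gM => x Dx; first exact: funepos_ge0.
  rewrite funeposE ge_max !lee_fin; apply/andP; split.
    exact: le_trans (ler_norm _) (fg _ Dx).
  exact: le_trans (normr_ge0 _) (fg _ Dx).
have BM : B <= M%:E.
  apply: ge0_integral_mono_le gM => x Dx; first exact: funeneg_ge0.
  rewrite funenegE ge_max -EFinN !lee_fin; apply/andP; split.
    by apply: le_trans (fg _ Dx); rewrite -normrN ler_norm.
  exact: le_trans (normr_ge0 _) (fg _ Dx).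
case: A A0 AM => [a||]//; case: B B0 BM => [b||]//; rewrite !lee_fin => b0 bM a0 aM.
rewrite -EFinB /= ler_norml; apply/andP; split; lra.
Qed.

Lemma integrable_of_le (D : set T) (f g : T -> R) (M : R) :
  measurable D -> measurable_fun D f ->
  (forall x, D x -> `|f x| <= g x)%R ->
  \int[mu]_(x in D) (g x)%:E <= M%:E ->
  mu.-integrable D (EFin \o f).
Proof.
move=> mD mf fg gM; apply/integrableP; split; first exact/measurable_EFinP.
apply: le_lt_trans (ltry M).
by apply: ge0_integral_mono_le gM => x Dx; rewrite ?abse_ge0// lee_fin; exact: fg.
Qed.

Lemma integrable_EFinB (D : set T) (f g : T -> R) : measurable D ->
  mu.-integrable D (EFin \o f) -> mu.-integrable D (EFin \o g) ->
  mu.-integrable D (EFin \o (fun x => f x - g x)%R).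
Proof. by move=> mD fi gi; exact: (integrableB mD fi gi). Qed.

Lemma integrable_EFinZl (D : set T) (k : R) (f : T -> R) : measurable D ->
  mu.-integrable D (EFin \o f) ->
  mu.-integrable D (EFin \o (fun x => k * f x)%R).
Proof. by move=> mD fi; exact: (integrableZl mD k fi). Qed.

End integral_tools.

Section Rintegral_tools.
Context d (T : measurableType d) (R : realType).
Variable mu : {measure set T -> \bar R}.

(** Counterpart of [normr_Rintegral_le] for a bound valid almost everywhere, as the one on the force
    is. Integrability comes along because the force term is later cut into differences. *)
Lemma normr_Rintegral_le_ae (g h : T -> R) (M : R) :
  measurable_fun setT g -> measurable_fun setT h ->
  {ae mu, forall z, `|g z| <= h z} ->
  (\int[mu]_z (h z)%:E <= M%:E)%E -> (forall z, 0 <= h z) ->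
  mu.-integrable setT (EFin \o g) /\ `|\int[mu]_z g z| <= M.
Proof.
move=> mg mh gh hM h0.
have le : (\int[mu]_z `|(g z)%:E| <= M%:E)%E.
  apply: le_trans hM; apply: ae_ge0_le_integral => //.
  - by apply: measurableT_comp => //; exact/measurable_EFinP.
  - by move=> z _; rewrite lee_fin.
  - exact/measurable_EFinP.
  - by apply: filterS gh => z hz _; rewrite lee_fin.
have gi : mu.-integrable setT (EFin \o g).
  by apply/integrableP; split; [exact/measurable_EFinP|exact: le_lt_trans (ltry M)].
split => //; rewrite -lee_fin EFin_normr_Rintegral//.
by apply: le_trans le; apply: le_abse_integral => //; exact/measurable_EFinP.
Qed.

Lemma Rintegral_ord_sum (D : set T) n (g : 'I_n -> T -> R) :
  measurable D -> (forall i, mu.-integrable D (EFin \o g i)) ->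
  \int[mu]_(z in D) (\sum_i g i z) = \sum_i \int[mu]_(z in D) g i z /\
  mu.-integrable D (EFin \o (fun z => \sum_i g i z)).
Proof.
move=> mD; elim: n g => [|n IH] g gi.
  split; first by rewrite big_ord0 /Rintegral integral0_eq// => z _; rewrite big_ord0.
  apply: (eq_integrable mD (cst 0%E)); last exact: integrable0.
  by move=> z _; rewrite /= big_ord0.
have [e i] := IH (fun k => g (lift ord0 k)) (fun k => gi (lift ord0 k)).
have E z : \sum_i0 g i0 z = g ord0 z + \sum_i0 g (lift ord0 i0) z by rewrite big_ord_recl.
split.
  by under eq_Rintegral do rewrite E; rewrite RintegralD// e big_ord_recl.
apply: (eq_integrable mD (fun z => (g ord0 z)%:E + (\sum_i0 g (lift ord0 i0) z)%:E)%E).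
  by move=> z _; rewrite /= E.
exact: (integrableD mD (gi ord0) i).
Qed.

End Rintegral_tools.

Section Rintegral_fubini.
Local Open Scope ereal_scope.
Context d1 d2 (T1 : measurableType d1) (T2 : measurableType d2) (R : realType).

Lemma measurable_Rintegral (m2 : {sigma_finite_measure set T2 -> \bar R})
    (f : T1 * T2 -> R) : measurable_fun setT f ->
  measurable_fun setT (fun x => \int[m2]_y f (x, y))%R.
Proof.
move=> mf; apply: measurableT_comp => //.
have mfE : measurable_fun setT (EFin \o f) by exact/measurable_EFinP.
rewrite (_ : (fun x => _) = (fun x =>
    fubini_F m2 ((EFin \o f)^\+) x - fubini_F m2 ((EFin \o f)^\-) x)); last first.
  apply/funext => x; rewrite integralE /fubini_F.
  by congr (_ - _); apply: eq_integral => y _; rewrite ?funeposE ?funenegE.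
apply: emeasurable_funB; apply: measurable_fun_fubini_tonelli_F => //.
  exact: measurable_funepos.
exact: measurable_funeneg.
Qed.

Variables (m1 : {sigma_finite_measure set T1 -> \bar R}).
Variables (m2 : {sigma_finite_measure set T2 -> \bar R}).

(** [Rintegral] applies [fine] to the inner integral and so alters it where it is infinite;
    integrability on the product makes this a null set. *)
Lemma Rintegral_prod1 (f : T1 * T2 -> R) :
  (m1 \x m2).-integrable setT (EFin \o f) ->
  (\int[m1]_x \int[m2]_y f (x, y) = \int[m1 \x m2]_z f z)%R.
Proof.
move=> fi; rewrite {1 3}/Rintegral -(integral12_prod_meas1 fi).
have iF := integrable_fubini_F fi.
have mF : measurable_fun setT (fubini_F m2 (EFin \o f)) by exact: measurable_int iF.
congr fine; apply: ae_eq_integral => //.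
  by apply/measurable_EFinP; apply: measurableT_comp.
have := integrable_ae measurableT iF; apply: filterS => x /= /(_ I) h _.
by rewrite /Rintegral fineK.
Qed.

Lemma Rintegral_prod2 (f : T1 * T2 -> R) :
  (m1 \x m2).-integrable setT (EFin \o f) ->
  (\int[m2]_y \int[m1]_x f (x, y) = \int[m1 \x m2]_z f z)%R.
Proof.
move=> fi; rewrite {1 3}/Rintegral -(integral21_prod_meas1 fi).
have mf : measurable_fun setT (EFin \o f) by exact: measurable_int fi.
have mF : measurable_fun setT (fubini_G m1 (EFin \o f)) by exact: (measurable_fubini_G fi).
have iF : m2.-integrable setT (fubini_G m1 (EFin \o f)).
  apply/integrableP; split => //; apply: le_lt_trans ((integrable21ltyP m1 m2 mf).1 fi).
  apply: ge0_integral_mono => y _ //; apply: le_abse_integral => //.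
  exact: measurableT_comp.
congr fine; apply: ae_eq_integral => //.
  by apply/measurable_EFinP; apply: measurableT_comp.
have := integrable_ae measurableT iF; apply: filterS => x /= /(_ I) h _.
by rewrite /Rintegral fineK.
Qed.

Lemma integrable_Rintegral2 (f : T1 * T2 -> R) :
  (m1 \x m2).-integrable setT (EFin \o f) ->
  m2.-integrable setT (EFin \o (fun y => \int[m1]_x f (x, y))%R).
Proof.
move=> fi.
have mf : measurable_fun setT (EFin \o f) by exact: measurable_int fi.
have mF : measurable_fun setT (fubini_G m1 (EFin \o f)) by exact: (measurable_fubini_G fi).
apply/integrableP; split.
  by apply/measurable_EFinP; apply: measurableT_comp.
apply: le_lt_trans ((integrable21ltyP m1 m2 mf).1 fi).
apply: ge0_integral_mono => y _ //.
apply: (@le_trans _ _ `|\int[m1]_x (EFin \o f) (x, y)|).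
  by rewrite /Rintegral /=; case: (integral _ _ _) => [r| |] //=; rewrite ?normr0 ?leey.
apply: le_abse_integral => //; exact: measurableT_comp.
Qed.

(** Multiplication by the indicator of [D] moves the problem to the full product, where the bound on
    the absolute iterated integral gives integrability. *)
Lemma RintegralC_dom (D : set T2) (f : T1 * T2 -> R) (M : R) :
  measurable D -> measurable_fun setT f ->
  \int[m1]_x \int[m2]_(y in D) `|f (x, y)|%:E <= M%:E ->
  (\int[m1]_x \int[m2]_(y in D) f (x, y) =
   \int[m2]_(y in D) \int[m1]_x f (x, y))%R.
Proof.
move=> mD mf fM.
pose g z := (f z * \1_D z.2)%R.
have gE x y : (g (x, y) = ((fun y => f (x, y)) \_ D) y)%R.
  by rewrite /g /= patchE indicE; case: (y \in D); rewrite ?mulr1 ?mulr0.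
have mg : measurable_fun setT g.
  by apply: measurable_funM => //; exact: measurableT_comp.
have ig : (m1 \x m2).-integrable setT (EFin \o g).
  apply/integrable12ltyP; first exact/measurable_EFinP.
  apply: le_lt_trans (ltry M); apply: le_trans fM.
  apply: ge0_integral_mono => x _; first exact: integral_ge0.
  rewrite [leRHS]integral_mkcond; apply: ge0_integral_mono => y _ //.
  by rewrite /= gE !patchE; case: ifPn => //; rewrite normr0.
under eq_Rintegral do rewrite Rintegral_mkcond.
transitivity (\int[m1]_x \int[m2]_y g (x, y))%R.
  by apply: eq_Rintegral => x _; apply: eq_Rintegral => y _; rewrite gE.
rewrite Rintegral_prod1// -Rintegral_prod2// [RHS]Rintegral_mkcond.
apply: eq_Rintegral => y _; rewrite patchE /g /=; case: ifPn => yD.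
  by apply: eq_Rintegral => x _; rewrite indicE yD mulr1.
rewrite /Rintegral integral0_eq// => x _; rewrite indicE (negbTE yD) mulr0//.
Qed.

End Rintegral_fubini.

Section rV_integral.
Local Open Scope ereal_scope.
Context {R : realType}.

Lemma ge0_integral_rV_cons n (f : 'rV[R]_n.+1 -> \bar R) :
  measurable_fun setT f -> (forall y, 0 <= f y) ->
  \int[lebesgue_rV n.+1]_y f y =
  \int[lebn n]_p \int[leb]_r f (rV_cons (p, r)).
Proof.
move=> mf f0.
transitivity (\int[(lebn n \x leb)]_z (f \o @rV_cons R n) z).
  have := @ge0_integral_pushforward _ _ _ _ R (@rV_cons R n)
    (@measurable_rV_cons R n) (lebn n \x leb) setT f measurableT mf.
  rewrite preimage_setT => <- //.
rewrite fubini_tonelli1//; last by move=> z; exact: f0.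
apply: measurableT_comp => //; exact: measurable_rV_cons.
Qed.

Lemma Rintegral_rV_cons n (f : 'rV[R]_n.+1 -> R) :
  measurable_fun setT f ->
  (lebn n \x leb).-integrable setT (EFin \o f \o @rV_cons R n) ->
  (\int[lebesgue_rV n.+1]_y f y = \int[lebn n \x leb]_z f (rV_cons z))%R.
Proof.
move=> mf fi.
have := @integral_pushforward _ _ _ _ R (@rV_cons R n)
    (@measurable_rV_cons R n) (lebn n \x leb) setT (EFin \o f).
rewrite preimage_setT /Rintegral => h; congr fine; apply: h => //.
exact/measurable_EFinP.
Qed.

Lemma Rintegral_rV_consE n (f : 'rV[R]_n.+1 -> R) :
  measurable_fun setT f ->
  (lebn n \x leb).-integrable setT (EFin \o f \o @rV_cons R n) ->
  (\int[lebesgue_rV n.+1]_y f y =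
   \int[lebesgue_rV n]_p \int[leb]_r f (rV_cons (p, r)))%R.
Proof.
move=> mf fi; rewrite Rintegral_rV_cons//.
exact: (esym (@Rintegral_prod1 _ _ _ _ R (lebn n) leb (f \o @rV_cons R n) fi)).
Qed.

End rV_integral.

(** * Improper integrals *)

Section exhaustion.
Context {R : realType}.
Implicit Types (D : set R) (u v : nat -> R) (f F : R -> R).

(** The line, half-lines and bounded open intervals are treated alike: the fundamental theorem of
    calculus is applied on each [[u n, v n]], and the integrals pass to the limit along the
    increasing union. *)
Definition exhaustion D u v :=
  [/\ forall n, u n < v n, nonincreasing_seq u, nondecreasing_seq v &
      D = \bigcup_n `[u n, v n]%classic].

Lemma exhaustionT : exhaustion setT (fun n => - n.+1%:R) (fun n => n.+1%:R).
Proof.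
split.
- by move=> n; rewrite gtrN.
- by move=> m n mn; rewrite lerN2 ler_nat.
- by move=> m n mn; rewrite ler_nat.
apply/esym/seteqP; split => // x _; exists (Num.bound `|x|) => //=.
rewrite in_itv/= -ler_norml (le_trans (ltW (archi_boundP (normr_ge0 x))))//.
by rewrite ler_nat.
Qed.

Lemma exhaustion_oy (a : R) :
  exhaustion `]a, +oo[%classic (fun n => a + n.+2%:R^-1) (fun n => a + n.+1%:R).
Proof.
split.
- by move=> n; rewrite ltrD2l (@lt_le_trans _ _ 1)// ?invf_lt1// ?ltr1n ?ler1n.
- by move=> m n mn; rewrite lerD2l lef_pV2 ?posrE// ler_nat !ltnS.
- by move=> m n mn; rewrite lerD2l ler_nat.
apply/seteqP; split => x /=; rewrite ?in_itv/= ?andbT.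
  move=> ax; have xa0 : 0 < x - a by rewrite subr_gt0.
  exists (maxn (Num.bound (x - a)) (Num.bound (x - a)^-1)) => //=.
  rewrite in_itv/=; apply/andP; split.
    rewrite -lerBrDl invf_ple ?posrE// (le_trans (ltW (archi_boundP _)))//.
      by rewrite invr_ge0 ltW.
    by rewrite ler_nat !leqW// leq_maxr.
  rewrite -lerBlDl (le_trans (ltW (archi_boundP (ltW xa0))))//.
  by rewrite ler_nat leqW// leq_maxl.
move=> [n _ /=]; rewrite in_itv/= => /andP[h _]; apply: lt_le_trans h.
by rewrite ltrDl.
Qed.

(** The denominators start at 3 so that the two endpoints are in order from the first index on. *)
Lemma exhaustion_oo (a b : R) : a < b ->
  exhaustion `]a, b[%classic
    (fun n => a + (b - a) / n.+3%:R) (fun n => b - (b - a) / n.+3%:R).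
Proof.
move=> ab; have ba0 : 0 < b - a by rewrite subr_gt0.
split.
- move=> n.
  have : (b - a) / n.+3%:R < (b - a) / 2.
    by rewrite ltr_pM2l// ltf_pV2 ?posrE// ltr_nat.
  move: (_ / n.+3%:R) => q; lra.
- move=> m n mn; rewrite lerD2l ler_pM2l// lef_pV2 ?posrE// ler_nat !ltnS//.
- by move=> m n mn; rewrite lerD2l lerN2 ler_pM2l// lef_pV2 ?posrE// ler_nat !ltnS.
apply/seteqP; split => x /=; rewrite ?in_itv/=.
  move=> /andP[ax xb].
  have xa0 : 0 < x - a by rewrite subr_gt0.
  have bx0 : 0 < b - x by rewrite subr_gt0.
  have key c : 0 < c -> exists n0, forall n, (n0 <= n)%N -> (b - a) / n.+3%:R <= c.
    move=> c0; exists (Num.bound ((b - a) / c)) => n h.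
    rewrite ler_pdivrMr// mulrC -ler_pdivrMr//.
    rewrite (le_trans (ltW (archi_boundP _)))//; first by rewrite divr_ge0 ?ltW.
    by rewrite ler_nat (leq_trans h)// !leqW.
  have [n1 h1] := key _ xa0; have [n2 h2] := key _ bx0.
  exists (maxn n1 n2) => //=; rewrite in_itv/=.
  have := h1 _ (leq_maxl n1 n2); have := h2 _ (leq_maxr n1 n2).
  by move: (_ / _) => q h3 h4; apply/andP; split; lra.
move=> [n _ /=]; rewrite in_itv/= => /andP[h1 h2].
have : 0 < (b - a) / n.+3%:R by rewrite divr_gt0.
by move: (_ / _) h1 h2 => q h1 h2 h; apply/andP; split; lra.
Qed.

Lemma exhaustion_cvg D u v f : exhaustion D u v ->
  (forall n, measurable_fun `[u n, v n] f) -> (forall x, D x -> 0 <= f x) ->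
  (\int[leb]_(x in `[u i, v i]) (f x)%:E @[i --> \oo]
    --> \int[leb]_(x in D) (f x)%:E)%E.
Proof.
move=> [_ hu hv DE] mf f0; rewrite [X in integral _ X]DE.
apply: ge0_nondecreasing_set_cvg_integral => //.
- move=> m n mn; rewrite subsetEset => x /=; rewrite !in_itv/= => /andP[h1 h2].
  by rewrite (le_trans (hu _ _ mn) h1) (le_trans h2 (hv _ _ mn)).
- by move=> n; apply/measurable_EFinP; exact: mf.
- by move=> n x xn; rewrite lee_fin; apply: f0; rewrite DE; exists n.
Qed.

Lemma cvg_harmonic_dist (x : nat -> R) (L K : R) :
  (forall n, `|x n - L| <= K / n.+1%:R) -> x n @[n --> \oo] --> L.
Proof.
move=> h; apply/cvgrPdist_le => /= e e0.
have K0 : 0 <= K.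
  by have := h 0%N; rewrite divr1; apply: le_trans.
near=> n; rewrite distrC; apply: le_trans (h n) _.
rewrite ler_pdivrMr// mulrC -ler_pdivrMr// (@le_trans _ _ n%:R)//.
  by near: n; exact: nbhs_infty_ger.
by rewrite ler_nat.
Unshelve. all: by end_near. Qed.

(** The endpoints are the images, in reverse order, of those of [exhaustion_oy 0] under
    [s |-> c / s], so that in [integral_inversion] the increments of the primitives agree index by
    index. *)
Lemma exhaustion_scale (c : R) : 0 < c ->
  exhaustion `]0, +oo[%classic (fun n => c / n.+1%:R) (fun n => c * n.+2%:R).
Proof.
move=> c0; split.
- move=> n; rewrite ltr_pM2l// (@le_lt_trans _ _ 1)// ?invf_le1 ?ler1n ?ltr1n//.
- by move=> m n mn; rewrite ler_pM2l// lef_pV2 ?posrE// ler_nat ltnS.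
- by move=> m n mn; rewrite ler_pM2l// ler_nat !ltnS.
apply/seteqP; split => x /=; rewrite ?in_itv/= ?andbT.
  move=> x0; exists (maxn (Num.bound (c / x)) (Num.bound (x / c))) => //=.
  rewrite in_itv/=; apply/andP; split.
    rewrite ler_pdivrMr// mulrC -ler_pdivrMr//.
    rewrite (le_trans (ltW (archi_boundP _)))//; first by rewrite divr_ge0 ?ltW.
    by rewrite ler_nat leqW// leq_maxl.
  rewrite mulrC -ler_pdivrMr//.
  rewrite (le_trans (ltW (archi_boundP _)))//; first by rewrite divr_ge0 ?ltW.
  by rewrite ler_nat !leqW// leq_maxr.
by move=> [n _ /=]; rewrite in_itv/= => /andP[h _]; apply: lt_le_trans h; rewrite divr_gt0.
Qed.

Section FTC.
Variables (D : set R) (u v : nat -> R) (f F : R -> R).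
Hypothesis ex : exhaustion D u v.
Hypothesis cf : forall x, D x -> {for x, continuous f}.
Hypothesis dF : forall x, D x -> is_derive x 1 F (f x).

Let subD n x : x \in `[u n, v n] -> D x.
Proof. by move=> h; case: ex => _ _ _ ->; exists n. Qed.

Lemma exhaustion_measurable : measurable D.
Proof. by case: ex => _ _ _ ->; apply: bigcup_measurable => k _. Qed.

Let mf n : measurable_fun `[u n, v n] f.
Proof.
apply: subspace_continuous_measurable_fun => //.
apply: continuous_in_subspaceT => x /set_mem /= h; apply: cf; exact: subD h.
Qed.

Lemma exhaustion_measurable_fun : measurable_fun D f.
Proof.
case: ex => _ _ _ ->; apply/measurable_fun_bigcup => //.
Qed.

Lemma exhaustion_FTC n :
  (\int[leb]_(x in `[u n, v n]) (f x)%:E = (F (v n) - F (u n))%:E)%E.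
Proof.
have cF x : x \in `[u n, v n] -> {for x, continuous F}.
  move=> h; have := dF (subD h) => -[+ _].
  by move=> /derivable1_diffP/differentiable_continuous.
have uv : u n < v n by case: ex.
rewrite (@continuous_FTC2 _ f F (u n) (v n))//.
- apply: continuous_in_subspaceT => x /set_mem /= h; apply: cf; exact: subD h.
- split => [x xuv||].
  + by have [] := dF (subD (subset_itv_oo_cc xuv)).
  + by apply: cvg_at_right_filter; apply: cF; rewrite in_itv/= lexx ltW.
  + by apply: cvg_at_left_filter; apply: cF; rewrite in_itv/= lexx ltW.
- move=> x xuv; rewrite derive1E.
  by have [_ ->] := dF (subD (subset_itv_oo_cc xuv)).
Qed.

Let nd : nondecreasing_seq (fun n => `[u n, v n]%classic).
Proof.
case: ex => _ hu hv _ m n mn; rewrite subsetEset => x /=.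
rewrite !in_itv/= => /andP[h1 h2].
by rewrite (le_trans (hu _ _ mn) h1) (le_trans h2 (hv _ _ mn)).
Qed.

Section ge0.
Hypothesis f0 : forall x, D x -> 0 <= f x.

Let cvgint := exhaustion_cvg ex mf f0.

Lemma exhaustion_ge0_le (M : R) : (forall n, F (v n) - F (u n) <= M) ->
  (\int[leb]_(x in D) (f x)%:E <= M%:E)%E.
Proof.
move=> h; have := cvgint => /cvg_lim <- //.
apply: lime_le; first by apply/cvg_ex; eexists; exact: cvgint.
by apply: nearW => n; rewrite exhaustion_FTC lee_fin.
Qed.

Lemma exhaustion_ge0_cvg (L : R) : F (v n) - F (u n) @[n --> \oo] --> L ->
  (\int[leb]_(x in D) (f x)%:E = L%:E)%E.
Proof.
move=> h; have := cvgint => /cvg_lim <- //.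
apply/cvg_lim => //; under eq_fun do rewrite exhaustion_FTC.
by apply: cvg_EFin => //; exact: nearW.
Qed.

End ge0.

(** For an integrand of variable sign the passage to the limit is by dominated convergence, with the
    absolute value of [f] as the dominating function. *)
Lemma exhaustion_integrable_cvg (L : R) :
  leb.-integrable D (EFin \o f) ->
  F (v n) - F (u n) @[n --> \oo] --> L -> \int[leb]_(x in D) f x = L.
Proof.
move=> fi h.
have mD := exhaustion_measurable.
pose fn n x := (f x * \1_(`[u n, v n]%classic) x)%:E.
have fnE n x : fn n x = ((EFin \o f) \_ `[u n, v n]%classic) x.
  by rewrite /fn patchE indicE; case: (x \in _); rewrite ?mulr1 ?mulr0.
have mfn n : measurable_fun D (fn n).
  apply/measurable_EFinP; apply: measurable_funM.
    exact: exhaustion_measurable_fun.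
  by apply: measurable_funTS; exact: measurable_indic.
have cv x : D x -> fn ^~ x @ \oo --> (f x)%:E.
  case: (ex) => _ _ _ DE; rewrite DE => -[n _ xn].
  apply: cvg_near_cst; near=> m.
  rewrite /fn indicE mem_set ?mulr1//.
  have : (`[u n, v n] `<=` `[u m, v m])%classic.
    by rewrite -subsetEset; apply: nd; near: m; exact: nbhs_infty_ge.
  by apply.
have mfD : measurable_fun D (EFin \o f).
  by apply/measurable_EFinP; exact: exhaustion_measurable_fun.
have aecv : {ae leb, forall x, D x -> fn ^~ x @ \oo --> (EFin \o f) x}.
  exact: aeW.
have aele : {ae leb, forall x n, D x -> (`|fn n x| <= `|f x|%:E)%E}.
  apply: aeW => x n Dx; rewrite /fn lee_fin normrM ler_piMr// indicE.
  by case: (_ \in _); rewrite ?normr1 ?normr0.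
have [_ _ hl] := @dominated_convergence _ (measurableTypeR R) R leb D mD fn (EFin \o f)
  (fun x => `|f x|%:E) mfn mfD aecv (integrable_abse fi) aele.
rewrite /Rintegral; have /cvg_lim <- // := hl.
rewrite (_ : (fun n => _) = (fun n => (F (v n) - F (u n))%:E)); last first.
  apply/funext => n; rewrite -exhaustion_FTC.
  rewrite [LHS]integral_mkcond [RHS]integral_mkcond; apply: eq_integral => x _.
    rewrite !patchE; case: ifPn => [_|xD].
      by rewrite fnE patchE.
    case: ifPn => //; rewrite inE => xn; case/negP: xD; rewrite inE.
    exact: subD xn.
  have -> // : lim ((F (v n) - F (u n))%:E @[n --> \oo])%E = L%:E.
  by apply/cvg_lim => //; apply: cvg_EFin => //; exact: nearW.
Unshelve. all: by end_near. Qed.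

End FTC.

End exhaustion.

(** * Measurability of elementary functions and the Cauchy integral *)

Section calculus.
Context {R : realType}.

Lemma is_derive_continuous (f : R -> R) (x df : R) :
  is_derive x 1 f df -> {for x, continuous f}.
Proof. by move=> [+ _] => /derivable1_diffP/differentiable_continuous. Qed.

Lemma measurable_funV d (T : measurableType d) (D : set T) (f : T -> R) :
  measurable_fun D f -> measurable_fun D (fun x => (f x)^-1).
Proof.
(* On nonnegative numbers the inverse is the real power of exponent [-1], which is measurable; the
   factor [f x] restores the sign, and both sides are 0 at a zero of [f]. *)
move=> mf; rewrite (_ : (fun x => _) = fun x => f x * (f x ^+ 2) `^ (-1)).
  apply: measurable_funM => //.
  exact: (measurableT_comp (measurable_powR (-1)) (measurable_funX 2 mf)).
apply/funext => x; rewrite powR_inv1 ?sqr_ge0//.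
have [->|fx0] := eqVneq (f x) 0; first by rewrite invr0 mul0r.
by field.
Qed.

Lemma measurable_fun_sqrt d (T : measurableType d) (D : set T) (f : T -> R) :
  measurable_fun D f -> measurable_fun D (fun x => Num.sqrt (f x)).
Proof.
move=> mf; have h : measurable_fun setT (Num.sqrt : R -> R).
  by apply: continuous_measurable_fun => x; exact: (@sqrt_continuous R x).
exact: (measurableT_comp h mf).
Qed.

Lemma measurable_fun_cos d (T : measurableType d) (D : set T) (f : T -> R) :
  measurable_fun D f -> measurable_fun D (fun x => cos (f x)).
Proof.
move=> mf; have h : measurable_fun setT (cos : R -> R).
  by apply: continuous_measurable_fun => x; exact: (@continuous_cos R x).
exact: (measurableT_comp h mf).
Qed.

Lemma measurable_fun_sin d (T : measurableType d) (D : set T) (f : T -> R) :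
  measurable_fun D f -> measurable_fun D (fun x => sin (f x)).
Proof.
move=> mf; have h : measurable_fun setT (sin : R -> R).
  by apply: continuous_measurable_fun => x; exact: (@continuous_sin R x).
exact: (measurableT_comp h mf).
Qed.

Lemma measurable_fun_expR d (T : measurableType d) (D : set T) (f : T -> R) :
  measurable_fun D f -> measurable_fun D (fun x => expR (f x)).
Proof. by move=> mf; apply: measurableT_comp. Qed.

Lemma measurable_fun_prod_ord d (T : measurableType d) (D : set T) n
    (f : 'I_n -> T -> R) :
  (forall i, measurable_fun D (f i)) -> measurable_fun D (fun x => \prod_i f i x).
Proof.
elim: n f => [|n IH] f mf.
  by under eq_fun do rewrite big_ord0; exact: measurable_cst.
under eq_fun do rewrite big_ord_recl; apply: measurable_funM => //; exact: IH.
Qed.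

Lemma integral_cauchy_le (a A : R) : 0 < A ->
  (\int[leb]_r (((a - r) ^+ 2 + A)^-1)%:E <= (pi / Num.sqrt A)%:E)%E.
Proof.
move=> A0; set B := Num.sqrt A; have B0 : 0 < B by rewrite sqrtr_gt0.
have AE : A = B ^+ 2 by rewrite sqr_sqrtr// ltW.
have pos r : 0 < (a - r) ^+ 2 + A by rewrite ltr_wpDl// sqr_ge0.
(* The primitive is an arctangent divided by [B]; its values lie in an interval of length [pi / B],
   which bounds every increment at once. *)
apply: (@exhaustion_ge0_le R setT _ _ (fun r => ((a - r) ^+ 2 + A)^-1)
  (fun r => atan ((r - a) / B) / B) exhaustionT).
- move=> r _; apply: is_derive_continuous; apply: is_deriveV; rewrite ?gt_eqF//.
- move=> r _; apply: is_derive_eq.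
  have := pos r; rewrite AE => h; rewrite /GRing.scale /=.
  have h1 : 0 < 1 + ((r - a) / B) ^+ 2 by rewrite ltr_pwDl// sqr_ge0.
  have -> : (a - r) ^+ 2 + B ^+ 2 = B ^+ 2 * (1 + ((r - a) / B) ^+ 2).
    by field; rewrite gt_eqF.
  rewrite !mulr0 add0r subr0 mulr1 add0r invfM expr2 invfM; lra.
- by move=> r _; rewrite invr_ge0 ltW.
- move=> n; rewrite -mulrBl ler_pM2r ?invr_gt0//.
  set x := atan _; set y := atan _.
  have h1 : x < pi / 2 by exact: atan_ltpi2.
  have h2 : - (pi / 2) < y by exact: atan_gtNpi2.
  lra.
Qed.

End calculus.

(** * Euclidean norms *)

Section euclid.
Context {R : realType}.
Implicit Types n : nat.

Lemma dotp_ge0 n (z : 'rV[R]_n) : 0 <= dotp z z.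
Proof. by apply: sumr_ge0 => i _; rewrite -expr2 sqr_ge0. Qed.

Lemma enorm_ge0 n (z : 'rV[R]_n) : 0 <= enorm z.
Proof. exact: sqrtr_ge0. Qed.

Lemma enorm_sqr n (z : 'rV[R]_n) : enorm z ^+ 2 = dotp z z.
Proof. by rewrite sqr_sqrtr// dotp_ge0. Qed.

Lemma sqr_coord_le n (z : 'rV[R]_n) i : z ord0 i ^+ 2 <= dotp z z.
Proof.
rewrite /dotp (bigD1 i)//= -expr2 lerDl.
by apply: sumr_ge0 => j _; rewrite -expr2 sqr_ge0.
Qed.

Lemma coord_le_enorm n (z : 'rV[R]_n) i : `|z ord0 i| <= enorm z.
Proof. by rewrite -sqrtr_sqr ler_sqrt ?dotp_ge0// sqr_coord_le. Qed.

Lemma coordB n (x y : 'rV[R]_n) i : (x - y) ord0 i = x ord0 i - y ord0 i.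
Proof. by rewrite !mxE. Qed.

Lemma dotpN n (z : 'rV[R]_n) : dotp (- z) (- z) = dotp z z.
Proof. by apply: eq_bigr => i _; rewrite !mxE mulrNN. Qed.

Lemma enormN n (z : 'rV[R]_n) : enorm (- z) = enorm z.
Proof. by rewrite /enorm dotpN. Qed.

Lemma dotpD_le n (z w : 'rV[R]_n) :
  dotp (z + w) (z + w) <= 2 * dotp z z + 2 * dotp w w.
Proof.
rewrite !mulr_sumr -big_split/=; apply: ler_sum => i _; rewrite !mxE -!expr2.
have := sqr_ge0 (z ord0 i - w ord0 i); rewrite !expr2; lra.
Qed.

Lemma enorm_gt0 n (z : 'rV[R]_n) : z != 0 -> 0 < enorm z.
Proof.
move=> z0; rewrite lt_def enorm_ge0 andbT; apply: contra z0 => /eqP h.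
apply/eqP/rowP => i; rewrite mxE.
have := coord_le_enorm z i; rewrite h normr_le0; exact: eqP.
Qed.

Lemma enorm_le_coord n (v : 'rV[R]_n) (M : R) : 0 <= M ->
  (forall j, `|v ord0 j| <= M) -> enorm v <= n%:R * M.
Proof.
move=> M0 vM.
suff : dotp v v <= (n%:R * M) ^+ 2.
  move=> h; rewrite /enorm -(@ger0_norm _ (n%:R * M)) ?mulr_ge0// -sqrtr_sqr.
  by rewrite ler_sqrt// sqr_ge0.
case: n v vM => [|n] v vM.
  by rewrite /dotp big_ord0 sqr_ge0.
apply: (@le_trans _ _ (\sum_(i < n.+1) M ^+ 2)).
  by apply: ler_sum => i _; rewrite -expr2 -real_normK ?num_real// lerXn2r ?nnegrE.
rewrite sumr_const card_ord exprMn -[leLHS]mulr_natl.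
apply: ler_wpM2r; first exact: sqr_ge0.
by rewrite -natrX ler_nat expnS leq_pmulr// expn_gt0.
Qed.

(* The parabolic size sqrt(|z|^2 + A) of a space-time point (z, A). *)
Definition br n (A : R) (z : 'rV[R]_n) : R := Num.sqrt (dotp z z + A).

Lemma br_gt0 n A (z : 'rV[R]_n) : 0 < A -> 0 < br A z.
Proof. by move=> A0; rewrite sqrtr_gt0 ltr_wpDl// dotp_ge0. Qed.

Lemma br_sqr n A (z : 'rV[R]_n) : 0 <= A -> br A z ^+ 2 = dotp z z + A.
Proof. by move=> A0; rewrite sqr_sqrtr// addr_ge0// dotp_ge0. Qed.

Lemma enorm_le_br n A (z : 'rV[R]_n) : 0 <= A -> enorm z <= br A z.
Proof. by move=> A0; rewrite ler_sqrt ?lerDl// addr_ge0// dotp_ge0. Qed.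

Lemma sqrt_le_br n A (z : 'rV[R]_n) : Num.sqrt A <= br A z.
Proof.
have [A0|A0] := leP 0 A; last by rewrite ltr0_sqrtr// sqrtr_ge0.
by rewrite ler_sqrt ?lerDr ?addr_ge0 ?dotp_ge0.
Qed.

Section measurability.
Context d (T : measurableType d).

Lemma measurable_dotp n (g h : T -> 'rV[R]_n) :
  (forall i, measurable_fun setT (fun t => g t ord0 i)) ->
  (forall i, measurable_fun setT (fun t => h t ord0 i)) ->
  measurable_fun setT (fun t => dotp (g t) (h t)).
Proof.
by move=> mg mh; apply: measurable_sum => i; exact: measurable_funM.
Qed.

Lemma measurable_enorm n (g : T -> 'rV[R]_n) :
  (forall i, measurable_fun setT (fun t => g t ord0 i)) ->
  measurable_fun setT (fun t => enorm (g t)).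
Proof. by move=> mg; apply: measurable_fun_sqrt; exact: measurable_dotp. Qed.

Lemma measurable_br n (g : T -> 'rV[R]_n) (h : T -> R) :
  (forall i, measurable_fun setT (fun t => g t ord0 i)) ->
  measurable_fun setT h ->
  measurable_fun setT (fun t => br (h t) (g t)).
Proof.
move=> mg mh; apply: measurable_fun_sqrt; apply: measurable_funD => //.
exact: measurable_dotp.
Qed.

End measurability.

Lemma measurable_subl_coord n (x : 'rV[R]_n) i :
  measurable_fun setT (fun y : 'rV[R]_n => (x - y) ord0 i).
Proof.
under eq_fun do rewrite !mxE; apply: measurable_funB => //.
exact: measurable_coord.
Qed.

(* Integrating out one coordinate lowers the exponent by one and costs pi. *)
Lemma integral_br_le n (m : nat) (A : R) (x : 'rV[R]_n) : (0 < m)%N -> 0 < A ->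
  (\int[lebesgue_rV n]_y (br A (x - y) ^- (n + m))%:E
    <= (pi ^+ n * Num.sqrt A ^- m)%:E)%E.
Proof.
move=> m0; elim: n A x => [|n IH] A x A0.
  rewrite integral_dirac//=.
    by rewrite diracE in_setT mul1e expr0 mul1r add0n /br /dotp big_ord0 add0r.
  apply/measurable_EFinP; apply: measurable_funV; apply: measurable_funX.
  by apply: measurable_br => // i; exact: measurable_subl_coord.
rewrite ge0_integral_rV_cons; last 2 first.
- apply/measurable_EFinP; apply: measurable_funV; apply: measurable_funX.
  by apply: measurable_br => // i; exact: measurable_subl_coord.
- by move=> y; rewrite lee_fin invr_ge0 exprn_ge0// sqrtr_ge0.
set x' : 'rV[R]_n := \row_i x ord0 (lift ord0 i).
have brE p r : br A (x - rV_cons (p, r)) =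
    Num.sqrt ((x ord0 ord0 - r) ^+ 2 + br A (x' - p) ^+ 2).
  rewrite br_sqr 1?ltW// addrA; congr (Num.sqrt (_ + _)).
  rewrite /dotp big_ord_recl coordB rV_cons0 -expr2; congr (_ + _).
  by apply: eq_bigr => i _; rewrite !coordB rV_consS mxE.
apply: (@le_trans _ _ (\int[lebn n]_p
    (pi%:E * (br A (x' - p) ^- (n + m))%:E))%E).
  apply: ge0_integral_mono => p _.
    by apply: integral_ge0 => r _; rewrite lee_fin invr_ge0 exprn_ge0// sqrtr_ge0.
  set B := br A (x' - p); have B0 : 0 < B by exact: br_gt0.
  (* Two of the [n.+1 + m] factors are kept as a Cauchy density in [r]; the remaining ones are
     bounded by their value at [r = x ord0 ord0], namely [B]. *)
  apply: (@le_trans _ _ (\int[leb]_r ((B ^- (n + m).-1)%:E *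
      (((x ord0 ord0 - r) ^+ 2 + B ^+ 2)^-1)%:E))%E).
    apply: ge0_integral_mono => r _.
      by rewrite lee_fin invr_ge0 exprn_ge0// sqrtr_ge0.
    rewrite brE -/B -EFinM lee_fin.
    have p0 : 0 < (x ord0 ord0 - r) ^+ 2 + B ^+ 2.
      by rewrite ltr_wpDl ?sqr_ge0// exprn_gt0.
    have -> : (n.+1 + m = (n + m).-1 + 2)%N.
      by rewrite addn2 prednK ?addSn// addn_gt0 m0 orbT.
    rewrite exprD (sqr_sqrtr (ltW p0)) invfM.
    apply: ler_wpM2r; first by rewrite invr_ge0 ltW.
    have q0 : 0 < Num.sqrt ((x ord0 ord0 - r) ^+ 2 + B ^+ 2) by rewrite sqrtr_gt0.
    rewrite lef_pV2 ?posrE ?exprn_gt0//.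
    rewrite lerXn2r ?nnegrE ?(ltW q0) ?(ltW B0)//.
    by rewrite -{1}(ger0_norm (ltW B0)) -sqrtr_sqr ler_sqrt ?(ltW p0)// lerDr sqr_ge0.
  rewrite ge0_integralZl_EFin//; last first.
  - by rewrite invr_ge0 exprn_ge0// ltW.
  - apply/measurable_EFinP; apply: measurable_funV; apply: measurable_funD => //.
    by apply: measurable_funX; exact: measurable_funB.
  - by move=> r _; rewrite lee_fin invr_ge0 addr_ge0// sqr_ge0.
  apply: (@le_trans _ _ ((B ^- (n + m).-1)%:E * (pi / Num.sqrt (B ^+ 2))%:E)%E).
    apply: lee_pmul => //.
    + by rewrite lee_fin invr_ge0 exprn_ge0// ltW.
    + by apply: integral_ge0 => r _; rewrite lee_fin invr_ge0 addr_ge0// sqr_ge0.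
    + by apply: integral_cauchy_le; rewrite exprn_gt0.
  rewrite sqrtr_sqr gtr0_norm// -!EFinM lee_fin.
  have -> : B ^- (n + m) = B ^- (n + m).-1 * B^-1.
    by rewrite -invfM -exprSr prednK// addn_gt0 m0 orbT.
  by rewrite mulrCA.
rewrite ge0_integralZl_EFin ?pi_ge0//; last 2 first.
- by move=> p _; rewrite lee_fin invr_ge0 exprn_ge0// sqrtr_ge0.
- apply/measurable_EFinP; apply: measurable_funV; apply: measurable_funX.
  by apply: measurable_br => // i; exact: measurable_subl_coord.
rewrite exprS -mulrA EFinM lee_pmul ?lee_fin ?pi_ge0//.
  by apply: integral_ge0 => p _; rewrite lee_fin invr_ge0 exprn_ge0// sqrtr_ge0.
exact: IH.
Qed.

End euclid.

(** * Gaussian Fourier transforms *)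

Section gauss1.
Context {R : realType}.
Variable s : R.
Hypothesis s0 : 0 < s.

Definition gauss (r : R) := expR (- (s * r ^+ 2)).

Lemma gauss_ge0 r : 0 <= gauss r.
Proof. exact: expR_ge0. Qed.

Lemma gauss_le1 r : gauss r <= 1.
Proof. by rewrite expR_le1 oppr_le0 mulr_ge0 ?sqr_ge0// ltW. Qed.

Lemma measurable_gauss : measurable_fun setT gauss.
Proof.
apply: measurable_fun_expR; apply: measurableT_comp => //.
by apply: measurable_funM => //; exact: measurable_funX.
Qed.

Lemma sqr_gauss_le r : r ^+ 2 * gauss r <= s^-1.
Proof.
rewrite /gauss expRN ler_pdivrMr ?expR_gt0// ler_pdivlMl//.
apply: le_trans (expR_ge1Dx _); lra.
Qed.

Lemma integral_gauss : (\int[leb]_r (gauss r)%:E = (Num.sqrt (pi / s))%:E)%E.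
Proof.
(* With this standard deviation the normal density centred at 0 is a multiple of [gauss s], so its
   total mass 1 gives the Gaussian integral. *)
pose sg := Num.sqrt (2 * s)^-1.
have sg0 : 0 < sg by rewrite sqrtr_gt0 invr_gt0 mulr_gt0.
have sgE : sg ^+ 2 = (2 * s)^-1 by rewrite sqr_sqrtr// invr_ge0 mulr_ge0 ?ltW.
have := @integral_normal_pdf R 0 sg.
under eq_integral => r _.
  rewrite /normal_pdf gt_eqF//.
  rewrite (_ : normal_fun 0 sg r = gauss r); last first.
    rewrite /normal_fun /gauss subr0 sgE; congr expR.
    rewrite -mulr_natr; field; rewrite gt_eqF//.
  rewrite (_ : normal_peak sg = (Num.sqrt (pi / s))^-1); last first.
    rewrite /normal_peak sgE; congr (Num.sqrt _)^-1.
    rewrite -mulr_natr; field; rewrite gt_eqF//.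
  rewrite EFinM; over.
have p0 : 0 < Num.sqrt (pi / s) by rewrite sqrtr_gt0 divr_gt0 ?pi_gt0.
rewrite ge0_integralZl_EFin ?invr_ge0 ?(ltW p0)//; last 2 first.
- by move=> r _; rewrite lee_fin gauss_ge0.
- by apply/measurable_EFinP; exact: measurable_gauss.
move=> h; have : ((Num.sqrt (pi / s))%:E * ((Num.sqrt (pi / s))^-1%:E *
   \int[leb]_r (gauss r)%:E) = (Num.sqrt (pi / s))%:E * 1)%E by rewrite h.
by rewrite muleA -EFinM mulfV ?gt_eqF// mul1e mule1.
Qed.

End gauss1.

Section gauss_phase.
Context {R : realType}.
Variable s : R.
Hypothesis s0 : 0 < s.
Local Notation g := (gauss s).

Lemma gauss_split r : g r = gauss (s / 2) r * gauss (s / 2) r.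
Proof. by rewrite /gauss -expRD; congr expR; field. Qed.

(** Half of the exponent absorbs the polynomial, as [r ^+ 2 * gauss (s / 2) r] is at most
    [(s / 2)^-1]; the other half is integrated. This integrand dominates all moments of order at
    most 2. *)
Lemma integral_moment_gauss :
  (\int[leb]_r ((1 + r ^+ 2) * g r)%:E <=
   ((1 + (s / 2)^-1) * Num.sqrt (pi / (s / 2)))%:E)%E.
Proof.
have h0 : 0 < s / 2 by rewrite divr_gt0.
have c0 : 0 <= 1 + (s / 2)^-1 by rewrite addr_ge0// invr_ge0 ltW.
rewrite EFinM -integral_gauss// -ge0_integralZl_EFin//; last 2 first.
- by move=> r _; rewrite lee_fin gauss_ge0.
- by apply/measurable_EFinP; exact: measurable_gauss.
apply: ge0_integral_mono => r _.
  by rewrite lee_fin mulr_ge0 ?addr_ge0 ?sqr_ge0// gauss_ge0.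
rewrite -EFinM lee_fin gauss_split mulrA.
apply: ler_wpM2r; first exact: gauss_ge0.
have := sqr_gauss_le h0 r; have := gauss_le1 h0 r; lra.
Qed.

Lemma integrable_gauss_le (f : R -> R) :
  measurable_fun setT f -> (forall r, `|f r| <= (1 + r ^+ 2) * g r) ->
  leb.-integrable setT (EFin \o f).
Proof.
move=> mf fg.
exact: (@integrable_of_le _ (measurableTypeR R) R leb setT f _ _ measurableT mf
  (fun r _ => fg r) integral_moment_gauss).
Qed.

(** Integration by parts without boundary terms: at the endpoints of [exhaustionT] the values of [F]
    are at most [K / n.+1]. *)
Lemma Rintegral_derive_eq0 (F f : R -> R) (K : R) :
  (forall r : R, is_derive r 1 F (f r)) -> (forall r : R, {for r, continuous f}) ->
  leb.-integrable setT (EFin \o f) -> (forall r, `|r| * `|F r| <= K) ->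
  \int[leb]_r f r = 0.
Proof.
move=> dF cf fi FK.
apply: (@exhaustion_integrable_cvg R setT _ _ f F exhaustionT) => //.
have K0 : 0 <= K by apply: le_trans (FK 0); rewrite normr0 mul0r.
apply: norm_cvg0.
apply: (@squeeze_cvgr _ _ _ _ (cst 0) (fun n => 2 * K * n.+1%:R^-1)) => //.
- apply: nearW => n; rewrite normr_ge0/=.
  apply: le_trans (ler_normB _ _) _.
  have h1 : `|F n.+1%:R| <= K * n.+1%:R^-1.
    by rewrite ler_pdivlMr// mulrC; have := FK n.+1%:R; rewrite normr_nat.
  have h2 : `|F (- n.+1%:R)| <= K * n.+1%:R^-1.
    by rewrite ler_pdivlMr// mulrC; have := FK (- n.+1%:R); rewrite normrN normr_nat.
  rewrite /= -mulrA mulr_natl mulr2n; exact: lerD.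
- exact: cvg_cst.
- rewrite -[X in _ --> X](mulr0 (2 * K)); apply: cvgMr.
  exact: cvg_harmonic.
Qed.

Let norm_cos_le (x : R) : `|cos x| <= 1.
Proof. by rewrite ler_norml cos_geN1 cos_le1. Qed.

Let norm_sin_le (x : R) : `|sin x| <= 1.
Proof. by rewrite ler_norml sin_geN1 sin_le1. Qed.

Let norm_le_1sqr (r : R) : `|r| <= 1 + r ^+ 2.
Proof.
rewrite -[r ^+ 2]real_normK ?num_real//.
have := sqr_ge0 (`|r| - 1); rewrite !expr2; have := normr_ge0 r; nra.
Qed.

Let mphase (z ph : R) : measurable_fun setT (fun r : R => z * r + ph).
Proof. by apply: measurable_funD => //; exact: measurable_funM. Qed.

Let mg : measurable_fun setT g. Proof. exact: measurable_gauss. Qed.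

Lemma integrable_phase0 z ph :
  leb.-integrable setT (EFin \o (fun r => cos (z * r + ph) * g r)).
Proof.
apply: integrable_gauss_le.
  by apply: measurable_funM => //; exact: measurable_fun_cos.
move=> r; rewrite normrM (ger0_norm (gauss_ge0 _ _)).
rewrite ler_wpM2r ?gauss_ge0// (le_trans (norm_cos_le _))// lerDl sqr_ge0//.
Qed.

Lemma integrable_phase1 z ph :
  leb.-integrable setT (EFin \o (fun r => r * sin (z * r + ph) * g r)).
Proof.
apply: integrable_gauss_le.
  apply: measurable_funM => //; apply: measurable_funM => //; exact: measurable_fun_sin.
move=> r; rewrite !normrM (ger0_norm (gauss_ge0 _ _)).
rewrite ler_wpM2r ?gauss_ge0// (le_trans _ (norm_le_1sqr r))//.
by rewrite ler_piMr.
Qed.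

Lemma integrable_phase2 z ph :
  leb.-integrable setT (EFin \o (fun r => r ^+ 2 * cos (z * r + ph) * g r)).
Proof.
apply: integrable_gauss_le.
  apply: measurable_funM => //; apply: measurable_funM => //.
  exact: measurable_fun_cos.
move=> r; rewrite (normrM _ (g r)) (normrM _ (cos _)) (ger0_norm (gauss_ge0 _ _)).
rewrite ler_wpM2r ?gauss_ge0//.
apply: (@le_trans _ _ (r ^+ 2)); last by rewrite lerDr.
by rewrite (ger0_norm (sqr_ge0 r)); apply: ler_piMr; rewrite ?sqr_ge0.
Qed.

(** The free phase [ph] takes the place of complex exponentials: [cos (dotp z y)] does not factor
    over the coordinates, but for one coordinate the others only contribute a phase. *)
Let A z ph := \int[leb]_r (cos (z * r + ph) * g r).
Let B z ph := \int[leb]_r (r * sin (z * r + ph) * g r).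
Let D z ph := \int[leb]_r (r ^+ 2 * cos (z * r + ph) * g r).

(** The derivative of [sin (z * r + ph) * g r] integrates to 0. For [phaseD] the same is done with
    [r * cos (z * r + ph) * g r]. *)
Let phaseB z ph : B z ph = z / (2 * s) * A z ph.
Proof.
have iA := integrable_phase0 z ph; have iB := integrable_phase1 z ph.
have h : \int[leb]_r (z * (cos (z * r + ph) * g r) -
    2 * s * (r * sin (z * r + ph) * g r)) = 0.
  apply: (@Rintegral_derive_eq0 (fun r => sin (z * r + ph) * g r) _ (1 + s^-1)).
  - by move=> r; apply: is_derive_eq; rewrite /GRing.scale/= /gauss; ring.
  - by move=> r; apply: is_derive_continuous.
  - by apply: integrable_EFinB => //; apply: integrable_EFinZl.
  - move=> r; rewrite normrM (ger0_norm (gauss_ge0 _ _)).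
    apply: (@le_trans _ _ ((1 + r ^+ 2) * g r)).
      rewrite mulrA; apply: ler_wpM2r; first exact: gauss_ge0.
      by apply: le_trans (norm_le_1sqr r); exact: ler_piMr.
    have := sqr_gauss_le s0 r; have := gauss_le1 s0 r; lra.
move: h; rewrite RintegralB//; last 2 first.
- exact: integrable_EFinZl.
- exact: integrable_EFinZl.
rewrite !RintegralZl// -/(A z ph) -/(B z ph) => /eqP; rewrite subr_eq0 => /eqP h.
have -> : B z ph = (2 * s)^-1 * (2 * s * B z ph) by field; rewrite gt_eqF.
by rewrite -h; field; rewrite gt_eqF.
Qed.

Let phaseD z ph : D z ph = (2 * s)^-1 * (A z ph - z * B z ph).
Proof.
have iA := integrable_phase0 z ph; have iB := integrable_phase1 z ph.
have iD := integrable_phase2 z ph.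
have h : \int[leb]_r ((cos (z * r + ph) * g r - z * (r * sin (z * r + ph) * g r)) -
    2 * s * (r ^+ 2 * cos (z * r + ph) * g r)) = 0.
  apply: (@Rintegral_derive_eq0 (fun r => r * cos (z * r + ph) * g r) _ s^-1).
  - by move=> r; apply: is_derive_eq; rewrite /GRing.scale/= /gauss; ring.
  - by move=> r; apply: is_derive_continuous.
  - apply: integrable_EFinB => //; last exact: integrable_EFinZl.
    by apply: integrable_EFinB => //; exact: integrable_EFinZl.
  - move=> r; rewrite !normrM (ger0_norm (gauss_ge0 _ _)).
    apply: le_trans (sqr_gauss_le s0 r).
    rewrite mulrA; apply: ler_wpM2r; first exact: gauss_ge0.
    by rewrite mulrA -expr2 real_normK ?num_real//; apply: ler_piMr => //; exact: sqr_ge0.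
move: h; rewrite RintegralB//; last 2 first.
- by apply: integrable_EFinB => //; exact: integrable_EFinZl.
- exact: integrable_EFinZl.
rewrite RintegralB//; last exact: integrable_EFinZl.
rewrite !RintegralZl// -/(A z ph) -/(B z ph) -/(D z ph).
move=> /eqP; rewrite subr_eq0 => /eqP ->; field; rewrite gt_eqF//.
Qed.

Let deriveA (z ph : R) : is_derive z 1 (A ^~ ph) (- B z ph).
Proof.
pose f (x r : R) := cos (x * r + ph) * g r.
have df (x r : R) : is_derive x 1 (f ^~ r) (- (r * sin (x * r + ph) * g r)).
  by apply: is_derive_eq; rewrite /GRing.scale/=; ring.
have d1f x r : (partial1of2 f) x r = - (r * sin (x * r + ph) * g r).
  by rewrite partial1of2E; have [_ ->] := df x r.
have Iz : z \in `]z - 1, z + 1[%classic.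
  by rewrite inE/= in_itv/=; apply/andP; split; lra.
have intG : leb.-integrable setT (EFin \o (fun r : R => `|r| * g r)).
  apply: integrable_gauss_le.
    by apply: measurable_funM => //; exact: measurableT_comp.
  move=> r; rewrite normrM normr_id (ger0_norm (gauss_ge0 _ _)).
  by rewrite ler_wpM2r ?norm_le_1sqr// gauss_ge0.
have h1 x : `]z - 1, z + 1[%classic x -> leb.-integrable setT (EFin \o f x).
  by move=> _; exact: integrable_phase0.
have h2 x r : `]z - 1, z + 1[%classic x -> [set: R] r -> derivable (f ^~ r) x 1.
  by move=> _ _; have [] := df x r.
have h3 x r : `]z - 1, z + 1[%classic x -> [set: R] r ->
    `|(partial1of2 f) x r| <= `|r| * g r.
  move=> _ _; rewrite d1f normrN !normrM (ger0_norm (gauss_ge0 _ _)).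
  by apply: ler_wpM2r; [exact: gauss_ge0|exact: ler_piMr].
have G0 r : 0 <= `|r| * g r by rewrite mulr_ge0// gauss_ge0.
apply: DeriveDef.
  exact: (derivable_under_integral measurableT (set_mem Iz) h1 h2 G0 intG h3).
have := differentiation_under_integral measurableT (set_mem Iz) h1 h2 G0 intG h3.
rewrite derive1E => ->; rewrite /B -mulN1r -RintegralZl//.
  by apply: eq_Rintegral => r _; rewrite d1f mulN1r.
exact: integrable_phase1.
Qed.

Definition gauss_hat z := Num.sqrt (pi / s) * expR (- (z ^+ 2 / (4 * s))).

(** By [deriveA] and [phaseB], [A] solves the linear equation [A' = - z / (2 * s) * A] in [z]; hence
    [A] times [expR (z ^+ 2 / (4 * s))] is constant, and its value at 0 is known from
    [integral_gauss]. *)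
Lemma Rintegral_phase0 z ph :
  \int[leb]_r (cos (z * r + ph) * g r) = cos ph * gauss_hat z.
Proof.
rewrite -/(A z ph).
pose h z := A z ph * expR (z ^+ 2 / (4 * s)).
have dh (x : R) : is_derive x 1 h 0.
  have dA := deriveA x ph.
  apply: is_derive_eq; rewrite /GRing.scale/= phaseB; field; rewrite gt_eqF//.
have hE : h z = h 0 by exact: is_derive_0_is_cst.
have A0 : A 0 ph = cos ph * Num.sqrt (pi / s).
  rewrite /A; under eq_Rintegral do rewrite mul0r add0r.
  rewrite RintegralZl//; last first.
    have := integrable_phase0 0 0.
    by apply: eq_integrable => // r _; rewrite /= mul0r add0r cos0 mul1r.
  by rewrite {1}/Rintegral integral_gauss.
move: hE; rewrite /h A0 expr0n/= mul0r expR0 mulr1 => hE.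
rewrite /gauss_hat mulrA -hE -mulrA -expRD addrN expR0 mulr1//.
Qed.

Lemma Rintegral_phase1 z ph :
  \int[leb]_r (r * sin (z * r + ph) * g r) = z / (2 * s) * cos ph * gauss_hat z.
Proof. by rewrite -/(B z ph) phaseB /A Rintegral_phase0 mulrA. Qed.

Lemma Rintegral_phase2 z ph :
  \int[leb]_r (r ^+ 2 * cos (z * r + ph) * g r) =
  ((2 * s)^-1 - z ^+ 2 / (4 * s ^+ 2)) * cos ph * gauss_hat z.
Proof.
rewrite -/(D z ph) phaseD phaseB /A Rintegral_phase0; field; rewrite gt_eqF//.
Qed.

End gauss_phase.

(** * Gaussian moments in several variables *)

Section gauss_rV.
Context {R : realType}.

Lemma measurable_coord_comp n (f : R -> R) (i : 'I_n) : measurable_fun setT f ->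
  measurable_fun setT (fun y : 'rV[R]_n => f (y ord0 i)).
Proof. by move=> mf; exact: (measurableT_comp mf (@measurable_coord R n i)). Qed.

Lemma integral_prod_le n (w : 'I_n -> R -> R) (M : 'I_n -> R) :
  (forall i r, 0 <= w i r) -> (forall i, measurable_fun setT (w i)) ->
  (forall i, (\int[leb]_r (w i r)%:E <= (M i)%:E)%E) ->
  (\int[lebesgue_rV n]_y (\prod_i w i (y ord0 i))%:E <= (\prod_i M i)%:E)%E.
Proof.
elim: n w M => [|n IH] w M w0 mw wM.
  rewrite big_ord0 integral_dirac//=; first by rewrite diracE in_setT mul1e !big_ord0 lexx.
  apply/measurable_EFinP; under eq_fun do rewrite big_ord0; exact: measurable_cst.
have M0 i : 0 <= M i.
  by rewrite -lee_fin; apply: le_trans (wM i); apply: integral_ge0 => r _; rewrite lee_fin.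
rewrite ge0_integral_rV_cons; last 2 first.
- apply/measurable_EFinP; apply: measurable_fun_prod_ord => i.
  exact: measurable_coord_comp.
- by move=> y; rewrite lee_fin prodr_ge0.
pose w' i := w (lift ord0 i).
have p0 (p : 'rV[R]_n) : 0 <= \prod_i w' i (p ord0 i) by rewrite prodr_ge0// => i _; exact: w0.
apply: (@le_trans _ _ (\int[lebn n]_p
    ((M ord0)%:E * (\prod_i w' i (p ord0 i))%:E))%E).
  apply: ge0_integral_mono => p _.
    by apply: integral_ge0 => r _; rewrite lee_fin prodr_ge0.
  have E r : ((\prod_i w i (rV_cons (p, r) ord0 i))%:E =
      (\prod_i w' i (p ord0 i))%:E * (w ord0 r)%:E)%E.
    rewrite big_ord_recl rV_cons0 mulrC EFinM; congr (_%:E * _)%E.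
    by apply: eq_bigr => i _; rewrite rV_consS.
  under eq_integral do rewrite E.
  rewrite ge0_integralZl_EFin//; last 2 first.
  - by move=> r _; rewrite lee_fin.
  - by apply/measurable_EFinP; exact: mw.
  rewrite muleC; apply: lee_wpmul2r; [by rewrite lee_fin|exact: wM].
rewrite ge0_integralZl_EFin//; last 2 first.
- by move=> p _; rewrite lee_fin; exact: p0.
- apply/measurable_EFinP; apply: measurable_fun_prod_ord => i.
  exact: (measurable_coord_comp i (mw (lift ord0 i))).
rewrite big_ord_recl EFinM; apply: lee_wpmul2l; first by rewrite lee_fin.
by apply: IH => i; [move=> r; exact: w0|exact: mw|exact: wM].
Qed.

Variable s : R.
Hypothesis s0 : 0 < s.
Local Notation g := (gauss s).

(* The Fourier transform of r^k exp(- s r^2) divided by that of exp(- s r^2), up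
   to a phase, for k <= 2. *)
Definition hat_factor (k : nat) (z : R) : R :=
  match k with
  | 0%N => 1
  | 1%N => z / (2 * s)
  | _ => (2 * s)^-1 - z ^+ 2 / (4 * s ^+ 2)
  end.

Lemma moment_gauss_le k r : (k <= 2)%N -> `|r ^+ k * g r| <= (1 + r ^+ 2) * g r.
Proof.
move=> k2; rewrite normrM (ger0_norm (gauss_ge0 _ _)).
apply: ler_wpM2r; first exact: gauss_ge0.
rewrite normrX -[r ^+ 2]real_normK ?num_real//.
have := sqr_ge0 (`|r| - 1); have := normr_ge0 r.
by case: k k2 => [|[|[|]]]// _; rewrite ?expr0 ?expr1 ?expr2; nra.
Qed.

Lemma measurable_moment_gauss k : measurable_fun setT (fun r : R => r ^+ k * g r).
Proof. by apply: measurable_funM => //; exact: measurable_gauss. Qed.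

(** Each factor [r] is a derivative in [z], that is, a quarter turn of the phase. For [k = 1] the
    turn stays visible; for [k = 2] the half turn is a sign, which [hat_factor] contains. *)
Lemma Rintegral_moment k z ph : (k <= 2)%N ->
  \int[leb]_r (cos (z * r + ph) * (r ^+ k * g r)) =
  hat_factor k z * gauss_hat s z * cos (ph + (k == 1%N)%:R * (pi / 2)).
Proof.
case: k => [|[|[|]]]// _ /=.
- under eq_Rintegral do rewrite expr0 mul1r.
  by rewrite Rintegral_phase0// mul0r addr0 mul1r mulrC.
- under eq_Rintegral => r _ do rewrite expr1 -sinDpihalf -addrA mulrA (mulrC (sin _)).
  by rewrite Rintegral_phase1// mul1r mulrAC.
- under eq_Rintegral => r _ do rewrite mulrA (mulrC (cos _)).
  by rewrite Rintegral_phase2// mul0r addr0 mulrAC.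
Qed.

Lemma integral_moments_le n :
  (\int[lebesgue_rV n]_y (\prod_i ((1 + y ord0 i ^+ 2) * g (y ord0 i)))%:E <=
   (\prod_(i < n) ((1 + (s / 2)^-1) * Num.sqrt (pi / (s / 2))))%:E)%E.
Proof.
apply: (@integral_prod_le n (fun _ r => (1 + r ^+ 2) * g r)).
- by move=> _ r; rewrite mulr_ge0 ?addr_ge0 ?sqr_ge0 ?gauss_ge0.
- move=> _; apply: measurable_funM; last exact: measurable_gauss.
  by apply: measurable_funD => //; exact: measurable_funX.
- by move=> _; exact: integral_moment_gauss.
Qed.

Let F n (z : 'rV[R]_n) (k : 'I_n -> nat) ph (y : 'rV[R]_n) :=
  cos (dotp z y + ph) * \prod_i (y ord0 i ^+ k i * g (y ord0 i)).

Let mF n (z : 'rV[R]_n) (k : 'I_n -> nat) ph : measurable_fun setT (F z k ph).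
Proof.
apply: measurable_funM.
  apply: measurable_fun_cos; apply: measurable_funD => //.
  by apply: measurable_dotp => i //; exact: measurable_coord.
apply: measurable_fun_prod_ord => i.
exact: (measurable_coord_comp i (measurable_moment_gauss (k i))).
Qed.

Let F_le n (z : 'rV[R]_n) (k : 'I_n -> nat) ph y : (forall i, (k i <= 2)%N) ->
  `|F z k ph y| <= \prod_i ((1 + y ord0 i ^+ 2) * g (y ord0 i)).
Proof.
move=> k2; rewrite normrM normr_prod -[leRHS]mul1r ler_pM ?prodr_ge0//.
  by rewrite ler_norml cos_geN1 cos_le1.
apply: ler_prod => i _; rewrite normr_ge0/=; exact: moment_gauss_le.
Qed.

Lemma integrable_moments n (z : 'rV[R]_n) (k : 'I_n -> nat) ph :
  (forall i, (k i <= 2)%N) ->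
  (lebesgue_rV n).-integrable setT (EFin \o (fun y : 'rV[R]_n =>
    cos (dotp z y + ph) * \prod_i (y ord0 i ^+ k i * g (y ord0 i)))).
Proof.
move=> k2; apply: (integrable_of_le measurableT (mF z k ph) (fun y _ => F_le z ph y k2)).
exact: integral_moments_le.
Qed.

(** Induction on the dimension. With the other coordinates fixed, the first one sees the phase
    [dotp z' p + ph]; integrating it out returns a cosine of the same kind in fewer variables, its
    phase increased by a quarter turn if the exponent was 1. *)
Lemma Rintegral_moments n (z : 'rV[R]_n) (k : 'I_n -> nat) ph :
  (forall i, (k i <= 2)%N) ->
  \int[lebesgue_rV n]_y
    (cos (dotp z y + ph) * \prod_i (y ord0 i ^+ k i * g (y ord0 i))) =
  \prod_i (hat_factor (k i) (z ord0 i) * gauss_hat s (z ord0 i)) *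
    cos (ph + (\sum_i (k i == 1)%N)%:R * (pi / 2)).
Proof.
elim: n z k ph => [|n IH] z k ph k2.
  rewrite /Rintegral integral_dirac//; last by apply/measurable_EFinP; exact: mF.
  by rewrite diracT mul1e /= /dotp !big_ord0 mul0r addr0 add0r mulr1 mul1r.
set z' : 'rV[R]_n := \row_i z ord0 (lift ord0 i).
pose k' i := k (lift ord0 i).
have k2' i : (k' i <= 2)%N by exact: k2.
have FE p r : F z k ph (rV_cons (p, r)) =
    cos (z ord0 ord0 * r + (dotp z' p + ph)) * (r ^+ k ord0 * g r) *
    \prod_i (p ord0 i ^+ k' i * g (p ord0 i)).
  rewrite /F /dotp !big_ord_recl rV_cons0 /= !mulrA -!(mulrA (cos _)) -!addrA -!mulrA.
  congr (cos _ * (_ * (_ * _))).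
    by congr (_ + (_ + _)); apply: eq_bigr => i _; rewrite rV_consS mxE.
  by apply: eq_bigr => i _; rewrite rV_consS.
have intF : (lebn n \x leb)%E.-integrable setT (EFin \o F z k ph \o @rV_cons R n).
  pose G (y : 'rV[R]_n.+1) := \prod_i ((1 + y ord0 i ^+ 2) * g (y ord0 i)).
  have mG : measurable_fun setT G.
    apply: measurable_fun_prod_ord => i.
    apply: (@measurable_coord_comp _ (fun r : R => (1 + r ^+ 2) * g r)).
    apply: measurable_funM; last exact: measurable_gauss.
    by apply: measurable_funD => //; exact: measurable_funX.
  have G0 y : 0 <= G y.
    by apply: prodr_ge0 => i _; rewrite mulr_ge0 ?addr_ge0 ?sqr_ge0 ?gauss_ge0.
  apply: (@integrable_of_le _ _ _ _ setT (F z k ph \o @rV_cons R n) (G \o @rV_cons R n)) => //.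
  - exact: (measurableT_comp (mF z k ph) (@measurable_rV_cons R n)).
  - by move=> y _; exact: F_le.
  - rewrite (fubini_tonelli1 (fun y => ((G \o @rV_cons R n) y)%:E))/=.
    + rewrite -(ge0_integral_rV_cons (f := fun y => (G y)%:E)).
      * exact: integral_moments_le.
      * exact/measurable_EFinP.
      * by move=> y; rewrite lee_fin.
    + apply/measurable_EFinP.
      exact: (measurableT_comp mG (@measurable_rV_cons R n)).
    + by move=> y; rewrite lee_fin.
rewrite [LHS](@Rintegral_rV_consE R n (F z k ph))//.
transitivity (\int[lebesgue_rV n]_p
    (hat_factor (k ord0) (z ord0 ord0) * gauss_hat s (z ord0 ord0) *
     F z' k' (ph + (k ord0 == 1%N)%:R * (pi / 2)) p)).
  apply: eq_Rintegral => p _.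
  under eq_Rintegral => r _ do rewrite FE.
  rewrite RintegralZr//; last first.
    apply: (integrable_gauss_le s0).
      apply: measurable_funM; last exact: measurable_moment_gauss.
      by apply: measurable_fun_cos; apply: measurable_funD => //; exact: measurable_funM.
    move=> r; rewrite normrM -[leRHS]mul1r ler_pM//.
      by rewrite ler_norml cos_geN1 cos_le1.
    by apply: moment_gauss_le; exact: k2.
  by rewrite Rintegral_moment// /F addrA [RHS]mulrA.
rewrite RintegralZl//; last exact: integrable_moments.
rewrite [X in _ * X]IH// !big_ord_recl natrD -[in LHS]addrA -mulrDl mulrA.
by congr (_ * _ * _); apply: eq_bigr => i _; rewrite mxE.
Qed.

End gauss_rV.

(** * The kernel of the Leray-projected heat semigroup *)

Section leray_representation.
Context {R : realType}.

(* heatG is the heat kernel and heatH j k its second derivative d_j d_k. *)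
Definition heatG d (z : 'rV[R]_d) (s : R) : R :=
  Num.sqrt (4 * pi * s) ^- d * expR (- (dotp z z / (4 * s))).

Definition heatH d (j k : 'I_d) (z : 'rV[R]_d) (s : R) : R :=
  (z ord0 j * z ord0 k / (4 * s ^+ 2) - (j == k)%:R / (2 * s)) * heatG z s.

Lemma prod_gauss d s (y : 'rV[R]_d) :
  \prod_i gauss s (y ord0 i) = expR (- (s * dotp y y)).
Proof.
rewrite /gauss -expR_sum; congr expR.
rewrite sumrN mulr_sumr; congr (- _); exact: eq_bigr.
Qed.

Lemma prod_gauss_hat d s (z : 'rV[R]_d) : 0 < s ->
  (2 * pi) ^- d * \prod_i gauss_hat s (z ord0 i) = heatG z s.
Proof.
move=> s0; rewrite /gauss_hat big_split/= prodr_const card_ord mulrA.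
congr (_ * _); last first.
  rewrite -expR_sum; congr expR.
  rewrite sumrN mulr_suml; congr (- _); exact: eq_bigr.
have p0 : 0 < pi :> R := pi_gt0 R.
rewrite -exprVn -exprMn -exprVn; congr (_ ^+ _).
have h1 : 0 <= (2 * pi)^-1 * Num.sqrt (pi / s).
  by rewrite mulr_ge0 ?invr_ge0 ?mulr_ge0 ?sqrtr_ge0 ?(ltW p0).
have h2 : 0 <= (Num.sqrt (4 * pi * s))^-1 by rewrite invr_ge0 sqrtr_ge0.
apply/eqP; rewrite -(eqrXn2 (isT : (0 < 2)%N) h1 h2).
have h3 : 0 <= pi / s by rewrite divr_ge0 ?(ltW p0) ?(ltW s0).
have h4 : 0 <= 4 * pi * s by rewrite !mulr_ge0 ?(ltW p0) ?(ltW s0).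
rewrite exprMn (sqr_sqrtr h3) !exprVn (sqr_sqrtr h4).
clear -p0 s0; move: pi p0 => p p0; apply/eqP; field.
by rewrite !(gt_eqF p0, gt_eqF s0).
Qed.

Variable d : nat.
Implicit Types (z y : 'rV[R]_d) (j k : 'I_d).

Lemma heatG_fourier z s : 0 < s ->
  (2 * pi) ^- d * \int[lebesgue_rV d]_y (cos (dotp z y) * expR (- (s * dotp y y)))
  = heatG z s.
Proof.
move=> s0; have := @Rintegral_moments R s s0 d z (fun=> 0%N) 0 (fun=> isT).
under eq_Rintegral => y _.
  rewrite addr0; under eq_bigr do rewrite expr0 mul1r.
  rewrite prod_gauss; over.
move=> ->; rewrite [in X in cos X]big1// mul0r addr0 cos0 mulr1.
by under eq_bigr do rewrite mul1r; exact: prod_gauss_hat.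
Qed.

Let kk j k (i : 'I_d) : nat := ((i == j) + (i == k))%N.

Let prod_kk j k y : \prod_i y ord0 i ^+ kk j k i = y ord0 j * y ord0 k.
Proof.
under eq_bigr do rewrite exprD; rewrite big_split/=; congr (_ * _).
  rewrite (bigD1 j)//= eqxx expr1 big1 ?mulr1// => i /negbTE ->.
  by rewrite expr0.
rewrite (bigD1 k)//= eqxx expr1 big1 ?mulr1// => i /negbTE ->.
by rewrite expr0.
Qed.

Let kk_le2 j k i : (kk j k i <= 2)%N.
Proof. by rewrite /kk; case: (_ == _); case: (_ == _). Qed.

(** On the diagonal one coordinate carries a second moment and the phase stays 0. Off the diagonal
    two coordinates carry first moments, and the phase [pi] produces the sign. *)
Lemma heatH_fourier j k z s : 0 < s ->
  (2 * pi) ^- d * \int[lebesgue_rV d]_y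
     (cos (dotp z y) * (y ord0 j * y ord0 k * expR (- (s * dotp y y))))
  = - heatH j k z s.
Proof.
move=> s0; have := @Rintegral_moments R s s0 d z (kk j k) 0 (kk_le2 j k).
under eq_Rintegral => y _.
  rewrite addr0 big_split/= prod_gauss prod_kk; over.
have AC (X P Q c : R) : X * (P * Q * c) = P * c * (X * Q) by ring.
move=> ->; rewrite big_split/= add0r AC prod_gauss_hat// -mulNr; congr (_ * _).
have [<-|jk] := eqVneq j k.
  rewrite (bigD1 j)//= {1}/kk eqxx big1 => [|i ij]; last first.
    by rewrite /kk (negbTE ij).
  rewrite big1 ?mul0r ?cos0 ?mulr1 => [|i _]; last by rewrite /kk; case: (i == j).
  by rewrite /hat_factor; field; rewrite gt_eqF.
rewrite (bigD1 j)//= (bigD1 k) ?[k == j]eq_sym//=.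
rewrite big1 => [|i /andP[ij ik]]; last by rewrite /kk (negbTE ij) (negbTE ik).
rewrite (bigD1 j)//= (bigD1 k) ?[k == j]eq_sym//=.
rewrite big1 => [|i /andP[ij ik]]; last by rewrite /kk (negbTE ij) (negbTE ik).
rewrite /kk !eqxx (negbTE jk) eq_sym (negbTE jk) /= addn0.
rewrite (_ : 2%:R * (pi / 2) = pi :> R) ?cospi; last by field.
by field; rewrite gt_eqF.
Qed.

Lemma measurable_exp_dotp (s : R) :
  measurable_fun setT (fun y : 'rV[R]_d => expR (- (s * dotp y y))).
Proof.
apply: measurable_fun_expR; apply: measurableT_comp => //.
by apply: measurable_funM => //; apply: measurable_dotp => i; exact: measurable_coord.
Qed.

Lemma integral_exp_dotp_le (s : R) : 0 < s ->
  (\int[lebesgue_rV d]_y (expR (- (s * dotp y y)))%:E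
    <= (Num.sqrt (pi / s) ^+ d)%:E)%E.
Proof.
move=> s0; under eq_integral do rewrite -prod_gauss.
rewrite -[d in (_ ^+ d)%:E]card_ord -prodr_const.
apply: (@integral_prod_le _ d (fun=> gauss s)) => [i r|i|i].
- exact: gauss_ge0.
- exact: measurable_gauss.
- by rewrite integral_gauss.
Qed.

Lemma norm_coordM_le y j k : `|y ord0 j * y ord0 k| <= dotp y y.
Proof.
rewrite normrM -enorm_sqr expr2; apply: ler_pM => //; exact: coord_le_enorm.
Qed.

(* The tail integral of exp (- q s) removes the denominator of the symbol. *)
Lemma integral_exp_tail (q tau : R) : 0 < q ->
  (\int[leb]_(s in `]tau, +oo[) (q * expR (- (s * q)))%:E
    = (expR (- (tau * q)))%:E)%E.
Proof.
move=> q0.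
apply: (@exhaustion_ge0_cvg R _ _ _ (fun s => q * expR (- (s * q)))
  (fun s => - expR (- (s * q))) (exhaustion_oy tau)).
- by move=> s _; apply: is_derive_continuous.
- by move=> s _; apply: is_derive_eq; rewrite /GRing.scale/=; ring.
- by move=> s _; rewrite mulr_ge0 ?expR_ge0// ltW.
apply: (@cvg_harmonic_dist _ _ _ (expR (- (tau * q)) * (q + q^-1))) => n.
set a := n.+2%:R^-1; set b := n.+1%:R.
have a0 : 0 < a by rewrite invr_gt0.
have b0 : 0 < b by [].
have ab : a <= b^-1 by rewrite lef_pV2 ?posrE// ler_nat.
have -> : - expR (- ((tau + b) * q)) - - expR (- ((tau + a) * q)) - expR (- (tau * q))
    = expR (- (tau * q)) * (expR (- (a * q)) - 1 - expR (- (b * q))).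
  by rewrite !mulrDl !opprD !expRD; ring.
rewrite normrM (gtr0_norm (expR_gt0 _)) -mulrA ler_wpM2l ?expR_ge0//.
have h1 : 1 - a * q <= expR (- (a * q)) by have := expR_ge1Dx (- (a * q)).
have h2 : expR (- (a * q)) <= 1 by rewrite expR_le1 oppr_le0 mulr_ge0 ?ltW.
have h3 : expR (- (b * q)) <= q^-1 * b^-1.
  rewrite expRN -invfM lef_pV2 ?posrE ?expR_gt0 ?mulr_gt0// mulrC.
  by apply: le_trans (expR_ge1Dx _); rewrite lerDr.
have h4 : a * q <= q * b^-1 by rewrite mulrC ler_wpM2l// ltW.
have h5 := expR_gt0 (- (b * q)).
have h6 : 0 <= a * q by rewrite mulr_ge0 ?ltW.
rewrite mulrDl ler_norml.
move: (expR (- (a * q))) (expR (- (b * q))) (q * b^-1) (q^-1 * b^-1) (a * q)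
  h1 h2 h3 h4 h5 h6 => v w x y z *.
by apply/andP; split; lra.
Qed.

Lemma Rintegral_exp_tail y j k (tau : R) :
  \int[leb]_(s in `]tau, +oo[) (y ord0 j * y ord0 k * expR (- (s * dotp y y)))
  = y ord0 j * y ord0 k / dotp y y * expR (- (tau * dotp y y)).
Proof.
(* At [y = 0] division by zero returns 0, which agrees with the vanishing integrand. *)
have [q0|q0] := eqVneq (dotp y y) 0.
  have y0 : y ord0 j * y ord0 k = 0.
    by apply/eqP; have := norm_coordM_le y j k; rewrite q0 normr_le0.
  rewrite y0 !mul0r /Rintegral integral0_eq// => s _; by rewrite mul0r.
have q1 : 0 < dotp y y by rewrite lt_def q0 dotp_ge0.
have mD : measurable (`]tau, +oo[%classic : set (measurableTypeR R)).
  exact: measurable_itv.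
transitivity (\int[leb]_(s in `]tau, +oo[)
    (y ord0 j * y ord0 k / dotp y y * (dotp y y * expR (- (s * dotp y y))))).
  by apply: eq_Rintegral => s _; rewrite [RHS]mulrA divfK.
rewrite RintegralZl//; first by rewrite /Rintegral integral_exp_tail.
apply: (@integrable_of_le _ (measurableTypeR R) R leb _ _
  (fun s => dotp y y * expR (- (s * dotp y y))) (expR (- (tau * dotp y y)))) => //.
- apply: measurable_funM => //; apply: measurable_fun_expR.
  by apply: measurableT_comp => //; exact: measurable_funM.
- by move=> s _; rewrite ger0_norm// mulr_ge0 ?expR_ge0 ?ltW.
- by rewrite integral_exp_tail.
Qed.

(** The exchange of the frequency and time integrals is dominated:
    [dotp y y * expR (- (s * dotp y y))] integrates over [s > tau] to at most a Gaussian in [y]. The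
    factor [(2 * pi) ^+ d] stays under the integral until [heatH] is known to be integrable. *)
Lemma leray_kernel_tail j k z (tau : R) : 0 < tau ->
  leray_kernel z tau j k =
  (j == k)%:R * heatG z tau -
  (2 * pi) ^- d * \int[leb]_(s in `]tau, +oo[) (- (2 * pi) ^+ d * heatH j k z s).
Proof.
move=> tau0; rewrite mxE.
pose f (p : 'rV[R]_d * measurableTypeR R) : R :=
  cos (dotp z p.1) * (p.1 ord0 j * p.1 ord0 k * expR (- (p.2 * dotp p.1 p.1))).
have mdot1 : measurable_fun setT
    (fun p : 'rV[R]_d * measurableTypeR R => dotp p.1 p.1).
  by apply: measurable_dotp => i; exact: (measurableT_comp (@measurable_coord R d i)).
have mf : measurable_fun setT f.
  apply: measurable_funM.
    apply: measurable_fun_cos; apply: measurable_dotp => i //.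
    exact: (measurableT_comp (@measurable_coord R d i)).
  apply: measurable_funM.
    by apply: measurable_funM; exact: (measurableT_comp (@measurable_coord R d _)).
  apply: measurable_fun_expR; apply: measurableT_comp => //.
  exact: measurable_funM.
have mD : measurable (`]tau, +oo[%classic : set (measurableTypeR R)).
  exact: measurable_itv.
have cos1 (r : R) : `|cos r| <= 1 by rewrite ler_norml cos_geN1 cos_le1.
have fub := @RintegralC_dom _ _ _ _ R (lebn d) leb _ f
  (Num.sqrt (pi / tau) ^+ d) mD mf.
have {}fub : \int[lebesgue_rV d]_y \int[leb]_(s in `]tau, +oo[) f (y, s) =
    \int[leb]_(s in `]tau, +oo[) \int[lebesgue_rV d]_y f (y, s).
  apply: fub; apply: le_trans (integral_exp_dotp_le tau0).
  apply: ge0_integral_mono => y _; first by apply: integral_ge0 => s _; rewrite lee_fin.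
  have [q0|q0] := eqVneq (dotp y y) 0.
    have y0 : y ord0 j * y ord0 k = 0.
      by apply/eqP; have := norm_coordM_le y j k; rewrite q0 normr_le0.
    rewrite integral0_eq ?lee_fin ?expR_ge0// => s _.
    by rewrite /f /= y0 mul0r mulr0 normr0.
  have q1 : 0 < dotp y y by rewrite lt_def q0 dotp_ge0.
  rewrite -(integral_exp_tail tau q1); apply: ge0_integral_mono => s _.
    by rewrite lee_fin.
  rewrite lee_fin /f /= normrM normrM (ger0_norm (expR_ge0 _)) -[leRHS]mul1r.
  apply: ler_pM; [exact: normr_ge0| |exact: cos1|].
    by apply: mulr_ge0; [exact: normr_ge0|exact: expR_ge0].
  by apply: ler_wpM2r; [exact: expR_ge0|exact: norm_coordM_le].
transitivity ((2 * pi) ^- d * ((j == k)%:R *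
    \int[lebesgue_rV d]_y (cos (dotp z y) * expR (- (tau * dotp y y))) -
    \int[lebesgue_rV d]_y \int[leb]_(s in `]tau, +oo[) f (y, s))).
  congr (_ * _).
  have E y : \int[leb]_(s in `]tau, +oo[) f (y, s) =
      cos (dotp z y) * (y ord0 j * y ord0 k / dotp y y * expR (- (tau * dotp y y))).
    rewrite -Rintegral_exp_tail -RintegralZl//.
    have [q0|q0] := eqVneq (dotp y y) 0.
      have y0 : y ord0 j * y ord0 k = 0.
        by apply/eqP; have := norm_coordM_le y j k; rewrite q0 normr_le0.
      apply: (eq_integrable mD (cst 0%E)); last exact: integrable0.
      by move=> s _; rewrite /= y0 mul0r.
    have q1 : 0 < dotp y y by rewrite lt_def q0 dotp_ge0.
    apply: (@integrable_of_le _ (measurableTypeR R) R leb _ _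
      (fun s => dotp y y * expR (- (s * dotp y y))) (expR (- (tau * dotp y y)))) => //.
    + apply: measurable_funM => //; apply: measurable_fun_expR.
      by apply: measurableT_comp => //; exact: measurable_funM.
    + move=> s _; rewrite normrM (ger0_norm (expR_ge0 _)).
      by apply: ler_wpM2r; [exact: expR_ge0|exact: norm_coordM_le].
    + by rewrite integral_exp_tail.
  have mcos : measurable_fun setT (fun y => cos (dotp z y)).
    by apply: measurable_fun_cos; apply: measurable_dotp => i //; exact: measurable_coord.
  have mexp := measurable_exp_dotp tau.
  have i1 : (lebesgue_rV d).-integrable setT
      (EFin \o (fun y => cos (dotp z y) * expR (- (tau * dotp y y)))).
    apply: (integrable_of_le measurableT _ _ (integral_exp_dotp_le tau0)).
      exact: measurable_funM.
    move=> y _; rewrite normrM (ger0_norm (expR_ge0 _)) -[leRHS]mul1r.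
    by apply: ler_wpM2r; [exact: expR_ge0|exact: cos1].
  have i2 : (lebesgue_rV d).-integrable setT
      (EFin \o (fun y => \int[leb]_(s in `]tau, +oo[) f (y, s))).
    apply: (integrable_of_le measurableT _ _ (integral_exp_dotp_le tau0)).
      under eq_fun do rewrite E.
      apply: measurable_funM => //; apply: measurable_funM => //.
      apply: measurable_funM; first by apply: measurable_funM; exact: measurable_coord.
      by apply: measurable_funV; apply: measurable_dotp => i; exact: measurable_coord.
    move=> y _; rewrite E mulrA normrM (ger0_norm (expR_ge0 _)) -[leRHS]mul1r.
    apply: ler_wpM2r; first exact: expR_ge0.
    rewrite normrM -[leRHS]mul1r; apply: ler_pM => //.
    rewrite normrM normfV (ger0_norm (dotp_ge0 y)).
    have [->|q0] := eqVneq (dotp y y) 0; first by rewrite invr0 mulr0.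
    have q1 : 0 < dotp y y by rewrite lt_def q0 dotp_ge0.
    by rewrite ler_pdivrMr// mul1r norm_coordM_le.
  rewrite -RintegralZl// -RintegralB//; last exact: integrable_EFinZl.
  apply: eq_Rintegral => y _; rewrite E mxE enorm_sqr; ring.
rewrite fub mulrBr mulrCA heatG_fourier//; congr (_ + _).
have p0 : 0 < (2 * pi : R) ^+ d by rewrite exprn_gt0// mulr_gt0 ?pi_gt0.
congr (- (_ * _)); apply: eq_Rintegral => s; rewrite inE/= in_itv/= andbT => ts.
have s0 : 0 < s by exact: lt_trans ts.
by rewrite mulNr -mulrN -(heatH_fourier j k z s0) mulrA mulfV ?gt_eqF// mul1r.
Qed.

End leray_representation.

(** * Pointwise bounds for the heat kernel and its second derivatives *)

Section heat_estimates.
Context {R : realType}.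

Lemma exp_decay (m : nat) : exists2 C : R, 0 < C & forall d (z : 'rV[R]_d) (s : R),
  0 < s -> expR (- (dotp z z / (4 * s))) <= C * (Num.sqrt s / br s z) ^+ m.
Proof.
pose M : R := m.+1%:R; have M0 : 0 < M by rewrite ltr0n.
exists ((4 * M) ^+ m.+1) => [|d z s s0]; first by rewrite exprn_gt0 ?mulr_gt0.
set q := dotp z z; have q0 : 0 <= q := dotp_ge0 z.
have b0 := br_gt0 z s0; have sg0 : 0 < Num.sqrt s by rewrite sqrtr_gt0.
set rho := Num.sqrt s / br s z.
have rho0 : 0 < rho by rewrite divr_gt0.
have rho1 : rho <= 1 by rewrite ler_pdivrMr// mul1r sqrt_le_br.
have rho2 : rho ^+ 2 = s / (q + s) by rewrite expr_div_n sqr_sqrtr ?(ltW s0)// br_sqr ?(ltW s0).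
apply: (@le_trans _ _ ((4 * M) ^+ m.+1 * (rho ^+ 2) ^+ m.+1)); last first.
  rewrite ler_pM2l ?exprn_gt0 ?mulr_gt0// -exprM.
  apply: ler_wiXn2l; rewrite ?(ltW rho0)//.
  by rewrite (leq_trans (leqnSn m))// leq_pmull.
have qs0 : 0 < q + s by rewrite ltr_wpDl.
rewrite rho2 expRN -exprMn -[leRHS]invrK lef_pV2 ?posrE ?expR_gt0//; last first.
  by rewrite invr_gt0 exprn_gt0// !mulr_gt0 ?invr_gt0.
pose r := q / (4 * s).
have r0 : 0 <= r by rewrite divr_ge0 ?mulr_ge0 ?(ltW s0).
have rM0 : 0 <= r / M by rewrite divr_ge0 ?(ltW M0).
rewrite -/r (_ : r = m.+1%:R * (r / M)); last by rewrite mulrC divfK// gt_eqF.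
rewrite expRM_natl -exprVn; apply: lerXn2r; rewrite ?nnegrE ?expR_ge0//.
  by rewrite invr_ge0 !mulr_ge0 ?(ltW M0) ?(ltW s0)// invr_ge0 ltW.
apply: (@le_trans _ _ (1 + r / M)); last exact: expR_ge1Dx.
have -> : (4 * M * (s / (q + s)))^-1 = (1 + 4 * r) / (4 * M).
  by rewrite /r; field; rewrite !gt_eqF.
rewrite ler_pdivrMr ?mulr_gt0//.
have -> : (1 + r / M) * (4 * M) = 4 * M + 4 * r by field; rewrite gt_eqF.
have M1 : 1 <= M by rewrite ler1n.
lra.
Qed.

Variable d : nat.
Implicit Types (z w : 'rV[R]_d) (j k : 'I_d).

Lemma heatG_ge0 z s : 0 <= heatG z s.
Proof. by rewrite mulr_ge0 ?expR_ge0// invr_ge0 exprn_ge0// sqrtr_ge0. Qed.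

(** Of [d + m] powers of decay, [d] turn the singular prefactor into [br s z ^- d]. The other [m]
    are a reserve against negative powers of [s]. *)
Lemma heatG_le (m : nat) : exists2 C : R, 0 < C & forall z (s : R), 0 < s ->
  heatG z s <= C * (br s z ^- d * (Num.sqrt s / br s z) ^+ m).
Proof.
have [C C0 hC] := exp_decay (d + m); exists C => // z s s0.
have b0 := br_gt0 z s0; have sg0 : 0 < Num.sqrt s by rewrite sqrtr_gt0.
apply: (@le_trans _ _ (Num.sqrt s ^- d * (C * (Num.sqrt s / br s z) ^+ (d + m)))).
  apply: ler_pM; [by rewrite invr_ge0 exprn_ge0// sqrtr_ge0|exact: expR_ge0| |exact: hC].
  have h : Num.sqrt s <= Num.sqrt (4 * pi * s).
    have pp : 2 <= pi :> R := pi_ge2 R.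
    rewrite ler_sqrt; last by rewrite !mulr_ge0 ?(ltW s0)// pi_ge0.
    by rewrite ler_peMl ?(ltW s0)//; lra.
  have sg1 : 0 < Num.sqrt (4 * pi * s) := lt_le_trans sg0 h.
  rewrite lef_pV2 ?posrE ?exprn_gt0//.
  by apply: lerXn2r => //; rewrite nnegrE ltW.
rewrite mulrCA ler_pM2l// exprD mulrA expr_div_n mulrA.
by rewrite mulVf ?mul1r// gt_eqF// exprn_gt0.
Qed.

Definition heat_coef j k z (s : R) : R :=
  z ord0 j * z ord0 k / (4 * s ^+ 2) - (j == k)%:R / (2 * s).

Lemma coord_le_br z (s : R) j : 0 <= s -> `|z ord0 j| <= br s z.
Proof. by move=> s0; apply: le_trans (coord_le_enorm z j) (enorm_le_br z s0). Qed.

Lemma heat_coef_le j k z (s : R) : 0 < s ->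
  `|heat_coef j k z s| <= br s z ^+ 2 / Num.sqrt s ^+ 4.
Proof.
move=> s0; have b0 := br_gt0 z s0.
have -> : Num.sqrt s ^+ 4 = s ^+ 2 by rewrite (exprM _ 2 2) sqr_sqrtr// ltW.
have hj := coord_le_br z j (ltW s0); have hk := coord_le_br z k (ltW s0).
have sb : s <= br s z ^+ 2 by rewrite br_sqr ?(ltW s0)// lerDr dotp_ge0.
have h1 : `|z ord0 j * z ord0 k| <= br s z ^+ 2.
  by rewrite normrM expr2; apply: ler_pM.
have h2 : `|((j == k)%:R : R)| <= 1 by case: (j == k); rewrite ?normr1 ?normr0.
have s2 : 0 < s ^+ 2 by rewrite exprn_gt0.
rewrite /heat_coef (_ : _ - _ = (z ord0 j * z ord0 k / 4 - (j == k)%:R * s / 2) / s ^+ 2);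
  last by field; rewrite gt_eqF.
rewrite normrM normfV (gtr0_norm s2); apply: ler_wpM2r; first by rewrite invr_ge0 ltW.
apply: le_trans (ler_normB _ _) _.
have -> : `|z ord0 j * z ord0 k / 4| = `|z ord0 j * z ord0 k| / 4.
  by rewrite normrM normfV (@ger0_norm _ 4).
have -> : `|(j == k)%:R * s / 2| = `|((j == k)%:R : R)| * s / 2.
  by rewrite normrM normfV (@ger0_norm _ 2)// normrM (gtr0_norm s0).
have h3 : `|((j == k)%:R : R)| * s <= s by rewrite ler_piMl// ltW.
lra.
Qed.

Lemma heatH_le j k : exists2 C : R, 0 < C & forall z (s : R), 0 < s ->
  `|heatH j k z s| <= C * br s z ^- (d + 2).
Proof.
(* The reserve 4 cancels the factor [Num.sqrt s ^- 4] of [heat_coef_le]. *)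
have [C C0 hC] := heatG_le 4; exists C => // z s s0.
have b0 := br_gt0 z s0; have sg0 : 0 < Num.sqrt s by rewrite sqrtr_gt0.
rewrite normrM (ger0_norm (heatG_ge0 _ _)).
apply: (@le_trans _ _ (br s z ^+ 2 / Num.sqrt s ^+ 4 *
   (C * (br s z ^- d * (Num.sqrt s / br s z) ^+ 4)))).
  by apply: ler_pM => //; [exact: heatG_ge0|exact: heat_coef_le|exact: hC].
rewrite le_eqVlt; apply/orP; left; apply/eqP.
rewrite exprD; move: (br s z ^+ d) (exprn_gt0 d b0) => X X0.
by field; rewrite !gt_eqF.
Qed.

(** A displacement of at most half the parabolic size changes that size by a factor 2 at most, so
    increments can be bounded by [br] at the single point [z]. *)
Lemma br_shift z w (s : R) : 0 < s -> 4 * dotp w w <= dotp z z + s ->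
  br s z <= 2 * br s (z + w) /\ br s (z + w) <= 2 * br s z.
Proof.
move=> s0 hw.
have b0 := br_gt0 z s0; have b1 := br_gt0 (z + w) s0.
have h1 := dotpD_le z w.
have h2 := dotpD_le (z + w) (- w); rewrite addrK dotpN in h2.
have z0 := dotp_ge0 z; have p0 := dotp_ge0 (z + w).
have e1 := br_sqr z (ltW s0); have e2 := br_sqr (z + w) (ltW s0).
split; rewrite -(@ler_pXn2r _ 2)// ?nnegrE ?mulr_ge0 ?(ltW b0) ?(ltW b1)// exprMn e1 e2;
  lra.
Qed.

(** Convexity, as [1 + x <= expR x], bounds the increment by its length times the larger value; the
    sum of both values makes the bound symmetric. *)
Lemma expR_sub_le (a b : R) :
  `|expR (- a) - expR (- b)| <= `|a - b| * (expR (- a) + expR (- b)).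
Proof.
wlog ab : a b / a <= b => [h|].
  have [ab|ba] := leP a b; first exact: h.
  rewrite distrC (distrC a) [X in _ <= _ * X]addrC; apply: h; exact: ltW.
have h1 : expR (- b) <= expR (- a) by rewrite ler_expR lerN2.
have h2 : expR (- a) * (1 + (a - b)) <= expR (- b).
  have -> : expR (- b) = expR (- a) * expR (a - b) by rewrite -expRD; congr expR; ring.
  by apply: ler_wpM2l; [exact: expR_ge0|exact: expR_ge1Dx].
rewrite ger0_norm ?subr_ge0// ler0_norm ?subr_le0//.
have := expR_ge0 (- b); have := expR_ge0 (- a).
move: (expR (- a)) (expR (- b)) h1 h2 => x y; nra.
Qed.

Lemma dotpD_sub_le z w (s : R) : 0 < s -> 4 * dotp w w <= dotp z z + s ->
  `|dotp (z + w) (z + w) - dotp z z| <= 3 * d%:R * enorm w * br s z.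
Proof.
move=> s0 hw; have [_ h2] := br_shift s0 hw.
have -> : dotp (z + w) (z + w) - dotp z z =
    \sum_i w ord0 i * ((z + w) ord0 i + z ord0 i).
  by rewrite /dotp -sumrB; apply: eq_bigr => i _; rewrite !mxE; ring.
apply: le_trans (ler_norm_sum _ _ _) _.
apply: (@le_trans _ _ (\sum_(i < d) enorm w * (3 * br s z))).
  apply: ler_sum => i _; rewrite normrM; apply: ler_pM => //.
    exact: coord_le_enorm.
  apply: le_trans (ler_normD _ _) _.
  have := coord_le_br (z + w) i (ltW s0); have := coord_le_br z i (ltW s0); lra.
by rewrite sumr_const card_ord -mulr_natl; lra.
Qed.

Lemma heatG_lip (m : nat) : exists2 K : R, 0 < K & forall z w (s : R), 0 < s ->
  4 * dotp w w <= dotp z z + s ->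
  let g := br s z ^- d * (Num.sqrt s / br s z) ^+ m in
  [/\ heatG z s <= K * g, heatG (z + w) s <= K * g &
      `|heatG (z + w) s - heatG z s| <=
        d%:R * enorm w * br s z / Num.sqrt s ^+ 2 * (2 * (K * g))].
Proof.
have [C C0 hC] := heatG_le m.
(* The bound at [z + w] has [d + m] negative powers of [br s (z + w)]; by [br_shift] each costs a
   factor 2 when rewritten at [z]. *)
pose K := C * 2 ^+ (d + m).
have K0 : 0 < K by rewrite mulr_gt0// exprn_gt0.
exists K => // z w s s0 hw.
have [bb1 bb2] := br_shift s0 hw.
have b0 := br_gt0 z s0; have b1 := br_gt0 (z + w) s0.
have sg0 : 0 < Num.sqrt s by rewrite sqrtr_gt0.
set b := br s z in b0 bb1 bb2 *; set b' := br s (z + w) in b1 bb1 bb2 *.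
set sg := Num.sqrt s in sg0 *.
have sE : s = sg ^+ 2 by rewrite sqr_sqrtr// ltW.
move=> g.
have g0 : 0 < g by rewrite mulr_gt0 ?invr_gt0 ?exprn_gt0 ?divr_gt0.
have Gz : heatG z s <= K * g.
  apply: le_trans (hC z s s0) _; rewrite -/b -/sg -/g ler_pM2r// ler_peMr ?(ltW C0)//.
  by rewrite exprn_ege1// ler1n.
have Gp : heatG (z + w) s <= K * g.
  apply: le_trans (hC (z + w) s s0) _; rewrite -/b' -/sg /K -mulrA ler_pM2l//.
  have -> : b' ^- d * (sg / b') ^+ m = sg ^+ m / b' ^+ (d + m).
    rewrite exprD expr_div_n.
    move: (b' ^+ d) (exprn_gt0 d b1) (b' ^+ m) (exprn_gt0 m b1) => X X0 Y Y0.
    by field; rewrite !gt_eqF.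
  have -> : 2 ^+ (d + m) * g = sg ^+ m / (b / 2) ^+ (d + m).
    rewrite /g !expr_div_n [b ^+ (d + m)]exprD.
    move: (b ^+ d) (exprn_gt0 d b0) (b ^+ m) (exprn_gt0 m b0) (2 ^+ (d + m))
      (exprn_gt0 (d + m) (ltr0Sn R 1)) => X X0 Y Y0 Z Z0.
    by field; rewrite !gt_eqF.
  rewrite ler_pM2l ?exprn_gt0// lef_pV2 ?posrE ?exprn_gt0 ?divr_gt0//.
  apply: lerXn2r; rewrite ?nnegrE ?(ltW b1) ?divr_ge0 ?(ltW b0)//.
  by rewrite ler_pdivrMr// mulrC.
have w0 : 0 <= enorm w := enorm_ge0 w.
split => //.
apply: (@le_trans _ _ (d%:R * enorm w * b / sg ^+ 2 * (heatG (z + w) s + heatG z s))).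
  rewrite /heatG -mulrBr normrM ger0_norm; last by rewrite invr_ge0 exprn_ge0// sqrtr_ge0.
  rewrite -mulrDr [leRHS]mulrCA; apply: ler_wpM2l.
    by rewrite invr_ge0 exprn_ge0// sqrtr_ge0.
  apply: le_trans (expR_sub_le _ _) _; apply: ler_wpM2r.
    by rewrite addr_ge0 ?expR_ge0.
  rewrite -mulrBl normrM normfV (gtr0_norm (_ : 0 < 4 * s)) ?mulr_gt0//.
  rewrite ler_pdivrMr ?mulr_gt0//; apply: le_trans (dotpD_sub_le s0 hw) _.
  rewrite -/b [X in _ <= _ * (4 * X)]sE.
  have -> : d%:R * enorm w * b / sg ^+ 2 * (4 * sg ^+ 2) = 4 * d%:R * enorm w * b.
    by field; rewrite gt_eqF.
  by rewrite !ler_wpM2r ?(ltW b0)// ler_nat.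
apply: ler_wpM2l; last lra.
by apply: divr_ge0; [rewrite !mulr_ge0 ?(ltW b0)|rewrite exprn_ge0 ?(ltW sg0)].
Qed.

Lemma heatH_lip j k : exists2 C : R, 0 < C & forall z w (s : R), 0 < s ->
  4 * dotp w w <= dotp z z + s ->
  `|heatH j k (z + w) s - heatH j k z s| <= C * enorm w * br s z ^- (d + 3).
Proof.
(* The increment of [heatG] costs [Num.sqrt s ^- 2] on top of the [Num.sqrt s ^- 4] of the
   coefficient: hence the reserve 6. *)
have [K K0 hK] := heatG_lip 6.
exists ((2 * d%:R + 1) * K) => [|z w s s0 hw].
  by rewrite mulr_gt0// ltr_wpDl// mulr_ge0.
have [Gz Gp GD] := hK z w s s0 hw.
have [bb1 bb2] := br_shift s0 hw.
have b0 := br_gt0 z s0.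
have sg0 : 0 < Num.sqrt s by rewrite sqrtr_gt0.
set b := br s z in b0 bb1 bb2 Gz Gp GD *.
set sg := Num.sqrt s in sg0 Gz Gp GD *.
have sE : s = sg ^+ 2 by rewrite sqr_sqrtr// ltW.
set g := b ^- d * (sg / b) ^+ 6 in Gz Gp GD.
have w0 : 0 <= enorm w := enorm_ge0 w.
have hwj := coord_le_enorm w j.
have hpk := coord_le_br (z + w) k (ltW s0); have hzj := coord_le_br z j (ltW s0).
have sgb : sg <= b := sqrt_le_br s z.
have S4 : 0 < sg ^+ 4 by rewrite exprn_gt0.
have coefD : `|heat_coef j k (z + w) s - heat_coef j k z s| <= enorm w * b / sg ^+ 4.
  rewrite /heat_coef.
  have -> : (z + w) ord0 j * (z + w) ord0 k / (4 * s ^+ 2) - (j == k)%:R / (2 * s) -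
      (z ord0 j * z ord0 k / (4 * s ^+ 2) - (j == k)%:R / (2 * s)) =
      (w ord0 j * (z + w) ord0 k + z ord0 j * w ord0 k) / 4 / sg ^+ 4.
    by rewrite sE !mxE; field; rewrite gt_eqF.
  rewrite normrM normfV (gtr0_norm S4); apply: ler_wpM2r; first by rewrite invr_ge0 ltW.
  rewrite normrM normfV (@ger0_norm _ 4)// ler_pdivrMr//.
  apply: le_trans (ler_normD _ _) _; rewrite !normrM.
  have t1 : `|w ord0 j| * `|(z + w) ord0 k| <= enorm w * (2 * b).
    by apply: ler_pM => //; apply: le_trans hpk bb2.
  have t2 : `|z ord0 j| * `|w ord0 k| <= enorm w * b.
    by rewrite mulrC; apply: ler_pM => //; exact: coord_le_enorm.
  have := mulr_ge0 w0 (ltW b0); lra.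
have -> : heatH j k (z + w) s - heatH j k z s =
    (heat_coef j k (z + w) s - heat_coef j k z s) * heatG (z + w) s +
    heat_coef j k z s * (heatG (z + w) s - heatG z s).
  by rewrite /heatH /heat_coef; ring.
apply: le_trans (ler_normD _ _) _; rewrite (normrM _ (heatG (z + w) s))
  (normrM (heat_coef j k z s)) (ger0_norm (heatG_ge0 (z + w) s)).
have S6 : 0 < sg ^+ 6 by rewrite exprn_gt0.
have t1 : `|heat_coef j k (z + w) s - heat_coef j k z s| * heatG (z + w) s <=
    enorm w * b ^+ 3 / sg ^+ 6 * (K * g).
  apply: ler_pM => //; first exact: heatG_ge0.
  apply: le_trans coefD _.
  have -> : enorm w * b / sg ^+ 4 = enorm w * b * (sg ^+ 2) / sg ^+ 6.
    by field; rewrite gt_eqF.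
  rewrite ler_pM2r ?invr_gt0// -!mulrA ler_wpM2l// [b ^+ 3]exprS ler_pM2l//.
  by apply: lerXn2r => //; rewrite nnegrE ltW.
have t2 : `|heat_coef j k z s| * `|heatG (z + w) s - heatG z s| <=
    b ^+ 2 / sg ^+ 4 * (d%:R * enorm w * b / sg ^+ 2 * (2 * (K * g))).
  by apply: ler_pM => //; exact: heat_coef_le.
apply: le_trans (lerD t1 t2) _.
rewrite le_eqVlt; apply/orP; left; apply/eqP.
rewrite /g exprD; move: (b ^+ d) (exprn_gt0 d b0) => X X0.
by field; rewrite !gt_eqF.
Qed.

(** The square of [br s z] has derivative 1 in [s], so [- (2 / m) * br s z ^- m] is a primitive and
    a tail integral gains two powers. The case [tau = 0] with [z] nonzero is the one needed for
    [kernelE]. *)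
Lemma integral_br_tail_le (m : nat) z (tau : R) : (0 < m)%N ->
  0 < dotp z z + tau ->
  (\int[leb]_(s in `]tau, +oo[) (br s z ^- (m + 2))%:E <= (2 * br tau z ^- m)%:E)%E.
Proof.
case: m => // n _ tau0.
have pos s : tau < s -> 0 < dotp z z + s.
  by move=> ts; apply: lt_trans tau0 _; rewrite ltrD2l.
have dbr (s : R) : tau < s -> is_derive s 1 (fun s => br s z) ((2 * br s z)^-1).
  move=> ts; have := is_derive1_sqrt (pos _ ts) => h.
  have h2 : is_derive s 1 (fun s => dotp z z + s) 1.
    by apply: is_derive_eq; rewrite add0r mulr1.
  by have := is_derive1_comp h h2; rewrite mulr1.
have dbrX m (s : R) : tau < s -> is_derive s 1 (fun s => br s z ^+ m)
    ((m%:R * br s z ^+ m.-1) *: (2 * br s z)^-1).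
  by move=> ts; have := is_deriveX m (dbr _ ts); rewrite exprfctE.
have brp s : tau < s -> 0 < br s z by move=> ts; rewrite sqrtr_gt0 pos.
apply: (@exhaustion_ge0_le R _ _ _ (fun s => br s z ^- (n.+1 + 2))
  (fun s => - (2 / n.+1%:R) * br s z ^- n.+1) (exhaustion_oy tau)).
- move=> s /=; rewrite in_itv/= andbT => ts.
  have n0 : br s z ^+ (n.+1 + 2) != 0 by rewrite expf_neq0// gt_eqF// brp.
  exact: (is_derive_continuous (@is_deriveV _ (fun s => br s z ^+ (n.+1 + 2))
    s _ _ n0 (dbrX _ s ts))).
- move=> s /=; rewrite in_itv/= andbT => ts.
  have b0 := brp s ts.
  have n0 : br s z ^+ n.+1 != 0 by rewrite expf_neq0// gt_eqF.
  have dX : is_derive s 1 (fun s => br s z ^- n.+1)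
      (- (br s z ^+ n.+1) ^- 2 *: ((n.+1%:R * br s z ^+ n) *: (2 * br s z)^-1)).
    exact: (@is_deriveV _ (fun s => br s z ^+ n.+1) s _ _ n0 (dbrX _ s ts)).
  apply: is_derive_eq; rewrite /GRing.scale/= exprD [br s z ^+ n.+1]exprS.
  have N0 : 0 < n.+1%:R :> R by rewrite ltr0n.
  move: (br s z ^+ n) (exprn_gt0 n b0) (n.+1%:R : R) N0 => X X0 N N0.
  by field; rewrite !gt_eqF.
- move=> s /=; rewrite in_itv/= andbT => ts.
  by rewrite invr_ge0 exprn_ge0// ltW// brp.
- move=> N; set u := tau + N.+2%:R^-1; set v := tau + N.+1%:R.
  have tu : tau < u by rewrite ltrDl.
  have tv : tau < v by rewrite ltrDl.
  have h1 : 0 < br v z ^- n.+1 by rewrite invr_gt0 exprn_gt0// brp.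
  have h2 : br u z ^- n.+1 <= br tau z ^- n.+1.
    have bu := brp _ tu; have bt : 0 < br tau z by rewrite sqrtr_gt0.
    rewrite lef_pV2 ?posrE ?exprn_gt0//.
    apply: lerXn2r; [by rewrite nnegrE ltW|by rewrite nnegrE ltW// brp|].
    by rewrite /br ler_sqrt ?(ltW (pos _ tu))// lerD2l ltW.
  have h3 : 0 < br tau z ^- n.+1 by rewrite invr_gt0 exprn_gt0// sqrtr_gt0.
  have h4 : 0 < 2 / n.+1%:R :> R by rewrite divr_gt0.
  have h5 : 2 / n.+1%:R <= 2 :> R by rewrite ler_pdivrMr// ler_peMr// ler1n.
  move: (2 / n.+1%:R) h4 h5 => c h4 h5.
  have h6 := ler_wpM2l (ltW h4) h2; have h7 := mulr_gt0 h4 h1.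
  have h8 := ler_wpM2r (ltW h3) h5.
  rewrite !mulNr opprK; lra.
Qed.

Lemma measurable_heatH j k z : measurable_fun setT (heatH j k z).
Proof.
apply: measurable_funM.
  apply: measurable_funB; apply: measurable_funM => //; apply: measurable_funV.
    by apply: measurable_funM => //; exact: measurable_funX.
  exact: measurable_funM.
apply: measurable_funM.
  apply: measurable_funV; apply: measurable_funX; apply: measurable_fun_sqrt.
  exact: measurable_funM.
apply: measurable_fun_expR; apply: measurableT_comp => //; apply: measurable_funM => //.
by apply: measurable_funV; exact: measurable_funM.
Qed.

End heat_estimates.

(** * Change of variable [s |-> c / s] on the half-line *)

Section inversion.
Context {R : realType}.
Variable phi : R -> R.
Hypothesis cphi : continuous phi.
Hypothesis phi0 : forall r, 0 < r -> 0 <= phi r.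

Let P (r : R) : R := \int[leb]_(t in [set` `[0, r]]) phi t.

Let dP (r : R) : 0 < r -> is_derive r 1 P (phi r).
Proof.
move=> r0.
have r1 : r < r + 1 by rewrite ltrDl.
have fi : leb.-integrable `[0, r + 1] (EFin \o phi).
  apply: continuous_compact_integrable; first exact: segment_compact.
  by apply: continuous_subspaceT.
have [dd eq] := @continuous_FTC1_closed R phi 0 r (r + 1) r1 fi r0 (@cphi r).
by apply: DeriveDef => //; rewrite -derive1E.
Qed.

(* Both sides are limits of increments of the same primitive, along s |-> c/s. *)
Lemma integral_inversion (c : R) : 0 < c ->
  (\int[leb]_(s in `]0%R, +oo[) (phi (c / s) * (c / s ^+ 2))%:E =
   \int[leb]_(r in `]0%R, +oo[) (phi r)%:E)%E.
Proof.
move=> c0.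
pose psi s := phi (c / s) * (c / s ^+ 2).
have dV (s : R) : 0 < s -> is_derive s 1 (fun s => c / s) (c * - (s ^- 2)).
  move=> s0; have sn0 : s != 0 by rewrite gt_eqF.
  have hV : is_derive s 1 (fun s : R => s^-1) (- (s ^- 2)).
    by have := @is_deriveV _ id s _ _ sn0 (is_derive_id s 1); rewrite /GRing.scale/= mulr1.
  by apply: is_derive_eq; rewrite /GRing.scale/=; ring.
have dpsi (s : R) : 0 < s -> is_derive s 1 (fun s => - P (c / s)) (psi s).
  move=> s0; have cs0 : 0 < c / s by rewrite divr_gt0.
  apply: (is_derive_eq (is_deriveN (@is_derive1_comp R P (fun s => c / s) s _ _
    (dP cs0) (dV s s0)))).
  by rewrite /psi; ring.
have cpsi (s : R) : 0 < s -> {for s, continuous psi}.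
  move=> s0; have sn0 : s != 0 by rewrite gt_eqF.
  have c1 := continuous_comp (is_derive_continuous (dV s s0)) (@cphi (c / s)).
  have c2 : {for s, continuous (fun s : R => c / s ^+ 2)}.
    apply: is_derive_continuous.
    have sn2 : s ^+ 2 != 0 by rewrite expf_neq0.
    have h := @is_deriveX R R id 2 s 1 1 (is_derive_id s 1).
    exact: is_deriveM (is_derive_cst c s 1) (@is_deriveV _ (id ^+ 2) s _ _ sn2 h).
  exact: (@cvgM R R (nbhs s) _ _ _ _ _ c1 c2).
have mphi n : measurable_fun `[c / n.+1%:R, c * n.+2%:R] phi.
  by apply: measurable_funTS; exact: continuous_measurable_fun.
have psi0 s : 0 < s -> 0 <= psi s.
  move=> s0; rewrite mulr_ge0 ?phi0 ?divr_gt0//.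
  by rewrite divr_ge0 ?(ltW c0)// sqr_ge0.
have dom (s : R) : `]0, +oo[%classic s -> 0 < s by rewrite /= in_itv/= andbT.
have mpsi n : measurable_fun `[(0 + n.+2%:R^-1 : R), (0 + n.+1%:R : R)] psi.
  apply: subspace_continuous_measurable_fun => //.
  apply: continuous_in_subspaceT => s /set_mem /=; rewrite in_itv/= => /andP[h _].
  by apply: cpsi; apply: lt_le_trans h; rewrite add0r.
have l1 := exhaustion_cvg (exhaustion_scale c0) mphi (fun s hs => phi0 (dom _ hs)).
have l2 := exhaustion_cvg (exhaustion_oy 0) mpsi (fun s hs => psi0 _ (dom _ hs)).
rewrite -(cvg_lim (@ereal_hausdorff R) l2) -(cvg_lim (@ereal_hausdorff R) l1).
congr (lim (_ @ \oo)); apply/funext => n; apply/esym.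
rewrite (exhaustion_FTC (exhaustion_scale c0) (fun r _ => @cphi r)
  (fun r hr => dP (dom r hr))).
rewrite (exhaustion_FTC (exhaustion_oy 0) (fun s hs => cpsi s (dom s hs))
  (fun s hs => dpsi s (dom s hs))).
by rewrite !add0r invrK opprK addrC.
Qed.

End inversion.

(** * [kernelE] as a time integral of second derivatives of the heat kernel *)

Section kernelE.
Context {R : realType}.
Variable d : nat.
Hypothesis d2 : (2 <= d)%N.
Implicit Types (z : 'rV[R]_d) (j k : 'I_d).

Let dom (s : R) : `]0, +oo[%classic s -> 0 < s. Proof. by rewrite /= in_itv/= andbT. Qed.

Let mD : measurable (`]0, +oo[%classic : set (measurableTypeR R)).
Proof. exact: measurable_itv. Qed.

(** The integrand of [Gamma (d%:R / 2)] with its power written as an integer power of a square root: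
    since [d >= 2] it is continuous on the whole line, as [integral_inversion] requires. *)
Let phi (r : R) : R := Num.sqrt r ^+ (d - 2) * expR (- r).

Let cphi : continuous phi.
Proof.
move=> r; apply: (@cvgM R R (nbhs r) _ (fun r => Num.sqrt r ^+ (d - 2)) (fun r => expR (- r))).
  apply: (@continuous_comp _ _ _ Num.sqrt (fun x : R => x ^+ (d - 2))).
    exact: (@sqrt_continuous R r).
  exact: exprn_continuous.
apply: (@continuous_comp _ _ _ (fun r : R => - r) expR).
  exact: opp_continuous.
exact: continuous_expR.
Qed.

Lemma Gamma_sqrt : Gamma (d%:R / 2 : R) =
  \int[leb]_(r in `]0, +oo[) (Num.sqrt r ^+ (d - 2) * expR (- r)).
Proof.
apply: eq_Rintegral => r; rewrite inE => /dom r0; congr (_ * _).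
have -> : d%:R / 2 - 1 = 2^-1 * (d - 2)%:R :> R by rewrite natrB//; field.
by rewrite powRrM powR12_sqrt ?(ltW r0)// powR_mulrn// sqrtr_ge0.
Qed.

Lemma measurable_heatG z : measurable_fun setT (heatG z).
Proof.
apply: measurable_funM.
  apply: measurable_funV; apply: measurable_funX; apply: measurable_fun_sqrt.
  exact: measurable_funM.
apply: measurable_fun_expR; apply: measurableT_comp => //; apply: measurable_funM => //.
by apply: measurable_funV; exact: measurable_funM.
Qed.

(** A reserve of [2 * m] powers in [heatG_le] cancels [s ^+ m]. What is left is a power of [br s z]
    above 2, integrable up to [s = 0] because [z] is nonzero. *)
Lemma integrable_heatG_div (m : nat) z : 0 < dotp z z -> (0 < m)%N ->
  leb.-integrable `]0, +oo[ (EFin \o (fun s => heatG z s / s ^+ m)).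
Proof.
move=> z0 m0; have [C C0 hC] := @heatG_le R d (2 * m).
have q0 : 0 < dotp z z + 0 by rewrite addr0.
have d0 : (0 < d)%N by exact: leq_trans d2.
have hm : (0 < d + 2 * m - 2)%N by rewrite subn_gt0; lia.
apply: (@integrable_of_le _ (measurableTypeR R) R leb _ _
  (fun s => C * br s z ^- (d + 2 * m - 2 + 2)) (C * (2 * br 0 z ^- (d + 2 * m - 2)))) => //.
- apply: measurable_funTS; apply: measurable_funM; first exact: measurable_heatG.
  by apply: measurable_funV; exact: measurable_funX.
- move=> s /dom s0; rewrite normrM normfV !ger0_norm ?heatG_ge0 ?exprn_ge0 ?(ltW s0)//.
  rewrite ler_pdivrMr ?exprn_gt0//; apply: le_trans (hC _ _ s0) _.
  rewrite -mulrA ler_pM2l//.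
  have b0 := br_gt0 z s0.
  rewrite expr_div_n exprM sqr_sqrtr ?(ltW s0)// subnK; last by lia.
  rewrite mulrA mulrAC -invfM exprD//.
- under eq_integral do rewrite EFinM.
  rewrite ge0_integralZl_EFin ?(ltW C0)//; last 2 first.
  + by move=> s _; rewrite lee_fin invr_ge0 exprn_ge0// sqrtr_ge0.
  + apply/measurable_EFinP; apply: measurable_funTS; apply: measurable_funV.
    by apply: measurable_funX; apply: measurable_br.
  rewrite EFinM; apply: lee_wpmul2l; first by rewrite lee_fin ltW.
  exact: integral_br_tail_le.
Qed.

(** The substitution [r = dotp z z / (4 * s)] turns this into a Gamma integral: this is the origin
    of the constant in [kernelE]. *)
Lemma integral_heatG_div1 z : z != 0 ->
  \int[leb]_(s in `]0, +oo[) (heatG z s / s ^+ 1) =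
  Gamma (d%:R / 2) / (pi `^ (d%:R / 2) * enorm z ^+ d).
Proof.
move=> z0; have e0 := enorm_gt0 z0.
have q0 : 0 < dotp z z by rewrite -enorm_sqr exprn_gt0.
have c0 : 0 < dotp z z / 4 by rewrite divr_gt0.
have p0 : 0 < pi :> R := pi_gt0 R.
have pd : (pi : R) `^ (d%:R / 2) = Num.sqrt pi ^+ d.
  by rewrite mulrC powRrM powR12_sqrt ?(ltW p0)// powR_mulrn// sqrtr_ge0.
set c := dotp z z / 4 in c0.
have phi0 r : 0 < r -> 0 <= phi r.
  by move=> _; rewrite mulr_ge0 ?expR_ge0// exprn_ge0// sqrtr_ge0.
have -> : Gamma (d%:R / 2) = (Num.sqrt pi ^+ d * enorm z ^+ d) *
    \int[leb]_(s in `]0, +oo[) (heatG z s / s ^+ 1).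
  rewrite Gamma_sqrt -RintegralZl//; last exact: integrable_heatG_div.
  rewrite /Rintegral -(integral_inversion cphi phi0 c0); congr fine.
  apply: eq_integral => s; rewrite inE => /dom s0; congr EFin.
  have sg0 : 0 < Num.sqrt s by rewrite sqrtr_gt0.
  have sp0 : 0 < Num.sqrt pi :> R by rewrite sqrtr_gt0.
  rewrite /phi /heatG expr1.
  have -> : dotp z z / (4 * s) = c / s by rewrite /c; field; rewrite gt_eqF.
  have -> : Num.sqrt (4 * pi * s) = 2 * Num.sqrt pi * Num.sqrt s.
    rewrite sqrtrM ?mulr_ge0 ?(ltW p0)// sqrtrM//; congr (_ * _ * _).
    by rewrite (_ : 4 = 2 ^+ 2) ?sqrtr_sqr ?ger0_norm//; ring.
  have -> : Num.sqrt (c / s) = enorm z / (2 * Num.sqrt s).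
    have h : 0 <= enorm z / (2 * Num.sqrt s) by rewrite divr_ge0 ?mulr_ge0 ?ltW.
    rewrite -[RHS]ger0_norm// -sqrtr_sqr; congr Num.sqrt.
    rewrite expr_div_n exprMn (sqr_sqrtr (ltW s0)) enorm_sqr /c.
    by field; rewrite gt_eqF.
  have -> : c / s ^+ 2 = (enorm z / (2 * Num.sqrt s)) ^+ 2 / s.
    rewrite expr_div_n exprMn (sqr_sqrtr (ltW s0)) enorm_sqr /c.
    by field; rewrite gt_eqF.
  have AC (x y u w : R) : x * y * (u * w) = (x * u) * (y * w) by ring.
  rewrite AC -exprD subnK// !exprMn exprVn !exprMn.
  move: (enorm z ^+ d) (Num.sqrt pi ^+ d) (Num.sqrt s ^+ d) (2 ^+ d : R)
    (exprn_gt0 d e0) (exprn_gt0 d sp0) (exprn_gt0 d sg0) (exprn_gt0 d (ltr0Sn R 1))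
    => X Y Z W X0 Y0 Z0 W0.
  by field; rewrite !gt_eqF.
rewrite pd mulrC mulKf// gt_eqF// mulr_gt0// exprn_gt0// sqrtr_gt0//.
Qed.

Lemma is_derive_heatG z (s : R) : 0 < s ->
  is_derive s 1 (heatG z)
    (dotp z z / 4 * (heatG z s / s ^+ 2) - d%:R / 2 * (heatG z s / s ^+ 1)).
Proof.
move=> s0; have p0 : 0 < pi :> R := pi_gt0 R.
have ps : 0 < 4 * pi * s by rewrite !mulr_gt0.
have b0 : 0 < Num.sqrt (4 * pi * s) by rewrite sqrtr_gt0.
have h2 : is_derive s 1 (fun s => 4 * pi * s) (4 * pi).
  by apply: is_derive_eq; rewrite /GRing.scale/=; ring.
have dX := is_deriveX d (@is_derive1_comp R Num.sqrt (fun s => 4 * pi * s) s _ _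
  (is_derive1_sqrt ps) h2).
have n0 : Num.sqrt (4 * pi * s) ^+ d != 0 by rewrite expf_neq0// gt_eqF.
rewrite exprfctE in dX.
have dV := @is_deriveV _ (fun s => Num.sqrt (4 * pi * s) ^+ d) s _ _ n0 dX.
have sn0 : 4 * s != 0 by rewrite gt_eqF// mulr_gt0.
have hl : is_derive s 1 (fun s : R => 4 * s) 4.
  by apply: is_derive_eq; rewrite /GRing.scale/=; ring.
have hV := @is_deriveV _ (fun s => 4 * s) s _ _ sn0 hl.
have dE : is_derive s 1 (fun s => expR (- (dotp z z / (4 * s))))
   (expR (- (dotp z z / (4 * s))) * (dotp z z / (4 * s ^+ 2))).
  apply: is_derive_eq; rewrite /GRing.scale/=; field; rewrite gt_eqF//.
apply: (is_derive_eq (is_deriveM dV dE)).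
rewrite /heatG /GRing.scale/=.
have h4 : 4 * pi = Num.sqrt (4 * pi * s) ^+ 2 / s.
  by rewrite sqr_sqrtr ?(ltW ps)// mulfK// gt_eqF.
have Xd : Num.sqrt (4 * pi * s) ^+ d =
    Num.sqrt (4 * pi * s) ^+ d.-1 * Num.sqrt (4 * pi * s).
  by rewrite -exprSr prednK// (leq_trans _ d2).
rewrite Xd; move: h4; have Y0 := exprn_gt0 d.-1 b0.
move: (Num.sqrt (4 * pi * s) ^+ d.-1) Y0 => Y Y0.
move: (Num.sqrt (4 * pi * s)) b0 (expR _) => X X0 E ->.
by field; rewrite !gt_eqF.
Qed.

(** For [z] nonzero, [heatG z] tends to 0 at both ends of []0, +oo[], so its time derivative
    integrates to 0; the two terms of the derivative are thereby related. *)
Lemma Rintegral_heatG_derive z : z != 0 ->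
  dotp z z / 4 * \int[leb]_(s in `]0, +oo[) (heatG z s / s ^+ 2) =
  d%:R / 2 * \int[leb]_(s in `]0, +oo[) (heatG z s / s ^+ 1).
Proof.
move=> z0; have e0 := enorm_gt0 z0.
have q0 : 0 < dotp z z by rewrite -enorm_sqr exprn_gt0.
have i1 := integrable_heatG_div q0 (isT : (0 < 1)%N).
have i2 := integrable_heatG_div q0 (isT : (0 < 2)%N).
(* With reserve 0 the bound at time [n.+1] is of order [1 / n.+1], as [d >= 2]. Near time 0 the
   reserve 2 supplies the factor [s], and [br] is bounded below by the norm of [z]. *)
have [C0 C00 hC0] := @heatG_le R d 0.
have [C2 C20 hC2] := @heatG_le R d 2.
have cG (s : R) : 0 < s -> {for s, continuous (heatG z)}.
  by move=> s0; exact: is_derive_continuous (is_derive_heatG z s0).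
have cq (m : nat) (s : R) : 0 < s -> {for s, continuous (fun s => heatG z s / s ^+ m)}.
  move=> s0; have sn : s ^+ m != 0 by rewrite expf_neq0// gt_eqF.
  apply: (@cvgM R R (nbhs s) _ (heatG z) (fun s => (s ^+ m)^-1)); first exact: cG.
  by apply: cvgV => //; exact: exprn_continuous.
have h : \int[leb]_(s in `]0, +oo[) (dotp z z / 4 * (heatG z s / s ^+ 2) -
    d%:R / 2 * (heatG z s / s ^+ 1)) = 0.
  apply: (@exhaustion_integrable_cvg R _ _ _ _ (heatG z) (exhaustion_oy 0)).
  - move=> s /dom s0.
    apply: (@cvgB R R R (nbhs s) _ (fun s => dotp z z / 4 * (heatG z s / s ^+ 2))
      (fun s => d%:R / 2 * (heatG z s / s ^+ 1))).
      by apply: cvgM; [exact: cvg_cst|exact: (cq 2%N)].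
    by apply: cvgM; [exact: cvg_cst|exact: (cq 1%N)].
  - by move=> s /dom; exact: is_derive_heatG.
  - by apply: integrable_EFinB => //; exact: integrable_EFinZl.
  apply: (@cvg_harmonic_dist _ _ _ (C0 + C2 / enorm z ^+ (d + 2))) => n.
  rewrite subr0 !add0r; apply: le_trans (ler_normB _ _) _.
  rewrite !ger0_norm ?heatG_ge0// mulrDl; apply: lerD.
    have v0 : 0 < n.+1%:R :> R by rewrite ltr0n.
    apply: le_trans (hC0 _ _ v0) _; rewrite expr0 mulr1 ler_pM2l//.
    rewrite lef_pV2 ?posrE ?exprn_gt0 ?br_gt0//.
    have sv : 1 <= Num.sqrt n.+1%:R :> R by rewrite -[leLHS]sqrtr1 ler_sqrt ?ler1n.
    have sb := sqrt_le_br n.+1%:R z.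
    apply: (@le_trans _ _ (Num.sqrt n.+1%:R ^+ 2)); first by rewrite sqr_sqrtr.
    apply: (@le_trans _ _ (Num.sqrt n.+1%:R ^+ d)).
      by rewrite ler_weXn2l.
    by apply: lerXn2r; rewrite ?nnegrE ?sqrtr_ge0.
  have u0 : 0 < n.+2%:R^-1 :> R by rewrite invr_gt0 ltr0n.
  apply: le_trans (hC2 _ _ u0) _; rewrite -mulrA ler_pM2l//.
  have b0 := br_gt0 z u0.
  rewrite expr_div_n sqr_sqrtr ?(ltW u0)// mulrA mulrAC -invfM -exprD.
  apply: ler_pM; rewrite ?invr_ge0 ?exprn_ge0 ?(ltW b0)//.
    rewrite lef_pV2 ?posrE ?exprn_gt0//.
    apply: lerXn2r; rewrite ?nnegrE ?(ltW b0) ?(ltW e0)//.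
    exact: enorm_le_br (ltW u0).
  by rewrite lef_pV2 ?posrE ?ltr0n// ler_nat.
move: h; rewrite RintegralB//; try exact: integrable_EFinZl.
by rewrite !RintegralZl// => /eqP; rewrite subr_eq0 => /eqP.
Qed.

(** Both terms of [heatH] reduce to the integral of [heatG z s / s], the first with the additional
    factor [2 * d%:R / dotp z z], which yields the numerator of [kernelE]. *)
Lemma kernelE_heatH j k z : z != 0 ->
  kernelE z j k = \int[leb]_(s in `]0, +oo[) heatH j k z s.
Proof.
move=> z0; have e0 := enorm_gt0 z0.
have q0 : 0 < dotp z z by rewrite -enorm_sqr exprn_gt0.
have i1 := integrable_heatG_div q0 (isT : (0 < 1)%N).
have i2 := integrable_heatG_div q0 (isT : (0 < 2)%N).
transitivity (\int[leb]_(s in `]0, +oo[)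
   (z ord0 j * z ord0 k / 4 * (heatG z s / s ^+ 2) -
    (j == k)%:R / 2 * (heatG z s / s ^+ 1))); last first.
  apply: eq_Rintegral => s; rewrite inE => /dom s0.
  by rewrite /heatH; field; rewrite gt_eqF.
rewrite RintegralB//; try exact: integrable_EFinZl.
rewrite !RintegralZl//.
have -> : \int[leb]_(s in `]0, +oo[) (heatG z s / s ^+ 2) =
    2 * d%:R / dotp z z * \int[leb]_(s in `]0, +oo[) (heatG z s / s ^+ 1).
  apply: (@mulfI _ (dotp z z / 4)); first by rewrite gt_eqF// divr_gt0.
  by rewrite Rintegral_heatG_derive//; field; rewrite gt_eqF.
rewrite integral_heatG_div1// mxE -enorm_sqr exprD.
have P0 : 0 < (pi : R) `^ (d%:R / 2) by rewrite powR_gt0// pi_gt0.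
move: (_ `^ _) P0 (Gamma _) (enorm z ^+ d) (exprn_gt0 d e0) => X X0 Y W W0.
by field; rewrite !gt_eqF.
Qed.

End kernelE.

(** * Size, increments and large-distance limit of the Leray kernel *)

Section kernel_bounds.
Context {R : realType}.
Variable d : nat.
Implicit Types (z w : 'rV[R]_d) (j k : 'I_d).

Let dom (tau s : R) : `]tau, +oo[%classic s -> tau < s.
Proof. by rewrite /= in_itv/= andbT. Qed.

Let mD (tau : R) : measurable (`]tau, +oo[%classic : set (measurableTypeR R)).
Proof. exact: measurable_itv. Qed.

Lemma integral_brZ_tail_le (m : nat) z (tau C : R) : (0 < m)%N -> 0 <= C ->
  0 < dotp z z + tau ->
  (\int[leb]_(s in `]tau, +oo[) (C * br s z ^- (m + 2))%:E
    <= (C * (2 * br tau z ^- m))%:E)%E.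
Proof.
move=> m0 C0 zt; under eq_integral do rewrite EFinM.
rewrite ge0_integralZl_EFin//; last 2 first.
- by move=> s _; rewrite lee_fin invr_ge0 exprn_ge0// sqrtr_ge0.
- apply/measurable_EFinP; apply: measurable_funTS; apply: measurable_funV.
  by apply: measurable_funX; apply: (@measurable_br _ _ (measurableTypeR R) d (fun=> z) id).
rewrite EFinM; apply: lee_wpmul2l; first by rewrite lee_fin.
exact: integral_br_tail_le.
Qed.

Hypothesis d0 : (0 < d)%N.

Lemma integrable_heatH j k z (tau : R) : 0 <= tau -> 0 < dotp z z + tau ->
  leb.-integrable `]tau, +oo[ (EFin \o heatH j k z).
Proof.
move=> tau0 zt; have [C C0 hC] := @heatH_le R d j k.
apply: (@integrable_of_le _ (measurableTypeR R) R leb _ _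
  (fun s => C * br s z ^- (d + 2)) _ _ _ _ (integral_brZ_tail_le d0 (ltW C0) zt)) => //.
- by apply: measurable_funTS; exact: measurable_heatH.
- by move=> s /dom ts; apply: hC; exact: le_lt_trans ts.
Qed.

Lemma leray_kernelE j k z (tau : R) : 0 < tau ->
  leray_kernel z tau j k =
  (j == k)%:R * heatG z tau + \int[leb]_(s in `]tau, +oo[) heatH j k z s.
Proof.
move=> tau0; rewrite leray_kernel_tail// RintegralZl//; last first.
  by apply: integrable_heatH; rewrite ?(ltW tau0)// ltr_wpDl// dotp_ge0.
have p0 : (2 * pi : R) ^+ d != 0 by rewrite gt_eqF// exprn_gt0// mulr_gt0 ?pi_gt0.
by rewrite mulNr mulrN opprK mulKf.
Qed.

Let norm_delta_le j k : `|((j == k)%:R : R)| <= 1.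
Proof. by case: (j == k); rewrite ?normr1 ?normr0. Qed.

Lemma leray_kernel_le j k : exists2 C : R, 0 < C & forall z (tau : R), 0 < tau ->
  `|leray_kernel z tau j k| <= C * br tau z ^- d.
Proof.
have [C C0 hC] := @heatH_le R d j k; have [C1 C10 hC1] := @heatG_le R d 0.
exists (C1 + 2 * C) => [|z tau tau0]; first by rewrite addr_gt0 ?mulr_gt0.
have zt : 0 < dotp z z + tau by rewrite ltr_wpDl// dotp_ge0.
rewrite leray_kernelE// mulrDl; apply: le_trans (ler_normD _ _) _; apply: lerD.
  have := hC1 z tau tau0; rewrite expr0 mulr1; apply: le_trans.
  by rewrite normrM (ger0_norm (heatG_ge0 _ _)) ler_piMl// heatG_ge0.
rewrite (mulrC 2) -mulrA; apply: normr_Rintegral_le (integral_brZ_tail_le d0 (ltW C0) zt).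
by move=> s /dom ts; apply: hC; exact: lt_trans ts.
Qed.

Lemma leray_kernel_lip j k : exists2 C : R, 0 < C & forall z w (tau : R), 0 < tau ->
  4 * dotp w w <= dotp z z + tau ->
  `|leray_kernel (z + w) tau j k - leray_kernel z tau j k| <=
    C * enorm w * br tau z ^- (d + 1).
Proof.
have [C C0 hC] := @heatH_lip R d j k; have [K K0 hK] := @heatG_lip R d 2.
exists (2 * d%:R * K + 2 * C) => [|z w tau tau0 hw].
  by rewrite ltr_wpDl ?mulr_gt0// !mulr_ge0// ltW.
have zt : 0 < dotp z z + tau by rewrite ltr_wpDl// dotp_ge0.
have zwt : 0 < dotp (z + w) (z + w) + tau by rewrite ltr_wpDl// dotp_ge0.
have w0 := enorm_ge0 w.
have b0 := br_gt0 z tau0.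
have sg0 : 0 < Num.sqrt tau by rewrite sqrtr_gt0.
rewrite !leray_kernelE//.
set I1 := Rintegral _ _ _; set I2 := Rintegral _ _ _.
have -> : (j == k)%:R * heatG (z + w) tau + I1 - ((j == k)%:R * heatG z tau + I2) =
  (j == k)%:R * (heatG (z + w) tau - heatG z tau) + (I1 - I2) by ring.
apply: le_trans (ler_normD _ _) _.
rewrite (mulrDl _ _ (enorm w)) (mulrDl _ _ (br tau z ^- (d + 1))); apply: lerD.
  have [_ _ hG] := hK z w tau tau0 hw.
  apply: (@le_trans _ _ `|heatG (z + w) tau - heatG z tau|).
    by rewrite normrM ler_piMl.
  apply: le_trans hG _; rewrite le_eqVlt; apply/orP; left; apply/eqP.
  rewrite exprD; move: (br tau z ^+ d) (exprn_gt0 d b0) => X X0.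
  by field; rewrite !gt_eqF.
rewrite /I1 /I2 -RintegralB//; last 2 first.
- by apply: integrable_heatH; rewrite ?(ltW tau0).
- by apply: integrable_heatH; rewrite ?(ltW tau0).
have C'0 : 0 <= C * enorm w by rewrite mulr_ge0// ltW.
have d1 : (0 < d + 1)%N by rewrite addn1.
have -> : 2 * C * enorm w / br tau z ^+ (d + 1) =
  C * enorm w * (2 * br tau z ^- (d + 1)) by ring.
apply: normr_Rintegral_le (integral_brZ_tail_le d1 C'0 zt).
(* The parabolic size grows with time, so the smallness of [w] at time [tau] persists for all
   [s > tau]. *)
move=> s /dom ts; rewrite -addnA; apply: hC; first exact: lt_trans ts.
by apply: le_trans hw _; rewrite lerD2l ltW.
Qed.

(* When the directional derivative does not exist, it is the junk limit 0, so
   the Lipschitz bound on increments is all that is needed. *)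
Lemma norm_partial_leray_le (h : 'I_d) j k : exists2 C : R, 0 < C &
  forall z (tau : R), 0 < tau ->
  `|partial h (fun z => leray_kernel z tau j k) z| <= C * br tau z ^- (d + 1).
Proof.
have [C C0 hC] := @leray_kernel_lip j k; exists C => // z tau tau0.
set M := C * _; have M0 : 0 <= M by rewrite mulr_ge0 ?(ltW C0)// invr_ge0 exprn_ge0// sqrtr_ge0.
rewrite /partial /derive.
set F := (X in lim (X @ _)).
have FM : \forall r \near 0^', `|F r| <= M.
  near=> r.
  have r0 : r != 0 by near: r; exact: nbhs_dnbhs_neq.
  have rt : `|r| < Num.sqrt tau / 2.
    by near: r; apply: dnbhs0_lt; rewrite divr_gt0// sqrtr_gt0.
  have dE : dotp (r *: delta_mx ord0 h : 'rV[R]_d) (r *: delta_mx ord0 h) = r ^+ 2.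
    rewrite /dotp (bigD1 h)//= big1 => [|i ih].
      by rewrite !mxE !eqxx/= mulr1 addr0.
    by rewrite !mxE eqxx (negbTE ih)/= !mulr0.
  have hw : 4 * dotp (r *: delta_mx ord0 h : 'rV[R]_d) (r *: delta_mx ord0 h)
      <= dotp z z + tau.
    rewrite dE -[r ^+ 2]real_normK ?num_real//.
    have : `|r| ^+ 2 <= (Num.sqrt tau / 2) ^+ 2.
      by apply: lerXn2r; rewrite ?nnegrE ?divr_ge0 ?sqrtr_ge0 ?(ltW rt).
    rewrite expr_div_n sqr_sqrtr ?(ltW tau0)//; have := dotp_ge0 z; lra.
  have := hC z _ tau tau0 hw.
  rewrite /enorm dE sqrtr_sqr => {}hC'.
  rewrite /F /= /GRing.scale/= normrM normfV ler_pdivrMl ?normr_gt0//.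
  by rewrite (addrC _ z) /M mulrCA mulrA.
have [cF|dF] := pselect (cvg (F x @[x --> 0^'])); last by rewrite (dvgP dF) normr0.
rewrite ler_norml; apply/andP; split.
  apply: limr_ge => //; near=> r.
  suff : `|F r| <= M by rewrite ler_norml => /andP[].
  by near: r.
apply: limr_le => //; near=> r.
suff : `|F r| <= M by rewrite ler_norml => /andP[].
by near: r.
Unshelve. all: by end_near. Qed.

Hypothesis d2 : (2 <= d)%N.

(** The tails over [s > tau] cancel. There remain [heatG z tau], bounded with reserve 1, and an
    integral over []0, tau]] of size [tau * enorm z ^- (d + 2)], in which [tau <= enorm z ^+ 2]
    trades a factor [Num.sqrt tau] for [enorm z]. *)
Lemma leray_kernel_kernelE j k : exists2 C : R, 0 < C & forall z (tau : R),
  0 < tau -> tau <= enorm z ^+ 2 ->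
  `|leray_kernel z tau j k - kernelE z j k| <=
    C * Num.sqrt tau * enorm z ^- (d + 1).
Proof.
have [C C0 hC] := @heatH_le R d j k; have [C1 C10 hC1] := @heatG_le R d 1.
exists (C1 + C) => [|z tau tau0 tz]; first by rewrite addr_gt0.
have sg0 : 0 < Num.sqrt tau by rewrite sqrtr_gt0.
have e2 : 0 < enorm z ^+ 2 by exact: lt_le_trans tz.
have e0 : 0 < enorm z.
  rewrite lt_def enorm_ge0 andbT; apply/eqP => h; move: e2.
  by rewrite h expr0n/= ltxx.
have z0 : z != 0.
  apply/eqP => h; move: e0; rewrite h /enorm /dotp big1 ?sqrtr0 ?ltxx// => i _.
  by rewrite mxE mul0r.
have q0 : 0 < dotp z z + 0 by rewrite addr0 -enorm_sqr.
have b0 := br_gt0 z tau0.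
have eb := enorm_le_br z (ltW tau0).
rewrite leray_kernelE// kernelE_heatH//.
rewrite (_ : `]0, +oo[%classic = `]0, tau] `|` `]tau, +oo[)%classic; last first.
  by rewrite -itv_bndbnd_setU// bnd_simp ltW.
rewrite Rintegral_setU//=; last 2 first.
- rewrite -itv_bndbnd_setU//; last by rewrite bnd_simp ltW.
  exact: integrable_heatH.
- apply/disj_setPS => s [/=]; rewrite !in_itv/= andbT => /andP[_ h1] h2.
  by have := lt_le_trans h2 h1; rewrite ltxx.
set I1 := Rintegral _ _ _; set I2 := Rintegral _ _ _.
have -> : (j == k)%:R * heatG z tau + I1 - (I2 + I1) = (j == k)%:R * heatG z tau - I2 by ring.
apply: le_trans (ler_normB _ _) _; rewrite !mulrDl; apply: lerD.
  rewrite normrM (ger0_norm (heatG_ge0 _ _)).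
  apply: (@le_trans _ _ (heatG z tau)); first by rewrite ler_piMl// heatG_ge0.
  apply: le_trans (hC1 z tau tau0) _; rewrite -mulrA ler_pM2l//.
  rewrite expr1 mulrCA ler_pM2l// -invfM -exprSr addn1.
  rewrite lef_pV2 ?posrE ?exprn_gt0//.
  by apply: lerXn2r; rewrite ?nnegrE ?(ltW e0) ?(ltW b0).
have st : Num.sqrt tau <= enorm z.
  by rewrite -[leRHS]ger0_norm ?enorm_ge0// -sqrtr_sqr ler_sqrt// ltW.
apply: (@le_trans _ _ (C * enorm z ^- (d + 2) * tau)).
  apply: (@normr_Rintegral_le _ (measurableTypeR R) R leb _ _ (fun=> C * enorm z ^- (d + 2))).
    move=> s /=; rewrite in_itv/= => /andP[s0 _].
    apply: le_trans (hC z s s0) _; rewrite ler_pM2l//.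
    have bs := br_gt0 z s0.
    rewrite lef_pV2 ?posrE ?exprn_gt0//.
    by apply: lerXn2r; rewrite ?nnegrE ?(ltW e0) ?(ltW bs)// enorm_le_br// ltW.
  rewrite integral_cst//= lebesgue_measure_itv/= lte_fin tau0 oppr0 adde0 -EFinM//.
rewrite -!mulrA ler_pM2l//.
have -> : enorm z ^- (d + 2) * tau =
    Num.sqrt tau * enorm z ^- (d + 1) * (Num.sqrt tau / enorm z).
  rewrite -[X in _ * X = _](sqr_sqrtr (ltW tau0)) !exprD.
  move: (enorm z ^+ d) (exprn_gt0 d e0) => X X0.
  by field; rewrite !gt_eqF.
rewrite ler_piMr ?mulr_ge0 ?invr_ge0 ?exprn_ge0 ?(ltW e0) ?(ltW sg0)//.
by rewrite ler_pdivrMr// mul1r.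
Qed.

End kernel_bounds.

(** * The Duhamel terms *)

Section pointwise_bounds.
Context {R : realType}.

(** The kernel bounds carry one constant per matrix entry; being monotone in it, they all hold with
    1 plus the sum, which is positive even for an empty family. *)
Lemma uniform_const (I : finType) (P : I -> R -> Prop) :
  (forall i C C', P i C -> C <= C' -> P i C') ->
  (forall i, exists2 C, 0 < C & P i C) -> exists2 C, 0 < C & forall i, P i C.
Proof.
move=> mono h.
have /choice[c hc] : forall i, exists C, 0 < C /\ P i C.
  by move=> i; have [C C0 PC] := h i; exists C.
exists (1 + \sum_i c i) => [|i].
  by rewrite ltr_pwDl// sumr_ge0// => i _; have [/ltW] := hc i.
have [_ /mono] := hc i; apply.
rewrite (bigD1 i)//= addrCA lerDl addr_ge0// sumr_ge0// => k _.
by have [/ltW] := hc k.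
Qed.

Variable d : nat.
Implicit Types (x y : 'rV[R]_d) (j k h : 'I_d).

Lemma enorm_half x y : 4 * dotp (x - y) (x - y) < dotp x x ->
  dotp x x <= 4 * dotp y y.
Proof.
move=> hxy; have := dotpD_le (x - y) y; rewrite subrK; lra.
Qed.

Lemma enorm_le2 x y : dotp x x <= 4 * dotp y y -> enorm x <= 2 * enorm y.
Proof.
move=> h; have y0 := enorm_ge0 y.
rewrite -(@ler_pXn2r _ 2)// ?nnegrE ?mulr_ge0 ?enorm_ge0// exprMn !enorm_sqr; lra.
Qed.

Lemma br_ge_half x y (tau : R) : 0 <= tau -> dotp x x <= 4 * dotp (x - y) (x - y) ->
  enorm x <= 2 * br tau (x - y).
Proof.
move=> tau0 /enorm_le2 h; apply: le_trans h _; rewrite ler_pM2l//.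
exact: enorm_le_br.
Qed.

Hypothesis d2 : (2 <= d)%N.

Let d0 : (0 < d)%N. Proof. exact: leq_trans d2. Qed.

Lemma invX_le (a b : R) n : 0 < a -> a <= 2 * b -> b ^- n <= 2 ^+ n * a ^- n.
Proof.
move=> a0 ab; have b0 : 0 < b by move: (lt_le_trans a0 ab); rewrite pmulr_rgt0.
rewrite -ler_pdivrMl ?exprn_gt0// -invfM -exprMn lef_pV2 ?posrE ?exprn_gt0 ?mulr_gt0//.
by apply: lerXn2r; rewrite ?nnegrE ?(ltW a0) ?mulr_ge0 ?(ltW b0).
Qed.

(** If [x - y] is large, the kernel yields the power of [enorm x] and the decay of [v] is left for
    the space integral, with its factor in [s] for the time integral. Otherwise [v] yields that
    power, its factor in [s] is bounded by 1, and the kernel is left to integrate. The form [0 - y]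
    matches [integral_br_le] centred at 0. *)
Lemma drift_pointwise j h k : exists2 C : R, 0 < C & forall x y (t s B v : R),
  0 < s < t -> 0 < enorm x -> 0 <= B ->
  `|v| <= B * ((1 + enorm y)^-1 ^+ d.+1 * (Num.sqrt (1 + s))^-1) ->
  `|partial h (fun z => leray_kernel z (t - s) j k) (x - y) * v| <=
  C * B * enorm x ^- (d + 1) *
    ((Num.sqrt (1 + s))^-1 * br 1 (0 - y) ^- (d + 1) + br (t - s) (x - y) ^- (d + 1)).
Proof.
have [C C0 hC] := @norm_partial_leray_le R d d0 h j k.
exists (C * 2 ^+ (d + 1)) => [|x y t s B v /andP[s0 st] x0 B0 hv].
  by rewrite mulr_gt0// exprn_gt0.
have tau0 : 0 < t - s by rewrite subr_gt0.
have hK := hC (x - y) _ tau0.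
have y0 := enorm_ge0 y.
have a0 : 0 < 1 + enorm y by rewrite ltr_pwDl.
have b1 : 1 <= Num.sqrt (1 + s).
  by rewrite -[leLHS]sqrtr1 ler_sqrt ?lerDl ?addr_ge0 ?(ltW s0).
have b0 : 0 < Num.sqrt (1 + s) := lt_le_trans ltr01 b1.
have be1 : (Num.sqrt (1 + s))^-1 <= 1 by rewrite invf_le1.
have be0 : 0 < (Num.sqrt (1 + s))^-1 by rewrite invr_gt0.
set beta := (Num.sqrt (1 + s))^-1 in hv be0 be1 *.
set al := (1 + enorm y)^-1 in hv.
have al0 : 0 < al by rewrite invr_gt0.
have br0 := br_gt0 (x - y) tau0.
set b := br (t - s) (x - y) in hK br0 *.
have X0 : 0 < enorm x ^- (d + 1) by rewrite invr_gt0 exprn_gt0.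
have bX0 : 0 < b ^- (d + 1) by rewrite invr_gt0 exprn_gt0.
have w0 : 0 < br 1 (0 - y) ^- (d + 1) by rewrite invr_gt0 exprn_gt0// br_gt0.
have p0 : 0 < 2 ^+ (d + 1) :> R by rewrite exprn_gt0.
rewrite normrM; apply: le_trans (ler_pM (normr_ge0 _) (normr_ge0 _) hK hv) _.
rewrite -[d.+1]addn1.
have hal : al ^+ (d + 1) <= br 1 (0 - y) ^- (d + 1).
  rewrite /al exprVn lef_pV2 ?posrE ?exprn_gt0 ?br_gt0//.
  apply: lerXn2r; rewrite ?nnegrE ?(ltW a0) ?(ltW (br_gt0 _ ltr01))//.
  rewrite -(@ler_pXn2r _ 2)// ?nnegrE ?(ltW a0) ?(ltW (br_gt0 _ ltr01))//.
  rewrite br_sqr// sub0r dotpN -enorm_sqr; lra.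
have [hxy|hxy] := leP (dotp x x) (4 * dotp (x - y) (x - y)).
  have hb : b ^- (d + 1) <= 2 ^+ (d + 1) * enorm x ^- (d + 1).
    by apply: invX_le => //; apply: br_ge_half => //; exact: ltW.
  apply: (@le_trans _ _ (C * (2 ^+ (d + 1) * enorm x ^- (d + 1)) *
      (B * (br 1 (0 - y) ^- (d + 1) * beta)))).
    apply: ler_pM.
    - by rewrite mulr_ge0 ?(ltW C0) ?(ltW bX0).
    - by rewrite !mulr_ge0 ?(ltW be0)// exprn_ge0// ltW.
    - by rewrite ler_pM2l.
    - by apply: ler_wpM2l => //; apply: ler_wpM2r => //; exact: ltW.
  rewrite (_ : C * _ * _ = C * 2 ^+ (d + 1) * B / enorm x ^+ (d + 1) *
    (beta / br 1 (0 - y) ^+ (d + 1))); last by ring.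
  apply: ler_wpM2l; last by rewrite lerDl ltW.
  by rewrite !mulr_ge0 ?(ltW C0) ?(ltW p0) ?(ltW X0).
have hal2 : al ^+ (d + 1) <= 2 ^+ (d + 1) * enorm x ^- (d + 1).
  rewrite /al exprVn; apply: invX_le => //.
  have := enorm_le2 (enorm_half hxy); lra.
apply: (@le_trans _ _ (C * b ^- (d + 1) * (B * (2 ^+ (d + 1) * enorm x ^- (d + 1) * 1)))).
  apply: ler_wpM2l; first by rewrite mulr_ge0 ?(ltW C0) ?(ltW bX0).
  apply: ler_wpM2l => //; apply: ler_pM => //; last exact: ltW.
  by rewrite exprn_ge0// ltW.
rewrite (_ : C * _ * _ = C * 2 ^+ (d + 1) * B / enorm x ^+ (d + 1) * b ^- (d + 1));
  last by ring.
apply: ler_wpM2l; last by rewrite lerDr mulr_ge0 ?(ltW be0) ?(ltW w0).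
by rewrite !mulr_ge0 ?(ltW C0) ?(ltW p0) ?(ltW X0).
Qed.

(** The three terms have separate origins: [enorm y * v] from moving the kernel from [x - y] to [x],
    the power of [br] from points [y] close to [x], and [Num.sqrt t * v] from replacing the kernel
    at [x] by [kernelE x]. *)
Lemma force_pointwise j k : exists2 C : R, 0 < C & forall x y (t s eps v : R),
  0 < s < t -> 0 < enorm x -> t <= enorm x ^+ 2 ->
  0 <= v <= eps * (1 + enorm y)^-1 ^+ (d + 2) ->
  `|leray_kernel (x - y) (t - s) j k - kernelE x j k| * v <=
  C * enorm x ^- (d + 1) *
    (enorm y * v + eps * br (t - s) (x - y) ^- (d + 1) + Num.sqrt t * v).
Proof.
have [C1 C10 hC1] := @leray_kernel_le R d d0 j k.
have [C2 C20 hC2] := @leray_kernel_lip R d d0 j k.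
have [C3 C30 hC3] := @leray_kernel_kernelE R d d0 d2 j k.
pose p : R := 2 ^+ (d + 1); have p0 : 0 < p by rewrite exprn_gt0.
pose K := C2 + 2 * C1 + 4 * p * C1 + C3.
have K0 : 0 < K by rewrite /K; have := mulr_gt0 p0 C10; lra.
exists K => // x y t s eps v /andP[s0 st] x0 tx /andP[v0 hv].
have tau0 : 0 < t - s by rewrite subr_gt0.
have tau_le : t - s <= t by lra.
set X := enorm x in x0 tx *; set tau := t - s in tau0 tau_le *.
have y0 := enorm_ge0 y.
have b0 := br_gt0 (x - y) tau0.
have xb : X <= br tau x := enorm_le_br x (ltW tau0).
set b := br tau (x - y) in b0 *.
have XX0 : 0 < X ^- (d + 1) by rewrite invr_gt0 exprn_gt0.
have bX0 : 0 < b ^- (d + 1) by rewrite invr_gt0 exprn_gt0.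
have a0 : 0 < (1 + enorm y)^-1 ^+ (d + 2) by rewrite exprn_gt0// invr_gt0 ltr_pwDl.
have eps0 : 0 <= eps by rewrite -(pmulr_lge0 _ a0); exact: le_trans hv.
have T3 : `|leray_kernel x tau j k - kernelE x j k| * v <= C3 * X ^- (d + 1) * (Num.sqrt t * v).
  rewrite mulrA; apply: ler_wpM2r => //.
  apply: le_trans (hC3 x tau tau0 (le_trans tau_le tx)) _.
  rewrite -/X mulrAC; apply: ler_wpM2l; first by rewrite mulr_ge0 ?(ltW C30) ?(ltW XX0).
  by rewrite ler_sqrt// ltW// (lt_trans s0).
have XE : X ^- d = X * X ^- (d + 1).
  by rewrite addn1 exprS invfM mulrA mulfV ?mul1r// gt_eqF.
have T12 : `|leray_kernel (x - y) tau j k - leray_kernel x tau j k| * v <=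
    (C2 + 2 * C1 + 4 * p * C1) * X ^- (d + 1) * (enorm y * v + eps * b ^- (d + 1)).
  have e1 : 0 <= eps * b ^- (d + 1) by rewrite mulr_ge0// ltW.
  have e2 : 0 <= enorm y * v by rewrite mulr_ge0.
  have [hxy|hxy] := leP (4 * dotp y y) (dotp x x + tau).
    apply: (@le_trans _ _ (C2 * X ^- (d + 1) * (enorm y * v))); last first.
      apply: ler_pM => //; first by rewrite mulr_ge0 ?(ltW C20) ?(ltW XX0).
      - apply: ler_wpM2r; first exact: ltW.
        by have := mulr_gt0 p0 C10; lra.
      - by rewrite lerDl.
    rewrite mulrA; apply: ler_wpM2r => //.
    have := hC2 x (- y) tau tau0; rewrite dotpN enormN => /(_ hxy) h.
    apply: le_trans h _; rewrite mulrAC; apply: ler_wpM2r => //.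
    apply: ler_wpM2l; first exact: ltW.
    rewrite lef_pV2 ?posrE ?exprn_gt0 ?(lt_le_trans x0 xb)//.
    by apply: lerXn2r; rewrite ?nnegrE ?(ltW x0) ?(le_trans (ltW x0) xb).
  have hy : X <= 2 * enorm y.
    by apply: enorm_le2; apply: ltW; apply: le_lt_trans hxy; rewrite lerDl ltW.
  have t1 : `|leray_kernel x tau j k| * v <= 2 * C1 * X ^- (d + 1) * (enorm y * v).
    rewrite mulrA; apply: ler_wpM2r => //.
    apply: le_trans (hC1 x tau tau0) _.
    apply: (@le_trans _ _ (C1 * X ^- d)).
      apply: ler_wpM2l; first exact: ltW.
      rewrite lef_pV2 ?posrE ?exprn_gt0 ?(lt_le_trans x0 xb)//.
      by apply: lerXn2r; rewrite ?nnegrE ?(ltW x0) ?(le_trans (ltW x0) xb).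
    rewrite XE (_ : _ * _ * enorm y = C1 * ((2 * enorm y) * X ^- (d + 1))); last by ring.
    by apply: ler_wpM2l; [exact: ltW|apply: ler_wpM2r => //; exact: ltW].
  have t2 : `|leray_kernel (x - y) tau j k| * v <=
      4 * p * C1 * X ^- (d + 1) * (enorm y * v + eps * b ^- (d + 1)).
    have c0 : 0 <= 4 * p * C1 * X ^- (d + 1).
      by rewrite !mulr_ge0 ?(ltW p0) ?(ltW C10) ?(ltW XX0).
    have [hh|hh] := leP (dotp x x) (4 * dotp (x - y) (x - y)).
      apply: (@le_trans _ _ (4 * p * C1 * X ^- (d + 1) * (enorm y * v))); last first.
        by apply: ler_wpM2l => //; rewrite lerDl.
      rewrite mulrA; apply: ler_wpM2r => //.
      apply: le_trans (hC1 (x - y) tau tau0) _.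
      apply: (@le_trans _ _ (C1 * (2 ^+ d * X ^- d))).
        apply: ler_wpM2l; first exact: ltW.
        by apply: invX_le => //; apply: br_ge_half => //; exact: ltW.
      have pE : p = 2 * 2 ^+ d by rewrite /p addn1 exprS.
      have -> : C1 * (2 ^+ d * X ^- d) = C1 * 2 ^+ d * X ^- (d + 1) * X.
        by rewrite XE; ring.
      have -> : 4 * p * C1 * X ^- (d + 1) * enorm y =
          C1 * 2 ^+ d * X ^- (d + 1) * (8 * enorm y) by rewrite pE; ring.
      apply: ler_wpM2l; last lra.
      by rewrite !mulr_ge0 ?(ltW C10) ?(ltW XX0)// exprn_ge0.
    apply: (@le_trans _ _ (4 * p * C1 * X ^- (d + 1) * (eps * b ^- (d + 1)))); last first.
      by apply: ler_wpM2l => //; rewrite lerDr.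
    have hv2 : v <= eps * (2 ^+ (d + 2) * X ^- (d + 2)).
      apply: le_trans hv _; apply: ler_wpM2l => //; rewrite exprVn.
      by apply: invX_le => //; lra.
    (* Near [x] the kernel has size [b ^- d], whose exponent is one short of [d + 1]. Since
       [t <= X ^+ 2], one factor [b] is worth [2 * X], which consumes one of the [d + 2] powers of
       decay in [hv2]. *)
    have hb : b <= 2 * X.
      rewrite -(@ler_pXn2r _ 2)// ?nnegrE ?mulr_ge0 ?(ltW b0) ?(ltW x0)//.
      rewrite exprMn br_sqr ?(ltW tau0)// enorm_sqr -/X.
      have := le_trans tau_le tx; rewrite /X enorm_sqr; lra.
    apply: (@le_trans _ _ (C1 * (2 * X * b ^- (d + 1)) * (eps * (2 ^+ (d + 2) * X ^- (d + 2))))).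
      apply: ler_pM => //.
      apply: le_trans (hC1 (x - y) tau tau0) _; apply: ler_wpM2l; first exact: ltW.
      rewrite -/b (_ : b ^- d = b * b ^- (d + 1)); last first.
        by rewrite addn1 exprS invfM mulrA mulfV ?mul1r// gt_eqF.
      by apply: ler_wpM2r => //; exact: ltW.
    rewrite le_eqVlt; apply/orP; left; apply/eqP.
    rewrite /p !exprD; move: (X ^+ d) (exprn_gt0 d x0) (b ^+ d) (exprn_gt0 d b0)
      (2 ^+ d : R) => Y Y0 Z Z0 W.
    by field; rewrite !gt_eqF.
  apply: (@le_trans _ _ (`|leray_kernel (x - y) tau j k| * v + `|leray_kernel x tau j k| * v)).
    by rewrite -mulrDl; apply: ler_wpM2r => //; exact: ler_normB.
  have t1' : 2 * C1 * X ^- (d + 1) * (enorm y * v) <=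
      2 * C1 * X ^- (d + 1) * (enorm y * v + eps * b ^- (d + 1)).
    by apply: ler_wpM2l; [rewrite !mulr_ge0 ?(ltW C10) ?(ltW XX0)|rewrite lerDl].
  have t3 : 0 <= C2 * X ^- (d + 1) * (enorm y * v + eps * b ^- (d + 1)).
    by rewrite !mulr_ge0 ?(ltW C20) ?(ltW XX0)// addr_ge0.
  move: t1 t2 t1' t3; rewrite !mulrDl; lra.
apply: (@le_trans _ _ (`|leray_kernel (x - y) tau j k - leray_kernel x tau j k| * v +
   `|leray_kernel x tau j k - kernelE x j k| * v)).
  rewrite -mulrDl; apply: ler_wpM2r => //.
  by apply: le_trans (ler_normD _ _); rewrite addrA subrK.
apply: le_trans (lerD T12 T3) _.
have r0 : 0 <= Num.sqrt t * v by rewrite mulr_ge0// sqrtr_ge0.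
have q0 : 0 <= enorm y * v + eps * b ^- (d + 1).
  by rewrite addr_ge0 ?mulr_ge0// ltW.
have u1 : 0 <= (C2 + 2 * C1 + 4 * p * C1) * X ^- (d + 1) * (Num.sqrt t * v).
  by apply: mulr_ge0 => //; apply: mulr_ge0; [have := mulr_gt0 p0 C10; lra|exact: ltW].
have u2 : 0 <= C3 * X ^- (d + 1) * (enorm y * v + eps * b ^- (d + 1)).
  by apply: mulr_ge0 => //; apply: mulr_ge0; exact: ltW.
rewrite /K [in leRHS]mulrDl [in leRHS]mulrDr [in leRHS]mulrDl [X in _ <= _ + X]mulrDl.
lra.
Qed.

End pointwise_bounds.

(** * The time integral behind the factor [Num.sqrt t] *)

Section time_integrals.
Context {R : realType}.

Lemma integral_time_le (t : R) : 0 < t ->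
  (\int[leb]_(s in `]0%R, t[) ((Num.sqrt (1 + s))^-1 + (Num.sqrt (t - s))^-1)%:E
    <= (4 * Num.sqrt t)%:E)%E.
Proof.
move=> t0.
have dom (s : R) : `]0, t[%classic s -> 0 < s /\ s < t by rewrite /= in_itv/= => /andP[].
have d1 (s : R) : 0 < s -> is_derive s 1 (fun s => Num.sqrt (1 + s)) ((2 * Num.sqrt (1 + s))^-1).
  move=> s0; have h1 : 0 < 1 + s by rewrite addr_gt0.
  have h2 : is_derive s 1 (fun s : R => 1 + s) 1.
    by apply: is_derive_eq; rewrite ?add0r ?mulr1.
  by have := @is_derive1_comp R Num.sqrt (fun s => 1 + s) s _ _ (is_derive1_sqrt h1) h2;
    rewrite mulr1.
have d2 (s : R) : s < t -> is_derive s 1 (fun s => Num.sqrt (t - s)) (- (2 * Num.sqrt (t - s))^-1).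
  move=> st; have h1 : 0 < t - s by rewrite subr_gt0.
  have h2 : is_derive s 1 (fun s : R => t - s) (- 1).
    by apply: is_derive_eq; ring.
  by have := @is_derive1_comp R Num.sqrt (fun s => t - s) s _ _ (is_derive1_sqrt h1) h2;
    rewrite mulrN1.
have p1 (s : R) : 0 < s -> 0 < Num.sqrt (1 + s) by move=> s0; rewrite sqrtr_gt0 addr_gt0.
have p2 (s : R) : s < t -> 0 < Num.sqrt (t - s) by move=> s0; rewrite sqrtr_gt0 subr_gt0.
apply: (@exhaustion_ge0_le R _ _ _
  (fun s => (Num.sqrt (1 + s))^-1 + (Num.sqrt (t - s))^-1)
  (fun s => 2 * Num.sqrt (1 + s) - 2 * Num.sqrt (t - s)) (exhaustion_oo t0)).
- move=> s /dom[s0 st].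
  have n1 : Num.sqrt (1 + s) != 0 by rewrite gt_eqF// p1.
  have n2 : Num.sqrt (t - s) != 0 by rewrite gt_eqF// p2.
  exact: is_derive_continuous (is_deriveD
    (@is_deriveV _ (fun s => Num.sqrt (1 + s)) s _ _ n1 (d1 s s0))
    (@is_deriveV _ (fun s => Num.sqrt (t - s)) s _ _ n2 (d2 s st))).
- move=> s /dom[s0 st]; have h1 := d1 s s0; have h2 := d2 s st.
  apply: is_derive_eq; rewrite /GRing.scale/=; field.
  by rewrite !gt_eqF ?p1 ?p2.
- by move=> s /dom[s0 st]; rewrite addr_ge0// invr_ge0 sqrtr_ge0.
- move=> n; set q := (t - 0) / n.+3%:R.
  have q0 : 0 < q by rewrite divr_gt0 ?subr0.
  have q3 : q <= t / 2.
    by rewrite /q subr0 ler_pM2l// lef_pV2 ?posrE// ler_nat.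
  have st0 := sqrtr_ge0 t.
  (* The 1 on the right is cancelled by the value at the lower endpoint, [h2]; this keeps the bound
     proportional to [Num.sqrt t] for small [t] as well. *)
  have h1 : Num.sqrt (1 + (t - q)) <= 1 + Num.sqrt t.
    rewrite -[leRHS]ger0_norm ?addr_ge0// -sqrtr_sqr ler_sqrt ?sqr_ge0//.
    rewrite sqrrD expr1n sqr_sqrtr ?(ltW t0)//; lra.
  have h2 : 1 <= Num.sqrt (1 + (0 + q)).
    rewrite -[leLHS]sqrtr1 ler_sqrt; lra.
  have h3 : 0 <= Num.sqrt (t - (t - q)) := sqrtr_ge0 _.
  have h4 : Num.sqrt (t - (0 + q)) <= Num.sqrt t by rewrite ler_sqrt; lra.
  lra.
Qed.

Lemma integral_timeZ_le (t c : R) : 0 < t -> 0 <= c ->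
  (\int[leb]_(s in `]0%R, t[)
     (c * ((Num.sqrt (1 + s))^-1 + (Num.sqrt (t - s))^-1))%:E
    <= (c * (4 * Num.sqrt t))%:E)%E.
Proof.
move=> t0 c0; under eq_integral do rewrite EFinM.
rewrite ge0_integralZl_EFin//; last first.
  apply/measurable_EFinP; apply: measurable_funTS; apply: measurable_funD;
    apply: measurable_funV; apply: measurable_fun_sqrt.
    exact: measurable_funD.
  exact: measurable_funB.
rewrite EFinM; apply: lee_wpmul2l; first by rewrite lee_fin.
exact: integral_time_le.
Qed.

End time_integrals.

(** * The Duhamel integral of the quadratic term *)

Section drift.
Context {R : realType}.
Variable d : nat.
Hypothesis d2 : (2 <= d)%N.
Implicit Types (x y : 'rV[R]_d).

(** Write [a] for the inverse of [1 + enorm y] and [b] for that of [Num.sqrt (1 + s)], both at most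
    1. The left side is the smaller of them to the power [2 * d], and [2 * d >= d + 2] leaves
    [d + 1] powers for [a] and one for [b]. *)
Lemma min_powR_sqr_le (y : 'rV[R]_d) (s : R) : 0 < s ->
  (Num.min ((1 + enorm y) `^ (- d%:R)) ((1 + s) `^ (- (d%:R / 2)))) ^+ 2 <=
  (1 + enorm y)^-1 ^+ d.+1 * (Num.sqrt (1 + s))^-1.
Proof.
move=> s0.
have y0 : 0 < 1 + enorm y by rewrite ltr_pwDl// enorm_ge0.
have s1 : 0 < 1 + s by rewrite addr_gt0.
have -> : (1 + enorm y) `^ (- d%:R) = (1 + enorm y)^-1 ^+ d.
  by rewrite powRN powR_mulrn ?(ltW y0)// exprVn.
have -> : (1 + s) `^ (- (d%:R / 2)) = (Num.sqrt (1 + s))^-1 ^+ d.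
  by rewrite powRN mulrC powRrM powR12_sqrt ?(ltW s1)// powR_mulrn ?sqrtr_ge0// exprVn.
have a1 : (1 + enorm y)^-1 <= 1 by rewrite invf_le1// lerDl enorm_ge0.
have a0 : 0 < (1 + enorm y)^-1 by rewrite invr_gt0.
have b1 : (Num.sqrt (1 + s))^-1 <= 1.
  by rewrite invf_le1 ?sqrtr_gt0// -[leLHS]sqrtr1 ler_sqrt ?(ltW s1)// lerDl ltW.
have b0 : 0 < (Num.sqrt (1 + s))^-1 by rewrite invr_gt0 sqrtr_gt0.
move: ((1 + enorm y)^-1) a0 a1 ((Num.sqrt (1 + s))^-1) b0 b1 => a a0 a1 b b0 b1.
have key (c : R) : 0 < c -> c <= 1 -> c ^+ d ^+ 2 <= c ^+ d.+1 * c.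
  move=> c0 c1; rewrite -exprM -exprSr; apply: ler_wiXn2l => //; [exact: ltW|lia].
have [ab|ba] := leP a b.
  have h : a ^+ d <= b ^+ d by apply: lerXn2r; rewrite ?nnegrE ?(ltW a0) ?(ltW b0).
  rewrite (min_idPl h); apply: le_trans (key a a0 a1) _.
  by apply: ler_wpM2l => //; rewrite exprn_ge0// ltW.
have h : b ^+ d <= a ^+ d.
  by apply: lerXn2r; rewrite ?nnegrE ?(ltW a0) ?(ltW b0)// ltW.
rewrite (min_idPr h); apply: le_trans (key b b0 b1) _.
apply: ler_wpM2r; first exact: ltW.
by apply: lerXn2r; rewrite ?nnegrE ?(ltW a0) ?(ltW b0)// ltW.
Qed.

Lemma integral_br_pair_le x (A w tau : R) : 0 <= A -> 0 <= w -> 0 < tau ->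
  (\int[lebesgue_rV d]_y
     (A * (w * br 1 (0 - y) ^- (d + 1) + br tau (x - y) ^- (d + 1)))%:E
    <= (A * (pi ^+ d * (w + (Num.sqrt tau)^-1)))%:E)%E.
Proof.
move=> A0 w0 tau0.
have mbr (a : R) (v : 'rV[R]_d) : measurable_fun setT (fun y => br a (v - y) ^- (d + 1)).
  apply: measurable_funV; apply: measurable_funX; apply: measurable_br => // i.
  exact: measurable_subl_coord.
have br0 (a : R) (v : 'rV[R]_d) : 0 <= br a v ^- (d + 1).
  by rewrite invr_ge0 exprn_ge0// sqrtr_ge0.
under eq_integral do rewrite EFinM.
rewrite ge0_integralZl_EFin//; last 2 first.
- by move=> y _; rewrite lee_fin; apply: addr_ge0 => //; exact: mulr_ge0.
- by apply/measurable_EFinP; apply: measurable_funD => //; exact: measurable_funM.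
rewrite [leRHS]EFinM; apply: lee_wpmul2l; first by rewrite lee_fin.
under eq_integral do rewrite EFinD EFinM.
rewrite ge0_integralD//; last 4 first.
- by move=> y _; rewrite -EFinM lee_fin; exact: mulr_ge0.
- by apply/measurable_EFinP; exact: measurable_funM.
- by move=> y _; rewrite lee_fin.
- exact/measurable_EFinP.
rewrite ge0_integralZl_EFin//; last 2 first.
- by move=> y _; rewrite lee_fin.
- exact/measurable_EFinP.
rewrite mulrDr EFinD; apply: leeD.
  rewrite mulrC EFinM; apply: lee_wpmul2l; first by rewrite lee_fin.
  apply: le_trans (@integral_br_le R d 1 1 0 isT ltr01) _.
  by rewrite sqrtr1 expr1 invr1 mulr1.
by apply: le_trans (@integral_br_le R d 1 tau x isT tau0) _; rewrite expr1.
Qed.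

Lemma drift_le (u : 'rV[R]_d -> R -> 'rV[R]_d) (M : R) (j : 'I_d) : 0 < M ->
  (forall y (s : R), 0 < s -> enorm (u y s) <= M *
     Num.min ((1 + enorm y) `^ (- d%:R)) ((1 + s) `^ (- (d%:R / 2)))) ->
  exists2 C : R, 0 < C & forall (t : R) x, 0 < t -> 0 < enorm x ->
    `|time_integral t (fun s =>
        leray_div_evol (t - s) (fun y => tensor_square (u y s)) x) ord0 j| <=
    C * enorm x ^- (d + 1) * Num.sqrt t.
Proof.
move=> M0 hu.
pose bound (hk : 'I_d * 'I_d) (C : R) := forall x y (t s B v : R),
  0 < s < t -> 0 < enorm x -> 0 <= B ->
  `|v| <= B * ((1 + enorm y)^-1 ^+ d.+1 * (Num.sqrt (1 + s))^-1) ->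
  `|partial hk.1 (fun z => leray_kernel z (t - s) j hk.2) (x - y) * v| <=
  C * B * enorm x ^- (d + 1) *
    ((Num.sqrt (1 + s))^-1 * br 1 (0 - y) ^- (d + 1) + br (t - s) (x - y) ^- (d + 1)).
have mono hk C C' : bound hk C -> C <= C' -> bound hk C'.
  move=> hC CC' x y t s B v st x0 B0 hv.
  apply: le_trans (hC x y t s B v st x0 B0 hv) _.
  apply: ler_wpM2r.
    by rewrite addr_ge0 ?mulr_ge0 ?invr_ge0 ?exprn_ge0 ?sqrtr_ge0 // sqrtr_ge0.
  apply: ler_wpM2r; first by rewrite invr_ge0 exprn_ge0// ltW.
  exact: ler_wpM2r.
have [C C0 hC] := uniform_const mono (fun hk => drift_pointwise d2 j hk.1 hk.2).
pose c := C * M ^+ 2.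
have c0 : 0 < c by rewrite mulr_gt0// exprn_gt0.
exists (d%:R * (d%:R * (c * pi ^+ d)) * 4) => [|t x t0 x0].
  by rewrite !mulr_gt0 ?ltr0n ?exprn_gt0 ?pi_gt0// (leq_trans _ d2).
have X0 : 0 < enorm x ^- (d + 1) by rewrite invr_gt0 exprn_gt0.
set X := enorm x ^- (d + 1) in X0 *.
rewrite mxE.
pose K := d%:R * (d%:R * (c * pi ^+ d)) * X.
(* The constant collects the double sum over [h] and [k], the space integral [pi ^+ d] and the
   pointwise constant [c]; the last factor 4 comes from the time integral. *)
have K0 : 0 <= K.
  have pd0 : 0 <= pi ^+ d :> R by rewrite exprn_ge0// pi_ge0.
  by apply: mulr_ge0 (ltW X0); do 2 apply: mulr_ge0 => //; exact: mulr_ge0 (ltW c0) pd0.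
rewrite (_ : _ * 4 * X * Num.sqrt t = K * (4 * Num.sqrt t)); last by rewrite /K; ring.
apply: normr_Rintegral_le (integral_timeZ_le t0 K0) => s /=.
rewrite in_itv/= => /andP[s0 st]; rewrite mxE.
have tau0 : 0 < t - s by rewrite subr_gt0.
set E := (Num.sqrt (1 + s))^-1 + (Num.sqrt (t - s))^-1.
have E0 : 0 <= E by rewrite addr_ge0// invr_ge0 sqrtr_ge0.
have one h k : `|\int[lebesgue_rV d]_y
     (partial h (fun z => leray_kernel z (t - s) j k) (x - y) *
      tensor_square (u y s) h k)| <= c * pi ^+ d * X * E.
  apply: (@normr_Rintegral_le _ _ _ _ _ _ (fun y => C * M ^+ 2 * X *
    ((Num.sqrt (1 + s))^-1 * br 1 (0 - y) ^- (d + 1) + br (t - s) (x - y) ^- (d + 1)))).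
    move=> y _; apply: (hC (h, k)); rewrite ?s0 ?sqr_ge0// mxE normrM.
    apply: (@le_trans _ _ (enorm (u y s) ^+ 2)).
      by rewrite expr2; apply: ler_pM => //; exact: coord_le_enorm.
    apply: (@le_trans _ _ ((M * Num.min ((1 + enorm y) `^ (- d%:R))
        ((1 + s) `^ (- (d%:R / 2)))) ^+ 2)).
      apply: lerXn2r; rewrite ?nnegrE ?enorm_ge0//; last exact: hu.
      by apply: le_trans (enorm_ge0 _) (hu y s s0).
    rewrite exprMn; apply: ler_wpM2l; first exact: sqr_ge0.
    exact: min_powR_sqr_le.
  rewrite (_ : c * pi ^+ d * X * E = (c * X) * (pi ^+ d * E)); last first.
    by rewrite -[RHS]mulrA [X * (_ * E)]mulrCA !mulrA.
  have s0' : 0 <= (Num.sqrt (1 + s))^-1 by rewrite invr_ge0 sqrtr_ge0.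
  exact: integral_br_pair_le (mulr_ge0 (ltW c0) (ltW X0)) s0' tau0.
rewrite (_ : K * E = \sum_(h < d) \sum_(k < d) (c * pi ^+ d * X * E)); last first.
  set q := c * _ * X * E.
  by rewrite !sumr_const !card_ord -(mulr_natl q d) -(mulr_natl (d%:R * q) d) /K /q !mulrA.
apply: le_trans (ler_norm_sum _ _ _) _; apply: ler_sum => h _.
by apply: le_trans (ler_norm_sum _ _ _) _; apply: ler_sum => k _; exact: one.
Qed.

End drift.

(** * The Duhamel integral of the force and its leading term *)

Section force.
Context {R : realType}.
Variable d : nat.
Hypothesis d2 : (2 <= d)%N.
Implicit Types (x y : 'rV[R]_d).

Let P := ('rV[R]_d * measurableTypeR R)%type.
Let mu := (lebn d \x (@lebesgue_measure R))%E.
Let mu' : {measure set P -> \bar R} := (lebn d \x (@lebesgue_measure R))%E.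

(** Joint measurability in space-time is read off the defining Fourier integral, a parameter
    integral of a measurable function; this covers [z.2 >= t], where that integral may diverge. *)
Lemma measurable_leray_kernel x (t : R) j k :
  measurable_fun setT (fun z : P => leray_kernel (x - z.1) (t - z.2) j k).
Proof.
under eq_fun do rewrite mxE.
apply: measurable_funM => //.
pose F (w : P * 'rV[R]_d) : R :=
  cos (dotp (x - w.1.1) w.2) * leray_symbol w.2 (t - w.1.2) j k.
have mc1 i : measurable_fun setT (fun w : P * 'rV[R]_d => (x - w.1.1) ord0 i).
  have := measurable_subl_coord x i => h.
  by apply: (measurableT_comp h); apply: (measurableT_comp measurable_fst).
have mc2 i : measurable_fun setT (fun w : P * 'rV[R]_d => w.2 ord0 i).
  exact: (measurableT_comp (@measurable_coord R d i) measurable_snd).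
have mt : measurable_fun setT (fun w : P * 'rV[R]_d => t - w.1.2).
  apply: measurable_funB => //.
  exact: (measurableT_comp measurable_snd measurable_fst).
have men : measurable_fun setT (fun w : P * 'rV[R]_d => enorm w.2 ^+ 2).
  by apply: measurable_funX; exact: measurable_enorm.
have mF : measurable_fun setT F.
  apply: measurable_funM; first by apply: measurable_fun_cos; exact: measurable_dotp.
  under eq_fun do rewrite mxE.
  apply: measurable_funM.
    apply: measurable_fun_expR; apply: measurableT_comp => //.
    exact: measurable_funM.
  apply: measurable_funB => //; apply: measurable_funM; first exact: measurable_funM.
  exact: measurable_funV.
exact: (@measurable_Rintegral _ _ _ _ R (lebn d) F mF).
Qed.

Variables (eps : R) (f : 'rV[R]_d -> R -> 'rV[R]_d).
Hypothesis hf : force_condition eps f.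

Section fixed_time.
Variable t : R.
Hypothesis t0 : 0 < t.

Let D : set P := setT `*` `]0, t[%classic.

Let mD : measurable D.
Proof. by apply: measurableX => //; exact: measurable_itv. Qed.

Let DE (z : P) : D z -> 0 < z.2 < t.
Proof. by move=> [_] /=; rewrite in_itv. Qed.

(** Extension by 0 outside the slab makes the force measurable on the whole product space, so that
    Fubini applies without restricting the domain. *)
Let Fk k : P -> R := (fun z => f z.1 z.2 ord0 k) \_ D.
Let FE : P -> R := (fun z => enorm (f z.1 z.2)) \_ D.

Let mfk k : measurable_fun D (fun z => f z.1 z.2 ord0 k).
Proof.
case: hf => mf _ _ _.
have h : measurable_fun D (fun z : P => f z.1 z.2).
  apply: measurable_funS mf.
    have -> : [set z : P | 0 <= z.2] = setT `*` `[0, +oo[%classic.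
      by apply/seteqP; split => z /=; rewrite ?in_itv/= ?andbT; [|case].
    by apply: measurableX => //; exact: measurable_itv.
  by move=> z /DE/andP[/ltW].
exact: (measurableT_comp (@measurable_coord R d k) h).
Qed.

Let mFk k : measurable_fun setT (Fk k).
Proof. exact/(measurable_restrictT _ mD). Qed.

Let mFE : measurable_fun setT FE.
Proof.
apply/(measurable_restrictT _ mD) => //.
apply: measurable_fun_sqrt; apply: measurable_sum => i.
by apply: measurable_funM.
Qed.

Let FkE k z : `|Fk k z| <= FE z.
Proof.
rewrite /Fk /FE !patchE; case: ifPn => _; first exact: coord_le_enorm.
by rewrite normr0.
Qed.

Let FE0 z : 0 <= FE z.
Proof. by rewrite /FE patchE; case: ifPn => // _; exact: enorm_ge0. Qed.

Let integral_FE : (\int[mu]_z (FE z)%:E <= eps%:E)%E.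
Proof.
case: hf => _ _ h _; apply: le_trans h.
rewrite [leRHS]integral_mkcond; apply: ge0_integral_mono => z _; first by rewrite lee_fin.
rewrite /FE !patchE; case: ifPn => [|_].
  rewrite inE => /DE/andP[/ltW z0 _].
  by rewrite mem_set.
by case: ifPn => // _; rewrite lee_fin enorm_ge0.
Qed.

Let eps_ge0 : 0 <= eps.
Proof.
by rewrite -lee_fin; apply: le_trans integral_FE; apply: integral_ge0 => z _; rewrite lee_fin.
Qed.

Let integrable_Fk k : mu.-integrable setT (EFin \o Fk k).
Proof.
by apply: integrable_of_le integral_FE => // z _.
Qed.

Let N x (z : P) : R := (fun z : P => br (t - z.2) (x - z.1) ^- (d + 1)) \_ D z.

Let N0 x z : 0 <= N x z.
Proof.
by rewrite /N patchE; case: ifPn => // _; rewrite invr_ge0 exprn_ge0// sqrtr_ge0.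
Qed.

Let mN x : measurable_fun setT (N x).
Proof.
apply/(measurable_restrictT _ mD) => //; apply: measurable_funTS.
apply: measurable_funV; apply: measurable_funX; apply: measurable_br => [i|].
  exact: (measurableT_comp (measurable_subl_coord x i) measurable_fst).
by apply: measurable_funB => //; exact: measurable_snd.
Qed.

(** By Tonelli, [integral_br_le] with one surplus power leaves the inverse square root of [t - s],
    one of the two terms of [integral_timeZ_le]. In [integral_yFE] the first-moment hypothesis
    supplies the other one. *)
Let integral_N x : (\int[mu]_z (N x z)%:E <= (pi ^+ d * (4 * Num.sqrt t))%:E)%E.
Proof.
rewrite (fubini_tonelli2 (fun z => (N x z)%:E)); last 2 first.
- exact/measurable_EFinP.
- by move=> z; rewrite lee_fin.
have pd0 : 0 <= pi ^+ d :> R by rewrite exprn_ge0// pi_ge0.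
apply: le_trans (integral_timeZ_le t0 pd0).
rewrite [leRHS]integral_mkcond; apply: ge0_integral_mono => s _.
  by apply: integral_ge0 => y _; rewrite lee_fin.
rewrite patchE; case: ifPn => [|sD]; last first.
  rewrite /fubini_G integral0_eq// => y _; rewrite /N patchE ifN//.
  by apply: contra sD; rewrite !inE => -[].
rewrite inE/= in_itv/= => /andP[s0 st].
have tau0 : 0 < t - s by rewrite subr_gt0.
apply: (@le_trans _ _ (\int[lebesgue_rV d]_y (br (t - s) (x - y) ^- (d + 1))%:E)%E).
  apply: ge0_integral_mono => y _; rewrite lee_fin//.
  rewrite /N patchE; case: ifPn => // _.
  by rewrite invr_ge0 exprn_ge0// sqrtr_ge0.
apply: le_trans (@integral_br_le R d 1 (t - s) x isT tau0) _.
rewrite lee_fin expr1; apply: ler_wpM2l => //.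
by rewrite lerDr invr_ge0 sqrtr_ge0.
Qed.

Let integral_yFE (Cf : R) : 0 < Cf -> (forall s : R, 0 <= s ->
    (\int[lebesgue_rV d]_y (enorm y * enorm (f y s))%:E
      <= (Cf * (1 + s) `^ (- 2^-1))%:E)%E) ->
  (\int[mu]_z (enorm z.1 * FE z)%:E <= (Cf * (4 * Num.sqrt t))%:E)%E.
Proof.
move=> Cf0 hCf.
rewrite (fubini_tonelli2 (fun z : P => (enorm z.1 * FE z)%:E)); last 2 first.
- apply/measurable_EFinP; apply: measurable_funM => //; apply: measurable_enorm => i.
  exact: (measurableT_comp (@measurable_coord R d i) measurable_fst).
- by move=> z; rewrite lee_fin mulr_ge0// enorm_ge0.
apply: le_trans (integral_timeZ_le t0 (ltW Cf0)).
rewrite [leRHS]integral_mkcond; apply: ge0_integral_mono => s _.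
  by apply: integral_ge0 => y _; rewrite lee_fin mulr_ge0// enorm_ge0.
rewrite patchE; case: ifPn => [|sD]; last first.
  rewrite /fubini_G integral0_eq// => y _; rewrite /FE patchE ifN ?mulr0//.
  by apply: contra sD; rewrite !inE => -[].
rewrite inE/= in_itv/= => /andP[s0 st].
apply: (@le_trans _ _ (\int[lebesgue_rV d]_y (enorm y * enorm (f y s))%:E)%E).
  apply: ge0_integral_mono => y _; rewrite lee_fin; first by rewrite mulr_ge0// enorm_ge0.
  apply: ler_wpM2l; first exact: enorm_ge0.
  by rewrite /FE patchE; case: ifPn => // _; exact: enorm_ge0.
apply: le_trans (hCf s (ltW s0)) _.
rewrite lee_fin; apply: ler_wpM2l; first exact: ltW.
rewrite powRN powR12_sqrt ?addr_ge0 ?(ltW s0)//.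
by rewrite lerDl invr_ge0 sqrtr_ge0.
Qed.

Let ae_FE : {ae mu, forall z, FE z <= eps * (1 + enorm z.1)^-1 ^+ (d + 2)}.
Proof.
case: hf => _ h _ _.
(* The same statement with the measure in its sigma-finite form [lebn d]. *)
have {}h : {ae (lebn d \x (@lebesgue_measure R))%E, forall z, 0 <= z.2 ->
    enorm (f z.1 z.2) <= eps * Num.min ((1 + enorm z.1) `^ (- (d%:R + 2)))
      ((1 + z.2) `^ (- ((d%:R + 2) / 2)))} := h.
apply: (@filterS _ _ (ae_filter_ringOfSetsType mu') _ _ _ h) => z hz.
have y1 : 0 < 1 + enorm z.1 by rewrite ltr_pwDl// enorm_ge0.
rewrite /FE patchE; case: ifPn => [|_]; last first.
  by rewrite mulr_ge0 ?eps_ge0// exprn_ge0// invr_ge0 ltW.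
rewrite inE => /DE/andP[/ltW z0 _]; apply: le_trans (hz z0) _.
apply: ler_wpM2l; first exact: eps_ge0.
rewrite ge_min; apply/orP; left.
by rewrite powRN -natrD powR_mulrn ?(ltW y1)// exprVn.
Qed.

(** Since [kernelE x] does not depend on the point of integration, the whole difference is one
    integral of a kernel difference against the force, to which the pointwise bound applies. The
    integrability in time is returned as well: it is needed to sum over [k]. *)
Lemma force_term_le (C Cf : R) x j k : 0 < C -> 0 < Cf ->
  (forall s : R, 0 <= s ->
    (\int[lebesgue_rV d]_y (enorm y * enorm (f y s))%:E
      <= (Cf * (1 + s) `^ (- 2^-1))%:E)%E) ->
  (forall y (s v : R), 0 < s < t ->
    0 <= v <= eps * (1 + enorm y)^-1 ^+ (d + 2) ->
    `|leray_kernel (x - y) (t - s) j k - kernelE x j k| * v <=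
    C * (enorm y * v + eps * br (t - s) (x - y) ^- (d + 1) + Num.sqrt t * v)) ->
  leb.-integrable `]0, t[ (EFin \o (fun s =>
    \int[lebesgue_rV d]_y (leray_kernel (x - y) (t - s) j k * f y s ord0 k))) /\
  `|\int[leb]_(s in `]0, t[) \int[lebesgue_rV d]_y
      (leray_kernel (x - y) (t - s) j k * f y s ord0 k) -
    kernelE x j k * \int[leb]_(s in `]0, t[) \int[lebesgue_rV d]_y f y s ord0 k|
  <= C * (Cf * 4 + eps * (pi ^+ d * 4) + eps) * Num.sqrt t.
Proof.
move=> C0 Cf0 hCf hC.
pose g z := (leray_kernel (x - z.1) (t - z.2) j k - kernelE x j k) * Fk k z.
pose h z := C * (enorm z.1 * FE z + eps * N x z + Num.sqrt t * FE z).
have mK := measurable_leray_kernel x t j k.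
have mg : measurable_fun setT g.
  apply: measurable_funM; last exact: mFk.
  by apply: measurable_funB; [exact: mK|exact: measurable_cst].
have me1 : measurable_fun setT (fun z : P => enorm z.1).
  apply: measurable_enorm => i.
  exact: (measurableT_comp (@measurable_coord R d i) measurable_fst).
have m1 : measurable_fun setT (fun z : P => enorm z.1 * FE z) by exact: measurable_funM.
have m2 : measurable_fun setT (fun z : P => eps * N x z) by exact: measurable_funM.
have m3 : measurable_fun setT (fun z : P => Num.sqrt t * FE z) by exact: measurable_funM.
have p1 z : 0 <= enorm z.1 * FE z by rewrite mulr_ge0// enorm_ge0.
have p2 z : 0 <= eps * N x z by rewrite mulr_ge0// eps_ge0.
have p3 z : 0 <= Num.sqrt t * FE z by rewrite mulr_ge0// sqrtr_ge0.
have mh : measurable_fun setT h.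
  by apply: measurable_funM => //; apply: measurable_funD => //; exact: measurable_funD.
have h0 z : 0 <= h z by rewrite mulr_ge0 ?(ltW C0)// !addr_ge0.
have gh : {ae mu, forall z, `|g z| <= h z}.
  apply: (@filterS _ _ (ae_filter_ringOfSetsType mu') _ _ _ ae_FE) => z hz; rewrite /g /h normrM.
  have [zD|zD] := boolP (z \in D); last first.
    by rewrite /Fk patchE (negbTE zD) normr0 mulr0; exact: h0.
  apply: (@le_trans _ _ (`|leray_kernel (x - z.1) (t - z.2) j k - kernelE x j k| * FE z)).
    by apply: ler_wpM2l.
  have -> : N x z = br (t - z.2) (x - z.1) ^- (d + 1) by rewrite /N patchE zD.
  by apply: hC; [apply: DE; exact: set_mem|rewrite FE0].
have hM : (\int[mu]_z (h z)%:E <=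
    (C * (Cf * 4 + eps * (pi ^+ d * 4) + eps) * Num.sqrt t)%:E)%E.
  rewrite /h; under eq_integral do rewrite EFinM.
  rewrite ge0_integralZl_EFin ?(ltW C0)//; last 2 first.
  - by move=> z _; rewrite lee_fin !addr_ge0.
  - by apply/measurable_EFinP; apply: measurable_funD => //; exact: measurable_funD.
  rewrite -mulrA EFinM; apply: lee_wpmul2l; first by rewrite lee_fin ltW.
  under eq_integral do rewrite !EFinD.
  rewrite ge0_integralD//; last 4 first.
  - by move=> z _; rewrite adde_ge0// lee_fin.
  - by apply: emeasurable_funD; exact/measurable_EFinP.
  - by move=> z _; rewrite lee_fin.
  - exact/measurable_EFinP.
  rewrite ge0_integralD//; last 4 first.
  - by move=> z _; rewrite lee_fin.
  - exact/measurable_EFinP.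
  - by move=> z _; rewrite lee_fin.
  - exact/measurable_EFinP.
  rewrite !mulrDl !EFinD; apply: leeD; first apply: leeD.
  - by rewrite -mulrA; exact: integral_yFE.
  - under eq_integral do rewrite EFinM.
    rewrite ge0_integralZl_EFin ?eps_ge0//; last 2 first.
    + by move=> z _; rewrite lee_fin.
    + exact/measurable_EFinP.
    rewrite -!mulrA EFinM; apply: lee_wpmul2l; first by rewrite lee_fin eps_ge0.
    exact: integral_N.
  - under eq_integral do rewrite EFinM.
    rewrite ge0_integralZl_EFin ?sqrtr_ge0//; last 2 first.
    + by move=> z _; rewrite lee_fin.
    + exact/measurable_EFinP.
    rewrite mulrC EFinM; apply: lee_wpmul2l; first by rewrite lee_fin sqrtr_ge0.
    exact: integral_FE.
have [gi gM] := @normr_Rintegral_le_ae _ P R mu' g h _ mg mh gh hM h0.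
have iF := integrable_Fk k.
have ikF := integrable_EFinZl (kernelE x j k) measurableT iF.
pose KF z := leray_kernel (x - z.1) (t - z.2) j k * Fk k z.
(* The term with the full kernel is the difference [g] plus a constant times the force, both
   integrable. *)
have iK : mu.-integrable setT (EFin \o KF).
  apply: (@eq_integrable _ P R mu' setT measurableT
    (fun z => (g z)%:E + (kernelE x j k * Fk k z)%:E)%E).
    by move=> z _; rewrite /KF /g /= -EFinD mulrBl subrK.
  exact: integrableD.
have slice (c : R -> 'rV[R]_d -> R) : (fun s => \int[lebesgue_rV d]_y
     (c s y * f y s ord0 k)) \_ `]0, t[ = fun s => \int[lebesgue_rV d]_y
     (c s y * Fk k (y, s)).
  apply/funext => s; rewrite patchE; case: ifPn => sD.
    apply: eq_Rintegral => y _; rewrite /Fk patchE mem_set//.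
    by split => //; exact: set_mem.
  rewrite /Rintegral integral0_eq// => y _; rewrite /Fk patchE ifN ?mulr0//.
  by apply: contra sD; rewrite !inE => -[].
have iK2 := integrable_Rintegral2 iK.
have mt : measurable (`]0, t[%classic : set (measurableTypeR R)) by exact: measurable_itv.
have sliceK := slice (fun s y => leray_kernel (x - y) (t - s) j k).
have sliceF : (fun s => \int[lebesgue_rV d]_y f y s ord0 k) \_ `]0, t[ =
    fun s => \int[lebesgue_rV d]_y Fk k (y, s).
  have -> : (fun s => \int[lebesgue_rV d]_y f y s ord0 k) =
      fun s => \int[lebesgue_rV d]_y (1 * f y s ord0 k).
    by apply/funext => s; apply: eq_Rintegral => y _; rewrite mul1r.
  rewrite (slice (fun _ _ => 1)).
  by apply/funext => s; apply: eq_Rintegral => y _; rewrite mul1r.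
split.
  by apply/(integrable_mkcond _ mt); rewrite restrict_EFin sliceK.
rewrite [X in X - _]Rintegral_mkcond sliceK [X in _ * X]Rintegral_mkcond sliceF.
rewrite (Rintegral_prod2 iK) (Rintegral_prod2 iF).
rewrite -(@RintegralZl _ P R mu' setT (Fk k) (kernelE x j k) measurableT iF).
rewrite -(@RintegralB _ P R mu' setT KF _ measurableT iK ikF).
apply: le_trans gM; rewrite le_eqVlt; apply/orP; left; apply/eqP; congr (`|_|).
by apply: eq_Rintegral => z _; rewrite /KF /g mulrBl.
Qed.

End fixed_time.

End force.

(** * Assembling the remainder *)

Section remainder.
Context {R : realType}.
Variable d : nat.
Hypothesis d2 : (2 <= d)%N.
Implicit Types (x y : 'rV[R]_d).

Lemma force_le (eps : R) (f : 'rV[R]_d -> R -> 'rV[R]_d) (j : 'I_d) :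
  0 < eps -> force_condition eps f ->
  exists2 C : R, 0 < C & forall (t : R) x, 0 < t -> 0 < enorm x -> t <= enorm x ^+ 2 ->
    `|time_integral t (fun s => leray_evol (t - s) (f ^~ s) x) ord0 j -
      \sum_k kernelE x j k * time_integral t (fun s => space_integral (f ^~ s)) ord0 k| <=
    C * enorm x ^- (d + 1) * Num.sqrt t.
Proof.
move=> eps0 hf; have [_ _ _ [Cf Cf0 hCf]] := hf.
pose bound k (C : R) := forall x y (t s v : R),
  0 < s < t -> 0 < enorm x -> t <= enorm x ^+ 2 ->
  0 <= v <= eps * (1 + enorm y)^-1 ^+ (d + 2) ->
  `|leray_kernel (x - y) (t - s) j k - kernelE x j k| * v <=
  C * enorm x ^- (d + 1) *
    (enorm y * v + eps * br (t - s) (x - y) ^- (d + 1) + Num.sqrt t * v).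
have mono k C C' : bound k C -> C <= C' -> bound k C'.
  move=> hC CC' x y t s v st x0 tx /[dup] /andP[v0 _] hv.
  apply: le_trans (hC x y t s v st x0 tx hv) _.
  apply: ler_wpM2r.
    have p1 : 0 <= enorm y * v by rewrite mulr_ge0 ?enorm_ge0.
    have p2 : 0 <= eps * br (t - s) (x - y) ^- (d + 1).
      by rewrite mulr_ge0 ?(ltW eps0)// invr_ge0 exprn_ge0// sqrtr_ge0.
    have p3 : 0 <= Num.sqrt t * v by rewrite mulr_ge0 ?sqrtr_ge0.
    by rewrite addr_ge0// addr_ge0.
  by apply: ler_wpM2r => //; rewrite invr_ge0 exprn_ge0// ltW.
have ex k : exists2 C : R, 0 < C & bound k C.
  have [C C0 hC] := @force_pointwise R d d2 j k; exists C => // x y t s v.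
  exact: hC.
have [C C0 hC] := uniform_const mono ex.
pose B := Cf * 4 + eps * (pi ^+ d * 4) + eps.
have B0 : 0 < B.
  have pd0 : 0 <= pi ^+ d :> R by rewrite exprn_ge0// pi_ge0.
  have h1 : 0 <= eps * (pi ^+ d * 4) by rewrite mulr_ge0 ?(ltW eps0)// mulr_ge0.
  have h2 : 0 < Cf * 4 by rewrite mulr_gt0.
  rewrite /B; lra.
exists (d%:R * (C * B)) => [|t x t0 x0 tx].
  by rewrite mulr_gt0 ?ltr0n ?(leq_trans _ d2)// mulr_gt0.
have X0 : 0 < enorm x ^- (d + 1) by rewrite invr_gt0 exprn_gt0.
pose c := C * enorm x ^- (d + 1).
have c0 : 0 < c by rewrite mulr_gt0.
have term k := @force_term_le R d eps f hf t t0 c Cf x j k c0 Cf0 hCf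
  (fun y s v st hv => hC k x y t s v st x0 tx hv).
have mt : measurable (`]0, t[%classic : set (measurableTypeR R)) by exact: measurable_itv.
rewrite mxE; under eq_Rintegral do rewrite mxE.
rewrite (Rintegral_ord_sum mt (fun k => (term k).1)).1 -sumrB.
apply: le_trans (ler_norm_sum _ _ _) _.
rewrite (_ : _ * _ * Num.sqrt t = \sum_(k < d) (c * B * Num.sqrt t)); last first.
  rewrite sumr_const card_ord -(mulr_natl (c * B * Num.sqrt t) d) /c.
  have E (n X B' q : R) : n * (C * B') * X * q = n * (C * X * B' * q) by ring.
  exact: E.
apply: ler_sum => k _; rewrite [time_integral _ _ _ _]mxE.
under [X in _ * X]eq_Rintegral do rewrite mxE.
exact: (term k).2.
Qed.

Lemma remainder_le (eps : R) (a : 'rV[R]_d -> 'rV[R]_d)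
    (f u : 'rV[R]_d -> R -> 'rV[R]_d) (j : 'I_d) :
  0 < eps -> force_condition eps f -> strong_solution eps a f u ->
  exists2 C : R, 0 < C & forall (t : R) x, 0 < t -> 0 < enorm x -> t <= enorm x ^+ 2 ->
    `|(u x t - heat_evol t a x -
       (kernelE x *m (time_integral t (fun s => space_integral (f ^~ s)))^T)^T) ord0 j| <=
    C * enorm x ^- (d + 1) * Num.sqrt t.
Proof.
move=> eps0 hf [_ [Cu Cu0 hCu] mild _ _].
have M0 : 0 < Cu * eps by rewrite mulr_gt0.
have [C1 C10 h1] := @drift_le R d d2 u (Cu * eps) j M0 (fun y s s0 => hCu y s s0).
have [C2 C20 h2] := force_le j eps0 hf.
exists (C1 + C2) => [|t x t0 x0 tx]; first by rewrite addr_gt0.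
have {}h1 := h1 t x t0 x0; have {}h2 := h2 t x t0 x0 tx.
rewrite mild// /mild_rhs.
set T1 := time_integral _ _ in h1 *; set T2 := time_integral _ _ in h2 *.
set T3 := time_integral _ _ in h2 *; set H := heat_evol _ _ _.
have -> : H - T1 + T2 - H - (kernelE x *m T3^T)^T = - T1 + (T2 - (kernelE x *m T3^T)^T).
  by rewrite -(addrA H (- T1)) [H + _]addrC addrK addrA.
rewrite mxE [X in _ + X]mxE.
have -> : (- (kernelE x *m T3^T)^T) ord0 j = - \sum_k kernelE x j k * T3 ord0 k.
  by rewrite !mxE; congr (- _); apply: eq_bigr => k _; rewrite [in T3^T _ _]mxE.
apply: le_trans (ler_normD _ _) _; rewrite [(- T1) _ _]mxE normrN !mulrDl.
exact: lerD.
Qed.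

End remainder.

Theorem theorem1 (R : realType) (d : nat) (hd : (2 <= d)%N) (eps : R)
    (eps_gt0 : 0 < eps)
    (f : 'rV[R]_d -> R -> 'rV[R]_d) (hf : force_condition eps f)
    (a : 'rV[R]_d -> 'rV[R]_d) (ha : datum_condition eps a)
    (u : 'rV[R]_d -> R -> 'rV[R]_d) (hu : unique_strong_solution eps a f u)
    (remainder : 'rV[R]_d -> R -> 'rV[R]_d)
    (hremainder : forall (x : 'rV[R]_d) (t : R), x != 0 -> 0 < t ->
      u x t = heat_evol t a x
        + (kernelE x *m (time_integral t (fun s => space_integral (f ^~ s)))^T)^T
        + remainder x t) :
  exists2 C : R, 0 < C & forall (t : R) (x : 'rV[R]_d),
    0 < t -> expR 1 * Num.sqrt t <= enorm x ->
    enorm (remainder x t) <= C * enorm x ^- (d + 1) * Num.sqrt t.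
Proof.
pose bound j (C : R) := forall (t : R) (x : 'rV[R]_d),
  0 < t -> 0 < enorm x -> t <= enorm x ^+ 2 ->
    `|(u x t - heat_evol t a x -
       (kernelE x *m (time_integral t (fun s => space_integral (f ^~ s)))^T)^T) ord0 j| <=
    C * enorm x ^- (d + 1) * Num.sqrt t.
have mono j C C' : bound j C -> C <= C' -> bound j C'.
  move=> hC CC' t x t0 x0 tx; apply: le_trans (hC t x t0 x0 tx) _.
  apply: ler_wpM2r; first exact: sqrtr_ge0.
  by apply: ler_wpM2r => //; rewrite invr_ge0 exprn_ge0// ltW.
have [C C0 hC] := uniform_const mono (fun j => remainder_le hd j eps_gt0 hf hu.1).
exists (d%:R * C) => [|t x t0 tx].
  by rewrite mulr_gt0 ?ltr0n ?(leq_trans _ hd).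
have st0 : 0 < Num.sqrt t by rewrite sqrtr_gt0.
(* As [expR 1 >= 1], this places [x] in the regime [t <= enorm x ^+ 2] where the kernel is
   comparable with [kernelE x]. *)
have stx : Num.sqrt t <= enorm x.
  apply: le_trans tx; rewrite ler_peMl ?(ltW st0)//.
  by apply: le_trans (expR_ge1Dx 1); rewrite lerDl.
have x0 : 0 < enorm x by exact: lt_le_trans stx.
have tx2 : t <= enorm x ^+ 2.
  rewrite -[leLHS](sqr_sqrtr (ltW t0)).
  by apply: lerXn2r => //; rewrite nnegrE ltW.
have xn0 : x != 0.
  apply: contraTneq x0 => ->; rewrite -leNgt /enorm /dotp big1 ?sqrtr0// => i _.
  by rewrite mxE mul0r.
have X0 : 0 <= enorm x ^- (d + 1) by rewrite invr_ge0 exprn_ge0// ltW.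
rewrite -!mulrA; apply: enorm_le_coord => [|j].
  by rewrite mulr_ge0 ?(ltW C0)// mulr_ge0 ?(ltW st0).
have -> : remainder x t = u x t - heat_evol t a x -
    (kernelE x *m (time_integral t (fun s => space_integral (f ^~ s)))^T)^T.
  by rewrite hremainder// addrAC [X in X - _]addrAC addrK addrAC subrr add0r.
by rewrite mulrA; exact: hC.
Qed.
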